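(* For all $p \in [1,\infty)\setminus 2\mathbb{Z}$, all integers $k > \max\{2,p\}$, and all $1 - 2^{-k} < s \le c \le 1$, there exists a polynomial-time (Karp) reduction from $(s,c)$-Gap-$k$-SAT instances on $n$ variables to $\gamma$-$\mathrm{CVP}_p$ instances of rank $n$, with $\gamma=\gamma(p,k,s,c)$ satisfying \[ \gamma \ge 1 + \frac{2^{k-1}}{2^k-1}\cdot (c-s)\cdot \frac{|\sin(\pi p/2)|}{4p^3k}\cdot\Big(\frac{2p}{e^2\pi^2k}\Big)^{(p+1)/2}. \] In particular, for all $p\in[1,\infty)\setminus 2\mathbb{Z}$ and every $\varepsilon>0$ there exists $\gamma = \gamma(p,\varepsilon,s,c) > 1$ such that there is no $2^{(1-\varepsilon)n}$-time algorithm for $\gamma$-$\mathrm{CVP}_p$ (on lattices of rank $n$) assuming Gap-SETH.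
   Context: For $1\le p<\infty$, $\|\vec x\|_p=(\sum_i|x_i|^p)^{1/p}$. A lattice of rank $n$ is $B\mathbb{Z}^n$ for $B\in\mathbb{R}^{d\times n}$ with linearly independent columns, and $\mathrm{dist}_p(\mathcal{L},\vec t)=\min_{\vec x\in\mathcal{L}}\|\vec x-\vec t\|_p$. $\gamma$-$\mathrm{CVP}_p$: given $B$, $\vec t$, $r>0$, distinguish $\mathrm{dist}_p(B\mathbb{Z}^n,\vec t)\le r$ (YES) from $\mathrm{dist}_p(B\mathbb{Z}^n,\vec t)>\gamma r$ (NO). A $k$-SAT instance is a conjunction of $m$ clauses, each a disjunction of $k$ literals over $n$ boolean variables; its value $\mathrm{val}$ is the maximum fraction of clauses satisfied by an assignment. $(s,c)$-Gap-$k$-SAT: distinguish $\mathrm{val}\ge c$ (YES) from $\mathrm{val}<s$ (NO). A Karp reduction maps YES to YES and NO to NO. Gap-SETH: for every $\varepsilon>0$ there exist $k\in\mathbb{Z}^+$ and $\delta>0$ such that no algorithm can distinguish, in time $2^{(1-\varepsilon)n}$, a satisfiable $k$-SAT formula on $n$ variables from one with value less than $1-\delta$. *)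

(* Defs.v *)
From HB Require Import structures.
From mathcomp Require Import all_boot all_order all_algebra.
From mathcomp Require Import all_classical all_reals all_analysis.

Set Implicit Arguments.
Unset Strict Implicit.
Unset Printing Implicit Defensive.

Import Order.TTheory GRing.Theory Num.Theory.
Import numFieldNormedType.Exports.

Local Open Scope ring_scope.

(** * Lattices and the closest vector problem *)

Definition lpnorm (R : realType) (p : R) (d : nat) (x : 'cV[R]_d) : R :=
  (\sum_(i < d) `|x i 0| `^ p) `^ p^-1.

Definition lattice (R : realType) (d n : nat) (B : 'M[R]_(d, n)) :
    set 'cV[R]_d :=
  range (fun z : 'cV[int]_n => B *m map_mx intr z).

(* For B with linearly independent columns the infimum is a minimum. *)
Definition dist (R : realType) (p : R) (d : nat) (L : set 'cV[R]_d)
    (t : 'cV[R]_d) : R :=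
  inf [set lpnorm p (x - t) | x in L]%classic.

(* (B, t, r) is an instance of CVP of rank n: the columns of B are linearly
   independent, and r > 0. *)
Definition cvp_instance (R : realType) (d n : nat) (B : 'M[R]_(d, n))
    (t : 'cV[R]_d) (r : R) : Prop :=
  row_free B^T /\ 0 < r.

Definition cvp_yes (R : realType) (p : R) (d n : nat) (B : 'M[R]_(d, n))
    (t : 'cV[R]_d) (r : R) : Prop :=
  dist p (lattice B) t <= r.

Definition cvp_no (R : realType) (p gamma : R) (d n : nat)
    (B : 'M[R]_(d, n)) (t : 'cV[R]_d) (r : R) : Prop :=
  gamma * r < dist p (lattice B) t.

(** * k-SAT *)

(* The literal (i, b) is satisfied when variable i has value b.  Repeated
   literals in a clause and repeated clauses in a formula are allowed. *)
Definition literal (n : nat) : Type := ('I_n * bool)%type.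
Definition formula (k n : nat) : Type := seq (k.-tuple (literal n)).

Definition sat_clause (k n : nat) (a : {ffun 'I_n -> bool})
    (C : k.-tuple (literal n)) : bool :=
  has (fun l : literal n => a l.1 == l.2) C.

Definition satisfiable (k n : nat) (phi : formula k n) : Prop :=
  exists a : {ffun 'I_n -> bool}, all (sat_clause a) phi.

(* Only used for formulas with at least one clause. *)
Definition val_sat (R : realType) (k n : nat) (phi : formula k n) : R :=
  (\max_(a : {ffun 'I_n -> bool}) count (sat_clause a) phi)%:R
    / (size phi)%:R.

(** * Random access machines

  Programs act on finitely many natural-number arrays and finitely many real
  arrays.  Operations on naturals, and every use of an address, are charged
  their bit length (the logarithmic cost criterion).  Operations on reals are
  exact and are charged one unit, as on a real RAM; a program may contain
  finitely many real constants.  Programs satisfying [discrete] do not touch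
  the reals, and are ordinary random access machines with logarithmic cost. *)

(* Direct a is cell 0 of array a; Indirect a b is the cell of array a whose
   index is the content of cell 0 of the natural-number array b. *)
Inductive addr : Type :=
| Direct (a : nat)
| Indirect (a b : nat).

Inductive nat_op : Type := NAdd | NSub | NMul | NDiv.
Inductive real_op : Type := RAdd | RSub | RMul | RDiv | RPow.

Inductive prog (R : realType) : Type :=
| Skip
| NConst (x : addr) (m : nat)
| NOp (o : nat_op) (x y z : addr)
| RConst (x : addr) (u : R)
| ROfNat (x y : addr)
| ROp (o : real_op) (x y z : addr)
| Seq (P Q : prog R)
| IfNLe (y z : addr) (P Q : prog R)
| IfRLe (y z : addr) (P Q : prog R)
| WhileNLt (y z : addr) (P : prog R).

Arguments Skip {R}.
Arguments NConst {R}.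
Arguments NOp {R}.
Arguments ROfNat {R}.
Arguments ROp {R}.

Fixpoint discrete (R : realType) (P : prog R) : bool :=
  match P with
  | Skip | NConst _ _ | NOp _ _ _ _ => true
  | RConst _ _ | ROfNat _ _ | ROp _ _ _ _ | IfRLe _ _ _ _ => false
  | Seq P1 P2 | IfNLe _ _ P1 P2 => discrete P1 && discrete P2
  | WhileNLt _ _ P1 => discrete P1
  end.

Record state (R : realType) : Type := State {
  nats : nat -> nat -> nat;
  reals : nat -> nat -> R
}.

Definition bits (m : nat) : nat := (trunc_log 2 m).+1.

Definition index_of (R : realType) (s : state R) (x : addr) : nat * nat :=
  match x with
  | Direct a => (a, 0%N)
  | Indirect a b => (a, nats s b 0%N)
  end.

Definition nget (R : realType) (s : state R) (x : addr) : nat :=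
  nats s (index_of s x).1 (index_of s x).2.

Definition rget (R : realType) (s : state R) (x : addr) : R :=
  reals s (index_of s x).1 (index_of s x).2.

Definition update (T : Type) (f : nat -> nat -> T) (ai : nat * nat) (v : T) :
    nat -> nat -> T :=
  fun a i => if (a, i) == ai then v else f a i.

Definition nset (R : realType) (s : state R) (x : addr) (v : nat) : state R :=
  State (update (nats s) (index_of s x) v) (reals s).

Definition rset (R : realType) (s : state R) (x : addr) (v : R) : state R :=
  State (nats s) (update (reals s) (index_of s x) v).

Definition nat_op_fun (o : nat_op) : nat -> nat -> nat :=
  match o with
  | NAdd => addn
  | NSub => subn
  | NMul => muln
  | NDiv => divn
  end.

Definition real_op_fun (R : realType) (o : real_op) (u v : R) : R :=
  match o with
  | RAdd => u + v
  | RSub => u - v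
  | RMul => u * v
  | RDiv => u / v
  | RPow => u `^ v
  end.

Definition addr_cost (R : realType) (s : state R) (x : addr) : nat :=
  bits (index_of s x).2.

Definition nread_cost (R : realType) (s : state R) (x : addr) : nat :=
  (addr_cost s x + bits (nget s x))%N.

Definition rread_cost (R : realType) (s : state R) (x : addr) : nat :=
  (addr_cost s x + 1)%N.

(* exec P s N s': started in s, the program P halts in s' at total cost N. *)
Inductive exec (R : realType) :
    prog R -> state R -> nat -> state R -> Prop :=
| exec_skip s : exec Skip s 1%N s
| exec_nconst x m s :
    exec (NConst x m) s (addr_cost s x + bits m)%N (nset s x m)
| exec_nop o x y z s :
    exec (NOp o x y z) s (addr_cost s x + nread_cost s y + nread_cost s z)%N
      (nset s x (nat_op_fun o (nget s y) (nget s z)))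
| exec_rconst x u s :
    exec (RConst x u) s (addr_cost s x + 1)%N (rset s x u)
| exec_rofnat x y s :
    exec (ROfNat x y) s (addr_cost s x + nread_cost s y)%N
      (rset s x (nget s y)%:R)
| exec_rop o x y z s :
    exec (ROp o x y z) s (addr_cost s x + rread_cost s y + rread_cost s z)%N
      (rset s x (real_op_fun o (rget s y) (rget s z)))
| exec_seq P Q s s1 s2 N1 N2 :
    exec P s N1 s1 -> exec Q s1 N2 s2 -> exec (Seq P Q) s (N1 + N2)%N s2
| exec_ifn y z P Q s s1 N :
    exec (if (nget s y <= nget s z)%N then P else Q) s N s1 ->
    exec (IfNLe y z P Q) s (nread_cost s y + nread_cost s z + N)%N s1
| exec_ifr y z P Q s s1 N :
    exec (if rget s y <= rget s z then P else Q) s N s1 ->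
    exec (IfRLe y z P Q) s (rread_cost s y + rread_cost s z + N)%N s1
| exec_while_stop y z P s :
    (nget s z <= nget s y)%N ->
    exec (WhileNLt y z P) s (nread_cost s y + nread_cost s z)%N s
| exec_while_step y z P s s1 s2 N1 N2 :
    (nget s y < nget s z)%N ->
    exec P s N1 s1 -> exec (WhileNLt y z P) s1 N2 s2 ->
    exec (WhileNLt y z P) s
      (nread_cost s y + nread_cost s z + N1 + N2)%N s2.

(* The input word is placed in natural-number array 0. *)
Definition init_state (R : realType) (w : seq nat) : state R :=
  State (fun a i => if a == 0%N then nth 0%N w i else 0%N) (fun _ _ => 0).

Definition accepting (R : realType) (s : state R) : Prop := nats s 0%N 0%N <> 0%N.

(** * Encodings of instances *)

Definition enc_literal (n : nat) (l : literal n) : nat :=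
  ((l.1 : nat).*2 + l.2)%N.

Definition enc_formula (k n : nat) (phi : formula k n) : seq nat :=
  [:: n, size phi &
    flatten [seq map (@enc_literal n) C | C : k.-tuple (literal n) <- phi]].

Definition enc_rat (x : rat) : seq nat :=
  [:: nat_of_bool (x < 0)%R; `|numq x|%N; `|denq x|%N].

Definition enc_cvp (d n : nat) (B : 'M[rat]_(d, n)) (t : 'cV[rat]_d)
    (r : rat) : seq nat :=
  [:: n, d &
    enc_rat r ++
    flatten [seq enc_rat (t i 0) | i <- enum 'I_d] ++
    flatten [seq enc_rat (B i j) | i <- enum 'I_d, j <- enum 'I_n]].

Definition word_size (w : seq nat) : nat := (\sum_(x <- w) bits x)%N.

Definition outputs_cvp (R : realType) (s : state R) (d n : nat)
    (B : 'M[R]_(d, n)) (t : 'cV[R]_d) (r : R) : Prop :=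
  [/\ nats s 0%N 0%N = n /\ nats s 0%N 1%N = d,
      reals s 0%N 0%N = r,
      forall i : 'I_d, reals s 1%N i = t i 0
    & forall (i : 'I_d) (j : 'I_n), reals s 2%N (i * n + j)%N = B i j].

(** * Reductions and algorithms *)

(* A bound by some polynomial is expressed as a * (N + 1) ^ a for some a. *)
Definition poly_bound (a N : nat) : nat := (a * N.+1 ^ a)%N.

(* The dimension d is bounded as well, so that the instance B, t, r (and not
   just the part of it written explicitly) has polynomial size. *)
Definition karp_reduction_gapsat_cvp (R : realType) (k : nat)
    (s c p gamma : R) : Prop :=
  exists (P : prog R) (a : nat), forall (n : nat) (phi : formula k n),
    (0 < size phi)%N ->
    exists (N : nat) (st : state R) (d : nat) (B : 'M[R]_(d, n))
           (t : 'cV[R]_d) (r : R),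
      [/\ exec P (init_state R (enc_formula phi)) N st,
          (N + d <= poly_bound a (n + size phi))%N,
          outputs_cvp st B t r /\ cvp_instance B t r,
          c <= val_sat R phi -> cvp_yes p B t r
        & val_sat R phi < s -> cvp_no p gamma B t r].

(* P halts on w within time 2 ^ ((1 - eps) n) times a polynomial in sz, and
   accepts (rejects) if yes (no) holds. *)
Definition decides_within (R : realType) (P : prog R) (eps : R)
    (n a sz : nat) (w : seq nat) (yes no : Prop) : Prop :=
  exists (N : nat) (st : state R),
    [/\ exec P (init_state R w) N st,
        N%:R <= 2 `^ ((1 - eps) * n%:R) * (poly_bound a sz)%:R,
        yes -> accepting st
      & no -> ~ accepting st].

(* P distinguishes satisfiable k-SAT formulas from those of value less than
   1 - delta. *)
Definition gap_sat_algorithm (R : realType) (k : nat) (delta eps : R)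
    (P : prog R) : Prop :=
  discrete P /\
  exists a : nat, forall (n : nat) (phi : formula k n),
    (0 < size phi)%N ->
    decides_within P eps n a (n + size phi) (enc_formula phi)
      (satisfiable phi) (val_sat R phi < 1 - delta).

Definition Gap_SETH (R : realType) : Prop :=
  forall eps : R, 0 < eps ->
  exists (k : nat) (delta : R), [/\ (0 < k)%N, 0 < delta &
    ~ exists P : prog R, gap_sat_algorithm k delta eps P].

(* A discrete machine receives rational instances; hardness on these implies
   hardness on all instances. *)
Definition cvp_algorithm (R : realType) (p gamma eps : R) (P : prog R) :
    Prop :=
  discrete P /\
  exists a : nat, forall (n d : nat) (B : 'M[rat]_(d, n)) (t : 'cV[rat]_d)
    (r : rat),
    let B' := map_mx (ratr : rat -> R) B in
    let t' := map_mx (ratr : rat -> R) t in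
    let r' : R := ratr r in
    cvp_instance B' t' r' ->
    decides_within P eps n a (word_size (enc_cvp B t r)) (enc_cvp B t r)
      (cvp_yes p B' t' r') (cvp_no p gamma B' t' r').

(* Main.v *)
(* The gadget of a clause is a finite family of affine forms in y in {1, -1}^k whose
   l_p cost is 1 if some y_i = 1 and 1 + rho if all y_i = -1.  Its forms are
   W_w (theta_j <w, y> + tau_j) for w in {-1, 0, 1}^k with j nonzero entries, and the
   weights W_w are nonnegative as soon as, for each j <= k, the iterated difference of
   |x|^p is at least rho times its iterated mean at some point.  For j <= p this is
   the mean value theorem.  For j > p, which needs p not even, |x|^p is an integral of
   remainders of the Taylor expansion of cos, so that its iterated differences are
   integrals of powers of sin.  Forms alpha y_i make |y_i| >= 3 expensive.  A lattice
   point gives the values y_i = +-(2 x_v - 1), and its cost is then a sum of gadget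
   costs over the clauses.

   For the hardness under Gap-SETH the gadget is rounded to integers, and the radius
   (m C)^(1/p), which need not be computable for a given p, is found with the assumed
   CVP algorithm itself: the formula obtained by making all literals positive is
   satisfiable, and the least q for which the algorithm accepts its instance with
   radius E q approximates the distance up to the factor gamma.  The algorithm is run
   repeatedly on fresh memory, run j using the indices congruent to j modulo J of the
   odd arrays. *)

Require Import Defs.
From mathcomp Require Import all_boot all_order all_algebra.
From mathcomp Require Import all_classical all_reals all_analysis.
From mathcomp Require Import measurable_realfun.
From mathcomp Require Import ring lra zify.

Set Implicit Arguments.
Unset Strict Implicit.
Unset Printing Implicit Defensive.

Import Order.TTheory GRing.Theory Num.Theory.
Import numFieldNormedType.Exports.

(** * Random access machines *)

Definition is_poly (f : nat -> nat) : Prop := exists a, forall V, f V <= poly_bound a V.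

Lemma leq_poly_bound a b V W : a <= b -> V <= W -> poly_bound a V <= poly_bound b W.
Proof.
move=> ab VW; apply: leq_mul => //; apply: (@leq_trans (W.+1 ^ a)).
  by case: a {ab} => // a; rewrite leq_exp2r.
by rewrite leq_pexp2l.
Qed.

Lemma is_poly_bound a : is_poly (poly_bound a).
Proof. by exists a. Qed.

Lemma is_polyC c : is_poly (fun=> c).
Proof. by exists c => V; rewrite leq_pmulr // expn_gt0. Qed.

Lemma is_poly_id : is_poly id.
Proof. by exists 1 => V; rewrite /poly_bound mul1n expn1. Qed.

Lemma is_polyD f g : is_poly f -> is_poly g -> is_poly (fun V => f V + g V).
Proof.
move=> [a fa] [b gb]; exists (a + b) => V; rewrite /poly_bound mulnDl.
apply: leq_add; [apply: leq_trans (fa V) _|apply: leq_trans (gb V) _];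
  by rewrite leq_mul // leq_pexp2l // ?leq_addr ?leq_addl.
Qed.

Lemma is_polyM f g : is_poly f -> is_poly g -> is_poly (fun V => f V * g V).
Proof.
move=> [a fa] [b gb]; exists (a * b + (a + b)) => V.
apply: leq_trans (leq_mul (fa V) (gb V)) _; rewrite /poly_bound mulnACA -expnD.
by rewrite leq_mul ?leq_addr // leq_pexp2l // leq_addl.
Qed.

Lemma is_polyS f : is_poly f -> is_poly (fun V => (f V).+1).
Proof.
move=> /is_polyD /(_ (is_polyC 1)) [a fa]; exists a => V.
by rewrite -addn1; exact: fa.
Qed.

Lemma is_poly_comp f g : is_poly f -> is_poly g -> is_poly (fun V => f (g V)).
Proof.
move=> [a fa] [b gb]; exists (a * b.+1 ^ a + b * a) => V.
have gS : (g V).+1 <= b.+1 * V.+1 ^ b.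
  by rewrite mulSn -add1n leq_add ?expn_gt0 //; exact: gb.
apply: leq_trans (fa _) _; apply: (@leq_trans (a * (b.+1 * V.+1 ^ b) ^ a)).
  by rewrite leq_mul2l; case: (a) => // a'; rewrite leq_exp2r // gS orbT.
rewrite expnMn -expnM mulnA /poly_bound.
by rewrite leq_mul ?leq_addr // leq_pexp2l // leq_addl.
Qed.

Create HintDb poly.
#[local] Hint Resolve is_poly_bound is_polyC is_poly_id is_polyD is_polyM is_polyS : poly.

Section BitLength.

Lemma bits_gt0 m : 0 < bits m. Proof. by []. Qed.

Lemma bits0 : bits 0 = 1. Proof. by rewrite /bits trunc_log0. Qed.

Lemma bits1 : bits 1 = 1. Proof. by rewrite /bits trunc_log1. Qed.

Lemma ltn_bits m : m < 2 ^ bits m.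
Proof. by rewrite /bits trunc_log_ltn. Qed.

Lemma bits_leq m b : 0 < b -> m < 2 ^ b -> bits m <= b.
Proof.
case: m => [|m] b0 mb; first by rewrite bits0.
have := leq_ltn_trans (trunc_logP (isT : 1 < 2) (isT : 0 < m.+1)) mb.
by rewrite ltn_exp2l.
Qed.

Lemma leq_bits m m' : m <= m' -> bits m <= bits m'.
Proof. by move=> mm; apply: bits_leq => //; exact: leq_ltn_trans mm (ltn_bits _). Qed.

Lemma bits_leqS m : bits m <= m.+1.
Proof. by apply: bits_leq => //; apply: ltn_trans (ltnSn m) (ltn_expl m.+1 _). Qed.

Lemma bits_nat_op o x y : bits (nat_op_fun o x y) <= bits x + bits y.
Proof.
apply: bits_leq; rewrite // expnD; have := ltn_bits x; have := ltn_bits y.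
move: (2 ^ bits x) (2 ^ bits y) => X Y yY xX.
by case: o => /=; [nia|nia|nia|apply: leq_ltn_trans (leq_div _ _) _; nia].
Qed.

Lemma bits_mulD v J j : j < J -> bits (v * J + j) <= bits v + bits J.
Proof.
move=> jJ; apply: bits_leq; rewrite // expnD.
have := ltn_bits v; have := ltn_bits J.
by move: (2 ^ bits v) (2 ^ bits J) => X Y; nia.
Qed.

End BitLength.

Section Triples.
Variable R : realType.
Implicit Types (s : state R) (P : prog R) (Q : state R -> Prop) (x y z : addr).

Definition runs P s T Q : Prop := exists N s', [/\ exec P s N s', N <= T & Q s'].

Lemma runs_leq P s T T' Q : T <= T' -> runs P s T Q -> runs P s T' Q.
Proof.
by move=> TT [N [s' [ex NT q]]]; exists N, s'; split => //; exact: leq_trans NT TT.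
Qed.

Lemma runs_post P s T Q Q' : runs P s T Q -> (forall s', Q s' -> Q' s') -> runs P s T Q'.
Proof. by move=> [N [s' [ex NT q]]] QQ; exists N, s'; split => //; exact: QQ. Qed.

Lemma runs_seq P P' s T T' Q Q' : runs P s T Q -> (forall s1, Q s1 -> runs P' s1 T' Q') ->
  runs (Seq P P') s (T + T') Q'.
Proof.
move=> [N [s1 [ex NT q]]] /(_ s1 q) [N' [s2 [ex' NT' q']]].
by exists (N + N'), s2; split; [exact: exec_seq ex ex'|exact: leq_add|].
Qed.

Lemma runs_nconst x m s T Q : addr_cost s x + bits m <= T -> Q (nset s x m) ->
  runs (NConst x m) s T Q.
Proof. by move=> NT q; do 2!eexists; split; [exact: exec_nconst| |]. Qed.

Lemma runs_nop o x y z s T Q : addr_cost s x + nread_cost s y + nread_cost s z <= T ->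
  Q (nset s x (nat_op_fun o (nget s y) (nget s z))) -> runs (NOp o x y z) s T Q.
Proof. by move=> NT q; do 2!eexists; split; [exact: exec_nop| |]. Qed.

Lemma runs_rconst x u s T Q : addr_cost s x + 1 <= T -> Q (rset s x u) ->
  runs (RConst x u) s T Q.
Proof. by move=> NT q; do 2!eexists; split; [exact: exec_rconst| |]. Qed.

Lemma runs_rofnat x y s T Q : addr_cost s x + nread_cost s y <= T ->
  Q (rset s x (nget s y)%:R%R) -> runs (ROfNat x y) s T Q.
Proof. by move=> NT q; do 2!eexists; split; [exact: exec_rofnat| |]. Qed.

Lemma runs_rop o x y z s T Q : addr_cost s x + rread_cost s y + rread_cost s z <= T ->
  Q (rset s x (real_op_fun o (rget s y) (rget s z))) -> runs (ROp o x y z) s T Q.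
Proof. by move=> NT q; do 2!eexists; split; [exact: exec_rop| |]. Qed.

Lemma runs_ifn y z P P' s T Q :
  runs (if nget s y <= nget s z then P else P') s T Q ->
  runs (IfNLe y z P P') s (nread_cost s y + nread_cost s z + T) Q.
Proof.
move=> [N [s' [ex NT q]]]; do 2!eexists; split; first exact: exec_ifn ex.
  by rewrite leq_add2l.
exact: q.
Qed.

(* The index of the invariant bounds the number of iterations still to come. *)
Lemma runs_while (Inv : nat -> state R -> Prop) y z P G T n s :
  (forall j s, Inv j s -> nread_cost s y + nread_cost s z <= G) ->
  (forall j s, Inv j.+1 s -> nget s y < nget s z -> runs P s T (Inv j)) ->
  (forall s, Inv 0 s -> nget s z <= nget s y) -> Inv n s ->
  runs (WhileNLt y z P) s (n * (T + G) + G)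
    (fun s' => exists2 j, Inv j s' & nget s' z <= nget s' y).
Proof.
move=> IG IP I0; elim: n s => [|n IH] s In; have [zy|yz] := leqP (nget s z) (nget s y).
all: try by exists (nread_cost s y + nread_cost s z), s; split;
  [exact: exec_while_stop|apply: leq_trans (IG _ _ In) (leq_addl _ _)|exists 0].
- by have := I0 _ In; rewrite leqNgt yz.
- exists (nread_cost s y + nread_cost s z), s; split; first exact: exec_while_stop.
    exact: leq_trans (IG _ _ In) (leq_addl _ _).
  by exists n.+1.
have [N1 [s1 [ex1 NT1 I1]]] := IP n s In yz; have [N2 [s2 [ex2 NT2 q]]] := IH _ I1.
do 2!eexists; split; [exact: exec_while_step yz ex1 ex2| |exact: q].
by have := IG _ _ In; rewrite mulSn; lia.
Qed.

End Triples.

Section Expressions.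

Inductive nexp : Type :=
| Cst (m : nat)
| Cell (a : nat) (e : nexp)
| Bin (o : nat_op) (e1 e2 : nexp).

Definition Var (a : nat) : nexp := Cell a (Cst 0).

Fixpoint neval (f : nat -> nat -> nat) (e : nexp) : nat :=
  match e with
  | Cst m => m
  | Cell a e => f a (neval f e)
  | Bin o e1 e2 => nat_op_fun o (neval f e1) (neval f e2)
  end.

(* The even arrays below 32 hold the variables of our programs, the even arrays
   from 32 on are scratch cells; the odd arrays are left to simulated programs. *)
Definition program_array (a : nat) : bool := ~~ odd a && (a < 32).
Definition scratch_array (d : nat) : nat := (16 + d).*2.
Definition scratch_from (d a : nat) : bool := ~~ odd a && (scratch_array d <= a).

Fixpoint nwf (e : nexp) : bool :=
  match e with
  | Cst _ => true
  | Cell a e => program_array a && nwf e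
  | Bin _ e1 e2 => nwf e1 && nwf e2
  end.

Fixpoint nreads (b : nat) (e : nexp) : bool :=
  match e with
  | Cst _ => false
  | Cell a e => (a == b) || nreads b e
  | Bin _ e1 e2 => nreads b e1 || nreads b e2
  end.

Lemma eq_neval f g e : nwf e ->
  (forall a i, program_array a -> nreads a e -> f a i = g a i) -> neval f e = neval g e.
Proof.
elim: e => [m|a e IH|o e1 IH1 e2 IH2] //=.
  move=> /andP[oa we] fg; rewrite (IH we) ?fg ?eqxx // => b i ob rb.
  by apply: fg => //; rewrite rb orbT.
move=> /andP[w1 w2] fg; rewrite (IH1 w1) ?(IH2 w2) // => b i ob rb; apply: fg => //;
by rewrite rb ?orbT.
Qed.

Fixpoint neval_bound (e : nexp) (V : nat) : nat :=
  match e with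
  | Cst m => m
  | Cell _ _ => V
  | Bin _ e1 e2 => (neval_bound e1 V).+1 * (neval_bound e2 V).+1
  end.

Lemma neval_leq V f e : (forall a i, program_array a -> f a i <= V) -> nwf e ->
  neval f e <= neval_bound e V.
Proof.
move=> fV; elim: e => [m|a e IH|o e1 IH1 e2 IH2] //=.
  by move=> /andP[oa _]; exact: fV.
move=> /andP[/IH1 b1 /IH2 b2].
move: (neval f e1) (neval f e2) (neval_bound e1 V) (neval_bound e2 V) b1 b2 => x y X Y xX yY.
by case: o => /=; nia.
Qed.

Fixpoint neval_cost (e : nexp) (V : nat) : nat :=
  match e with
  | Cst m => m + 2
  | Cell _ e => neval_cost e V + neval_bound e V + V + 10
  | Bin _ e1 e2 =>
      neval_cost e1 V + neval_cost e2 V + neval_bound e1 V + neval_bound e2 V + 10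
  end.

Lemma is_poly_neval_bound e : is_poly (neval_bound e).
Proof. by elim: e => /=; auto with poly. Qed.

Lemma is_poly_neval_cost e : is_poly (neval_cost e).
Proof. by have bound := is_poly_neval_bound; elim: e => /=; auto 10 with poly. Qed.

End Expressions.

#[local] Hint Resolve is_poly_neval_bound is_poly_neval_cost : poly.

Coercion Cst : nat >-> nexp.
Declare Scope nexp_scope.
Delimit Scope nexp_scope with nexp.
Bind Scope nexp_scope with nexp.
Local Notation "e1 + e2" := (Bin NAdd e1 e2) : nexp_scope.
Local Notation "e1 - e2" := (Bin NSub e1 e2) : nexp_scope.
Local Notation "e1 * e2" := (Bin NMul e1 e2) : nexp_scope.
Local Notation "e1 %/ e2" := (Bin NDiv e1 e2) : nexp_scope.

Section Compilation.
Variable R : realType.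
Implicit Types (s t : state R) (e : nexp).

Fixpoint ncompile (e : nexp) (d : nat) : prog R :=
  let acc := Direct (scratch_array d) in
  let next := Direct (scratch_array d.+1) in
  match e with
  | Cst m => NConst acc m
  | Cell a e => Seq (ncompile e d) (Seq (NConst next 0)
      (NOp NAdd acc next (Indirect a (scratch_array d))))
  | Bin o e1 e2 => Seq (ncompile e1 d) (Seq (ncompile e2 d.+1) (NOp o acc acc next))
  end.

Definition eq_but_scratch (d : nat) s t : Prop :=
  reals t = reals s /\ forall a i, ~~ scratch_from d a -> nats t a i = nats s a i.

Definition bounded (V : nat) s : Prop :=
  forall a i, program_array a -> nats s a i <= V.

Lemma scratch_from_array d d' : scratch_from d (scratch_array d') = (d <= d').
Proof. by rewrite /scratch_from /scratch_array odd_double /= leq_double leq_add2l. Qed.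

Lemma program_scratch d a : program_array a -> ~~ scratch_from d a.
Proof.
rewrite /program_array /scratch_from /scratch_array => /andP[-> a32] /=; rewrite -ltnNge.
by apply: leq_trans a32 _; rewrite (leq_double 16) leq_addr.
Qed.

Lemma odd_scratch d a : odd a -> ~~ scratch_from d a.
Proof. by rewrite /scratch_from => ->. Qed.

Lemma leq_scratch d d' a : d <= d' -> ~~ scratch_from d a -> ~~ scratch_from d' a.
Proof.
move=> dd; apply: contra => /andP[ea a_ge]; rewrite /scratch_from ea /=.
by apply: leq_trans a_ge; rewrite leq_double leq_add2l.
Qed.

Lemma eq_but_scratch_trans d s1 s2 s3 :
  eq_but_scratch d s1 s2 -> eq_but_scratch d s2 s3 -> eq_but_scratch d s1 s3.
Proof.
by move=> [r1 n1] [r2 n2]; split => [|a i na]; [rewrite r2|rewrite n2 // n1].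
Qed.

Lemma eq_but_scratch_leq d d' s t : d <= d' -> eq_but_scratch d' s t -> eq_but_scratch d s t.
Proof. by move=> dd [r n]; split => // a i na; apply: n; exact: leq_scratch na. Qed.

Lemma eq_but_scratch_nset d s v : eq_but_scratch d s (nset s (Direct (scratch_array d)) v).
Proof.
split => // a i; rewrite /nset /= /update /=.
by case: eqP => // -[-> _]; rewrite scratch_from_array leqnn.
Qed.

Lemma nats_scratch d d' s t i : d' < d -> eq_but_scratch d s t ->
  nats t (scratch_array d') i = nats s (scratch_array d') i.
Proof. by move=> dd [_ ->] //; rewrite scratch_from_array -ltnNge. Qed.

Lemma nats_program d s t a i : eq_but_scratch d s t -> program_array a ->
  nats t a i = nats s a i.
Proof. by move=> [_ n] oa; rewrite n // program_scratch. Qed.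

Lemma bounded_scratch d V s t : eq_but_scratch d s t -> bounded V s -> bounded V t.
Proof. by move=> st bs a i oa; rewrite (nats_program _ st) ?bs. Qed.

Lemma neval_scratch d s t e : nwf e -> eq_but_scratch d s t ->
  neval (nats t) e = neval (nats s) e.
Proof. by move=> we st; apply: eq_neval => // a i oa _; exact: nats_program st oa. Qed.

Lemma nats_nset_direct s a v : nats (nset s (Direct a) v) a 0 = v.
Proof. by rewrite /= /update eqxx. Qed.

Lemma addr_cost_direct s a : addr_cost s (Direct a) = 1.
Proof. exact: bits0. Qed.

Lemma addr_cost_indirect s a b : addr_cost s (Indirect a b) = bits (nats s b 0).
Proof. by []. Qed.

Lemma nget_direct s a : nget s (Direct a) = nats s a 0.
Proof. by []. Qed.

Lemma nget_indirect s a b : nget s (Indirect a b) = nats s a (nats s b 0).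
Proof. by []. Qed.

Lemma nread_cost_direct s a : nread_cost s (Direct a) <= nats s a 0 + 2.
Proof.
rewrite /nread_cost addr_cost_direct nget_direct.
by have := bits_leqS (nats s a 0); lia.
Qed.

Lemma nread_cost_indirect s a b :
  nread_cost s (Indirect a b) <= nats s b 0 + nats s a (nats s b 0) + 2.
Proof.
rewrite /nread_cost addr_cost_indirect nget_indirect.
by have := bits_leqS (nats s b 0); have := bits_leqS (nats s a (nats s b 0)); lia.
Qed.

(* The contents of a cell are moved by adding a zero. *)
Lemma cell_runs a d s V v : program_array a -> bounded V s ->
  nats s (scratch_array d) 0 = v ->
  runs (Seq (NConst (Direct (scratch_array d.+1)) 0) (NOp NAdd (Direct (scratch_array d))
      (Direct (scratch_array d.+1)) (Indirect a (scratch_array d)))) s (v + V + 9)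
    (fun t => nats t (scratch_array d) 0 = nats s a v /\ eq_but_scratch d s t).
Proof.
move=> oa bs sv; pose s1 := nset s (Direct (scratch_array d.+1)) 0.
have ss1 : eq_but_scratch d.+1 s s1 by exact: eq_but_scratch_nset.
have s1v : nats s1 (scratch_array d) 0 = v by rewrite (nats_scratch _ _ ss1) // sv.
have s1a : nats s1 a v = nats s a v by exact: nats_program ss1 oa.
have s1z : nats s1 (scratch_array d.+1) 0 = 0 by exact: nats_nset_direct.
have -> : v + V + 9 = 2 + (v + V + 7) by lia.
apply: (runs_seq (Q := eq s1)); first by apply: runs_nconst; rewrite ?addr_cost_direct ?bits0.
move=> _ <-; apply: runs_nop.
  have := nread_cost_direct s1 (scratch_array d.+1).
  have := nread_cost_indirect s1 a (scratch_array d).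
  by rewrite s1v s1a s1z addr_cost_direct; have := bs a v oa; lia.
rewrite nats_nset_direct nget_direct nget_indirect s1z s1v s1a; split => //.
exact: eq_but_scratch_trans (eq_but_scratch_leq (leqnSn d) ss1) (eq_but_scratch_nset _ _ _).
Qed.

Lemma ncompile_runs e d s V : nwf e -> bounded V s ->
  runs (ncompile e d) s (neval_cost e V)
    (fun t => nats t (scratch_array d) 0 = neval (nats s) e /\ eq_but_scratch d s t).
Proof.
elim: e d s => [m|a e IH|o e1 IH1 e2 IH2] d s /=.
- move=> _ _; apply: runs_nconst.
    by rewrite addr_cost_direct; have := bits_leqS m; lia.
  by split; [exact: nats_nset_direct|exact: eq_but_scratch_nset].
- move=> /andP[oa we] bs; have vb := neval_leq bs we.
  apply: (@runs_leq _ _ _ (neval_cost e V + (neval (nats s) e + V + 9))); first by lia.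
  apply: runs_seq (IH d s we bs) _ => s1 [s1e ss1].
  apply: runs_post (cell_runs oa (bounded_scratch ss1 bs) s1e) _ => t [tv s1t].
  by rewrite tv (nats_program _ ss1 oa); split => //; exact: eq_but_scratch_trans ss1 s1t.
move=> /andP[w1 w2] bs; have vb1 := neval_leq bs w1; have vb2 := neval_leq bs w2.
apply: (@runs_leq _ _ _ (neval_cost e1 V + (neval_cost e2 V +
  (neval (nats s) e1 + neval (nats s) e2 + 5)))); first by lia.
apply: runs_seq (IH1 d s w1 bs) _ => s1 [v1 ss1].
apply: runs_seq (IH2 d.+1 s1 w2 (bounded_scratch ss1 bs)) _ => s2 [v2 s1s2].
rewrite (neval_scratch w2 ss1) in v2; rewrite -(nats_scratch _ (ltnSn d) s1s2) in v1.
apply: runs_nop.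
  have := nread_cost_direct s2 (scratch_array d); have := nread_cost_direct s2 (scratch_array d.+1).
  by rewrite v1 v2 addr_cost_direct; lia.
split; first by rewrite nats_nset_direct !nget_direct v1 v2.
apply: eq_but_scratch_trans ss1 _.
exact: eq_but_scratch_trans (eq_but_scratch_leq (leqnSn d) s1s2) (eq_but_scratch_nset _ _ _).
Qed.

Definition store (a : nat) (e1 e2 : nexp) : prog R :=
  Seq (ncompile e1 0) (Seq (ncompile e2 1) (Seq (NConst (Direct (scratch_array 2)) 0)
    (NOp NAdd (Indirect a (scratch_array 0)) (Direct (scratch_array 1))
      (Direct (scratch_array 2))))).

Definition store_cost (e1 e2 : nexp) (V : nat) : nat :=
  neval_cost e1 V + neval_cost e2 V + neval_bound e1 V + neval_bound e2 V + 10.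

Definition assigned s (a i v : nat) t : Prop :=
  reals t = reals s /\
  forall b x, ~~ scratch_from 0 b -> nats t b x = update (nats s) (a, i) v b x.

Lemma assigned_eq s a i v t : ~~ scratch_from 0 a -> assigned s a i v t -> nats t a i = v.
Proof. by move=> na [_ ->] //; rewrite /update eqxx. Qed.

Lemma assigned_neq s a i v t b x : assigned s a i v t -> ~~ scratch_from 0 b ->
  (b, x) != (a, i) -> nats t b x = nats s b x.
Proof. by move=> [_ tE] nb ne; rewrite tE // /update (negbTE ne). Qed.

Lemma assigned_other s a i v t b : assigned s a i v t -> ~~ scratch_from 0 b ->
  b != a -> nats t b =1 nats s b.
Proof.
by move=> st nb ba x; apply: assigned_neq st nb _; rewrite xpair_eqE (negbTE ba).
Qed.

Lemma bounded_assigned V s a i v t : bounded V s -> (program_array a -> v <= V) ->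
  assigned s a i v t -> bounded V t.
Proof.
move=> bs vV st b x ob; have [[ba xi]|ne] := eqVneq (b, x) (a, i).
  by rewrite ba xi (assigned_eq _ st) -?ba ?program_scratch // vV // -ba.
by rewrite (assigned_neq st) ?program_scratch // bs.
Qed.

Lemma store_runs a e1 e2 s V : nwf e1 -> nwf e2 -> bounded V s ->
  runs (store a e1 e2) s (store_cost e1 e2 V)
    (assigned s a (neval (nats s) e1) (neval (nats s) e2)).
Proof.
move=> w1 w2 bs; have vb1 := neval_leq bs w1; have vb2 := neval_leq bs w2.
set v1 := neval _ e1 in vb1 *; set v2 := neval _ e2 in vb2 *.
apply: (@runs_leq _ _ _ (neval_cost e1 V + (neval_cost e2 V + (2 + (v1 + v2 + 5)))));
  first by rewrite /store_cost; lia.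
apply: runs_seq (ncompile_runs 0 w1 bs) _ => s1 [s1v ss1].
apply: runs_seq (ncompile_runs 1 w2 (bounded_scratch ss1 bs)) _ => s2 [s2v s1s2].
rewrite (neval_scratch w2 ss1) -/v2 in s2v; rewrite -(nats_scratch _ _ s1s2) // -/v1 in s1v.
pose s3 := nset s2 (Direct (scratch_array 2)) 0.
have s2s3 : eq_but_scratch 2 s2 s3 by exact: eq_but_scratch_nset.
have u1 : nats s3 (scratch_array 0) 0 = v1 by rewrite (nats_scratch _ _ s2s3).
have u2 : nats s3 (scratch_array 1) 0 = v2 by rewrite (nats_scratch _ _ s2s3).
have u0 : nats s3 (scratch_array 2) 0 = 0 by exact: nats_nset_direct.
have [r3 n3] : eq_but_scratch 0 s s3.
  apply: eq_but_scratch_trans ss1 _.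
  by apply: eq_but_scratch_trans (eq_but_scratch_leq _ s1s2) (eq_but_scratch_leq _ s2s3).
apply: (runs_seq (Q := eq s3)); first by apply: runs_nconst; rewrite ?addr_cost_direct ?bits0.
move=> _ <-; apply: runs_nop.
  have := nread_cost_direct s3 (scratch_array 1); have := nread_cost_direct s3 (scratch_array 2).
  by rewrite addr_cost_indirect u0 u1 u2; have := bits_leqS v1; lia.
split=> // b x nb; rewrite !nget_direct u2 u0.
rewrite [LHS]/(update (nats s3) (a, nats s3 (scratch_array 0) 0) (v2 + 0) b x).
by rewrite u1 addn0 /update; case: eqP => // _; exact: n3.
Qed.

Lemma is_poly_store_cost e1 e2 : is_poly (store_cost e1 e2).
Proof. by rewrite /store_cost; auto 10 with poly. Qed.

Definition set_var (a : nat) (e : nexp) : prog R := store a (Cst 0) e.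
Definition set_var_cost : nexp -> nat -> nat := store_cost (Cst 0).

Lemma set_var_runs a e s V v : nwf e -> program_array a -> bounded V s ->
  neval (nats s) e = v -> v <= V ->
  runs (set_var a e) s (set_var_cost e V) (fun t => assigned s a 0 v t /\ bounded V t).
Proof.
move=> we oa bs <- vV; apply: runs_post (store_runs a (isT : nwf (Cst 0)) we bs) _ => t st.
by split; last exact: bounded_assigned bs _ st.
Qed.

End Compilation.

#[local] Hint Resolve is_poly_store_cost : poly.

Section RealExpressions.
Variable R : realType.
Implicit Types (s t : state R) (e : nexp).

Inductive rexp : Type :=
| RCst (u : R)
| RNat (e : nexp)
| RBin (o : real_op) (r1 r2 : rexp).

Fixpoint reval (f : nat -> nat -> nat) (r : rexp) : R :=
  match r with
  | RCst u => u
  | RNat e => (neval f e)%:R%R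
  | RBin o r1 r2 => real_op_fun o (reval f r1) (reval f r2)
  end.

Fixpoint rwf (r : rexp) : bool :=
  match r with
  | RCst _ => true
  | RNat e => nwf e
  | RBin _ r1 r2 => rwf r1 && rwf r2
  end.

Fixpoint rreads (b : nat) (r : rexp) : bool :=
  match r with
  | RCst _ => false
  | RNat e => nreads b e
  | RBin _ r1 r2 => rreads b r1 || rreads b r2
  end.

Fixpoint reval_cost (r : rexp) (V : nat) : nat :=
  match r with
  | RCst _ => 2
  | RNat e => neval_cost e V + neval_bound e V + 5
  | RBin _ r1 r2 => reval_cost r1 V + reval_cost r2 V + 5
  end.

Lemma is_poly_reval_cost r : is_poly (reval_cost r).
Proof. by elim: r => /=; auto 10 with poly. Qed.

Lemma eq_reval f g r : rwf r ->
  (forall a i, program_array a -> rreads a r -> f a i = g a i) -> reval f r = reval g r.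
Proof.
elim: r => [u|e|o r1 IH1 r2 IH2] //=; first by move=> we fg; rewrite (eq_neval we fg).
move=> /andP[w1 w2] fg; rewrite (IH1 w1) ?(IH2 w2) // => b i ob rb; apply: fg => //;
by rewrite rb ?orbT.
Qed.

(* The real arrays 0, 1 and 2 hold the output; the later ones are scratch cells. *)
Fixpoint rcompile (r : rexp) (d : nat) : prog R :=
  let acc := Direct (3 + d) in
  match r with
  | RCst u => RConst acc u
  | RNat e => Seq (ncompile R e 0) (ROfNat acc (Direct (scratch_array 0)))
  | RBin o r1 r2 =>
      Seq (rcompile r1 d) (Seq (rcompile r2 d.+1) (ROp o acc acc (Direct (3 + d.+1))))
  end.

Definition eq_but_rscratch (d : nat) s t : Prop :=
  (forall b i, b < 3 + d -> reals t b i = reals s b i) /\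
  forall a i, ~~ scratch_from 0 a -> nats t a i = nats s a i.

Lemma neval_rscratch d s t e : nwf e -> eq_but_rscratch d s t ->
  neval (nats t) e = neval (nats s) e.
Proof.
by move=> we [_ n]; apply: eq_neval => // a i oa _; rewrite n // program_scratch.
Qed.

Lemma reval_rscratch d s t r : rwf r -> eq_but_rscratch d s t ->
  reval (nats t) r = reval (nats s) r.
Proof.
by move=> wr [_ n]; apply: eq_reval => // a i oa _; rewrite n // program_scratch.
Qed.

Lemma bounded_rscratch d V s t : eq_but_rscratch d s t -> bounded V s -> bounded V t.
Proof. by move=> [_ n] bs a i oa; rewrite n ?bs // program_scratch. Qed.

Lemma reals_rset_direct s a u : reals (rset s (Direct a) u) a 0 = u.
Proof. by rewrite /= /update eqxx. Qed.

Lemma rread_cost_direct s a : rread_cost s (Direct a) = 2.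
Proof. by rewrite /rread_cost addr_cost_direct. Qed.

Lemma eq_but_rscratch_rset d s u : eq_but_rscratch d s (rset s (Direct (3 + d)) u).
Proof.
split => // b i bd; rewrite /= /update; case: eqP => // -[bE _].
by rewrite bE ltnn in bd.
Qed.

Lemma eq_but_rscratch_trans d s1 s2 s3 :
  eq_but_rscratch d s1 s2 -> eq_but_rscratch d s2 s3 -> eq_but_rscratch d s1 s3.
Proof. by move=> [r1 n1] [r2 n2]; split => b i h; [rewrite r2 ?r1|rewrite n2 ?n1]. Qed.

Lemma eq_but_rscratchS d s t : eq_but_rscratch d.+1 s t -> eq_but_rscratch d s t.
Proof. by move=> [r n]; split => // b i bd; apply: r; rewrite addnS ltnW. Qed.

Lemma rcompile_runs r d s V : rwf r -> bounded V s ->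
  runs (rcompile r d) s (reval_cost r V)
    (fun t => reals t (3 + d) 0 = reval (nats s) r /\ eq_but_rscratch d s t).
Proof.
elim: r d s => [u|e|o r1 IH1 r2 IH2] d s.
- move=> _ _; apply: runs_rconst; first by rewrite addr_cost_direct.
  by split; [exact: reals_rset_direct|exact: eq_but_rscratch_rset].
- move=> we bs; have vb := neval_leq bs we.
  rewrite [reval_cost _ _]/= -addnA; apply: runs_seq (ncompile_runs 0 we bs) _ => s1 [v1 [r1 n1]].
  apply: runs_rofnat.
    have := nread_cost_direct s1 (scratch_array 0).
    by rewrite addr_cost_direct v1 => ?; lia.
  rewrite nget_direct v1; split; first exact: reals_rset_direct.
  by apply: eq_but_rscratch_trans (eq_but_rscratch_rset _ _ _); split => // *; rewrite r1.
move=> /andP[w1 w2] bs; rewrite [reval_cost _ _]/= -addnA.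
apply: runs_seq (IH1 d s w1 bs) _ => s1 [v1 ss1].
apply: runs_seq (IH2 d.+1 s1 w2 (bounded_rscratch ss1 bs)) _ => s2 [v2 s1s2].
rewrite (reval_rscratch w2 ss1) in v2; rewrite -s1s2.1 ?ltn_add2l // in v1.
apply: runs_rop; first by rewrite !rread_cost_direct addr_cost_direct.
split; first by rewrite reals_rset_direct /rget /= v1 v2.
apply: eq_but_rscratch_trans ss1 _.
exact: eq_but_rscratch_trans (eq_but_rscratchS s1s2) (eq_but_rscratch_rset _ _ _).
Qed.

Definition rstore (a : nat) (e : nexp) (r : rexp) : prog R :=
  Seq (rcompile r 0) (Seq (ncompile R e 0) (Seq (RConst (Direct 4) 0%R)
    (ROp RAdd (Indirect a (scratch_array 0)) (Direct 3) (Direct 4)))).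

Definition rstore_cost (e : nexp) (r : rexp) (V : nat) : nat :=
  reval_cost r V + neval_cost e V + neval_bound e V + 10.

Lemma is_poly_rstore_cost e r : is_poly (rstore_cost e r).
Proof. by have := is_poly_reval_cost r; rewrite /rstore_cost; auto 10 with poly. Qed.

Definition rassigned s (a i : nat) (u : R) t : Prop :=
  (forall b x, ~~ scratch_from 0 b -> nats t b x = nats s b x) /\
  forall b x, b < 3 -> reals t b x = update (reals s) (a, i) u b x.

Lemma rstore_runs a e r s V : nwf e -> rwf r -> bounded V s ->
  runs (rstore a e r) s (rstore_cost e r V)
    (rassigned s a (neval (nats s) e) (reval (nats s) r)).
Proof.
move=> we wr bs; have vb := neval_leq bs we; set v := neval _ e in vb *.
apply: (@runs_leq _ _ _ (reval_cost r V + (neval_cost e V + (2 + (v + 6)))));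
  first by rewrite /rstore_cost; lia.
apply: runs_seq (rcompile_runs 0 wr bs) _ => s1 [v1 ss1].
apply: runs_seq (ncompile_runs 0 we (bounded_rscratch ss1 bs)) _ => s2 [v2 [r2 n2]].
rewrite (neval_rscratch we ss1) -/v in v2; rewrite -r2 in v1.
pose s3 := rset s2 (Direct 4) 0%R.
apply: (runs_seq (Q := eq s3)); first by apply: runs_rconst; rewrite ?addr_cost_direct.
move=> _ <-; apply: runs_rop.
  rewrite !rread_cost_direct addr_cost_indirect [nats s3 _ _]v2.
  by have := bits_leqS v; lia.
split=> b x; first by move=> nb; rewrite /= n2 // ss1.2.
have acc3 : rget s3 (Direct 3) = reval (nats s) r by exact: v1.
have acc4 : rget s3 (Direct 4) = 0%R by exact: reals_rset_direct.
move=> b3; rewrite acc3 acc4 /= GRing.addr0 /update v2.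
case: eqP => // _; rewrite ifN; last by apply/eqP => -[b4 _]; rewrite b4 in b3.
by rewrite r2 ss1.1 // addn0.
Qed.

End RealExpressions.

#[local] Hint Resolve is_poly_rstore_cost : poly.

Local Notation counter := 4.
Local Notation limit := 6.

Section Loops.
Variable R : realType.
Implicit Types (s t : state R) (e eb : nexp) (P : prog R).

Definition for_loop eb P : prog R :=
  Seq (set_var R limit eb) (Seq (set_var R counter 0)
    (WhileNLt (Direct counter) (Direct limit)
      (Seq P (set_var R counter (Var counter + 1))))).

Definition for_cost eb (T V : nat) : nat :=
  set_var_cost eb V + (set_var_cost 0 V
    + (V * (T + set_var_cost (Var counter + 1) V + (V + V + 4)) + (V + V + 4))).

Lemma is_poly_for_cost eb T : is_poly T -> is_poly (fun V => for_cost eb (T V) V).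
Proof. by rewrite /for_cost /set_var_cost; auto 20 with poly. Qed.

Definition in_loop (V n j : nat) s : Prop :=
  [/\ bounded V s, nats s limit 0 = n & nats s counter 0 = j].

Lemma for_loop_runs eb P n T V (Inv : nat -> state R -> Prop) s :
  nwf eb -> neval (nats s) eb = n -> n <= V -> bounded V s ->
  (forall j s1 v t, Inv j s1 -> assigned s1 counter 0 v t -> Inv j t) ->
  (forall t, assigned s limit 0 n t -> Inv 0 t) ->
  (forall j s1, j < n -> Inv j s1 -> in_loop V n j s1 ->
     runs P s1 T (fun t => Inv j.+1 t /\ in_loop V n j t)) ->
  runs (for_loop eb P) s (for_cost eb T V) (fun t => Inv n t /\ bounded V t).
Proof.
move=> web ebE nV bs Istable I0 Istep.
have own_limit : program_array limit by []; have own_counter : program_array counter by [].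
apply: runs_seq (set_var_runs web own_limit bs ebE nV) _ => s1 [ss1 b1].
apply: runs_seq (set_var_runs (isT : nwf 0) own_counter b1 erefl (leq0n V)) _ => s2 [s1s2 b2].
pose loop_inv i t := i <= n /\ (Inv (n - i) t /\ in_loop V n (n - i) t).
have body_runs i t : loop_inv i.+1 t ->
    runs (Seq P (set_var R counter (Var counter + 1))) t
      (T + set_var_cost (Var counter + 1) V) (loop_inv i).
  move=> [iN [It tl]]; have nE : n - i = (n - i.+1).+1 by rewrite subnSK.
  apply: runs_seq (Istep _ _ _ It tl) _ => [|t1 [It1 [bt1 lt1 ct1]]].
    by rewrite -subn_gt0 subKn.
  have cE : neval (nats t1) (Var counter + 1)%nexp = n - i by rewrite /= ct1 addn1 nE.
  have niV : n - i <= V by apply: leq_trans (leq_subr _ _) nV.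
  apply: runs_post (set_var_runs _ own_counter bt1 cE niV) _ => // t2 [t12 bt2].
  split; first exact: ltnW.
  split; first by rewrite nE; exact: Istable It1 t12.
  by split => //; [rewrite (assigned_other t12)|exact: assigned_eq t12].
have guard i t : loop_inv i t ->
    nread_cost t (Direct counter) + nread_cost t (Direct limit) <= V + V + 4.
  move=> [_ [_ [bt _ _]]].
  have := nread_cost_direct t counter; have := nread_cost_direct t limit.
  by have := bt _ 0 own_counter; have := bt _ 0 own_limit; lia.
have start : loop_inv n s2.
  split=> //; rewrite subnn; split; first exact: Istable (I0 _ ss1) s1s2.
  split=> //; last exact: assigned_eq s1s2.
  by rewrite (assigned_other s1s2) //; exact: assigned_eq ss1.
have stop t : loop_inv 0 t -> nget t (Direct limit) <= nget t (Direct counter).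
  by move=> [_ [_ [_ lt ct]]]; rewrite !nget_direct lt ct subn0.
apply: (@runs_leq _ _ _ (n * (T + set_var_cost (Var counter + 1) V + (V + V + 4))
  + (V + V + 4))); first by rewrite leq_add2r leq_mul2r nV orbT.
apply: runs_post (runs_while guard _ stop start) _ => [i t /body_runs bt _|t].
  exact: bt.
move=> [i [iN [It [bt lt ct]]]]; rewrite !nget_direct lt ct => n_le.
by split=> //; have <- : n - i = n by lia.
Qed.

Fixpoint written (T : Type) (f : nat -> T) (idx : nat -> nat) (v : nat -> T)
    (n i : nat) : T :=
  if n is n'.+1 then if i == idx n' then v n' else written f idx v n' i else f i.

Section Written.
Variable T : Type.
Implicit Types (f v : nat -> T) (idx : nat -> nat).

Lemma written_notin f idx v n i : (forall j, j < n -> idx j != i) ->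
  written f idx v n i = f i.
Proof.
elim: n => //= n IH ni; rewrite eq_sym (negbTE (ni n _)) // IH // => j jn.
exact/ni/ltnW.
Qed.

Lemma written_in f idx v n j : {in gtn n &, injective idx} -> j < n ->
  written f idx v n (idx j) = v j.
Proof.
elim: n => //= n IH inj; rewrite ltnS leq_eqVlt => /predU1P[->|jn]; first by rewrite eqxx.
have jn' : j < n.+1 by rewrite ltnS ltnW.
rewrite ifN; first by apply: IH => // a b an bn; apply: inj; rewrite inE ltnS ltnW.
by apply/negP => /eqP /(inj _ _ jn' (ltnSn n)) E; rewrite E ltnn in jn.
Qed.

Lemma written_id f idx v n i : idx =1 id ->
  written f idx v n i = if i < n then v i else f i.
Proof.
move=> idxE; elim: n => //= n ->; rewrite idxE ltnS.
by case: ltngtP => // ->.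
Qed.

Lemma written_cst f idx (x : T) n i :
  written f idx (fun=> x) n i = if has (fun j => idx j == i) (iota 0 n) then x else f i.
Proof.
elim: n => [//|n IH]; rewrite -[in RHS]addn1 iotaD has_cat /= orbF IH eq_sym.
by case: eqP; rewrite ?orbT ?orbF.
Qed.

End Written.

Definition env s (j : nat) : nat -> nat -> nat := update (nats s) (counter, 0) j.

Definition same_outside (arrays : seq nat) s t : Prop :=
  forall b i, ~~ scratch_from 0 b -> b \notin arrays -> nats t b i = nats s b i.

Definition fill (a : nat) eb e1 e2 : prog R := for_loop eb (store R a e1 e2).

Definition fill_ok (a : nat) eb e1 e2 : bool :=
  [&& ~~ scratch_from 0 a, a \notin [:: counter; limit], [&& nwf eb, nwf e1 & nwf e2],
      ~~ nreads a e1 && ~~ nreads a e2 & ~~ nreads limit e1 && ~~ nreads limit e2].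

Definition fill_cost eb e1 e2 (V : nat) : nat := for_cost eb (store_cost e1 e2 V) V.

Lemma is_poly_fill_cost eb e1 e2 : is_poly (fill_cost eb e1 e2).
Proof. by apply: is_poly_for_cost; auto with poly. Qed.

Lemma fill_runs a eb e1 e2 s V n :
  fill_ok a eb e1 e2 -> neval (nats s) eb = n -> n <= V -> bounded V s ->
  (program_array a -> forall j, j < n -> neval (env s j) e2 <= V) ->
  runs (fill a eb e1 e2) s (fill_cost eb e1 e2 V) (fun t =>
    [/\ reals t = reals s, same_outside [:: a; counter; limit] s t,
        forall i, nats t a i = written (nats s a) (fun j => neval (env s j) e1)
          (fun j => neval (env s j) e2) n i
      & bounded V t]).
Proof.
move=> /and5P[na + /and3P[web w1 w2] /andP[ra1 ra2] /andP[rl1 rl2]] ebE nV bs vV.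
rewrite !inE negb_or => /andP[ac al].
pose idx j := neval (env s j) e1; pose v j := neval (env s j) e2.
pose Inv j t := [/\ reals t = reals s,
  forall b i, ~~ scratch_from 0 b -> b \notin [:: a; limit] -> (b, i) != (counter, 0) ->
    nats t b i = nats s b i
  & forall i, nats t a i = written (nats s a) idx v j i].
have stable j s1 u t : Inv j s1 -> assigned s1 counter 0 u t -> Inv j t.
  move=> [r1 n1 content1] s1t; split; first by rewrite s1t.1.
    by move=> b i nb bal bc; rewrite (assigned_neq s1t) // n1.
  by move=> i; rewrite (assigned_other s1t) // content1.
have start t : assigned s limit 0 n t -> Inv 0 t.
  move=> st; split; first exact: st.1.
    by move=> b i nb; rewrite !inE negb_or => /andP[_ bl] _; rewrite (assigned_other st).
  by move=> i; rewrite (assigned_other st).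
have step j s1 : j < n -> Inv j s1 -> in_loop V n j s1 ->
    runs (store R a e1 e2) s1 (store_cost e1 e2 V) (fun t => Inv j.+1 t /\ in_loop V n j t).
  move=> jn [r1 n1 content1] [b1 l1 c1].
  have evalE e : nwf e -> ~~ nreads a e -> ~~ nreads limit e ->
      neval (nats s1) e = neval (env s j) e.
    move=> we ra rl; apply: eq_neval => // b i ob rb; rewrite /env /update.
    case: eqP => [[-> ->] //|/eqP bc]; rewrite n1 ?program_scratch // !inE negb_or.
    by apply/andP; split; apply: contraTneq rb => ->.
  apply: runs_post (store_runs a w1 w2 b1) _ => t; rewrite !evalE // => s1t; split.
    split; first by rewrite s1t.1.
      move=> b i nb bal bc; rewrite (assigned_other s1t) ?n1 //.
      by move: bal; rewrite !inE negb_or => /andP[].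
    by move=> i; rewrite s1t.2 // /update xpair_eqE eqxx content1.
  split; first by apply: bounded_assigned b1 _ s1t => oa; exact: vV.
    by rewrite (assigned_other s1t) // eq_sym.
  by rewrite (assigned_other s1t) // eq_sym.
apply: runs_post (for_loop_runs web ebE nV bs stable start step) _ => t [[rt nt wt] bt].
split=> // b i nb; rewrite !inE !negb_or => /and3P[ba bc bl].
by apply: nt; rewrite ?inE ?negb_or ?ba ?bl // xpair_eqE (negbTE bc).
Qed.

Definition rfill (a : nat) eb e (r : rexp R) : prog R := for_loop eb (rstore a e r).

Definition rfill_cost eb e (r : rexp R) (V : nat) : nat := for_cost eb (rstore_cost e r V) V.

Lemma is_poly_rfill_cost eb e r : is_poly (rfill_cost eb e r).
Proof. by apply: is_poly_for_cost; auto with poly. Qed.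

Lemma rfill_runs a eb e r s V n :
  a < 3 -> [&& nwf eb, nwf e, rwf r, ~~ nreads limit e & ~~ rreads limit r] ->
  neval (nats s) eb = n -> n <= V -> bounded V s ->
  runs (rfill a eb e r) s (rfill_cost eb e r V) (fun t =>
    [/\ same_outside [:: counter; limit] s t,
        forall b i, b < 3 -> b != a -> reals t b i = reals s b i,
        forall i, reals t a i = written (reals s a) (fun j => neval (env s j) e)
          (fun j => reval (env s j) r) n i
      & bounded V t]).
Proof.
move=> a3 /and5P[web we wr rl rlr] ebE nV bs.
pose idx j := neval (env s j) e; pose v j := reval (env s j) r.
pose Inv j t := [/\
  forall b i, ~~ scratch_from 0 b -> b != limit -> (b, i) != (counter, 0) ->
    nats t b i = nats s b i,
  forall b i, b < 3 -> b != a -> reals t b i = reals s b i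
  & forall i, reals t a i = written (reals s a) idx v j i].
have stable j s1 u t : Inv j s1 -> assigned s1 counter 0 u t -> Inv j t.
  move=> [n1 r1 content1] s1t; split=> [b i nb bl bc|b i b3 ba|i].
  - by rewrite (assigned_neq s1t) // n1.
  - by rewrite s1t.1 r1.
  - by rewrite s1t.1 content1.
have start t : assigned s limit 0 n t -> Inv 0 t.
  move=> st; split=> [b i nb bl _|b i _ _|i]; rewrite ?st.1 //.
  by rewrite (assigned_other st).
have step j s1 : j < n -> Inv j s1 -> in_loop V n j s1 ->
    runs (rstore a e r) s1 (rstore_cost e r V) (fun t => Inv j.+1 t /\ in_loop V n j t).
  move=> jn [n1 r1 content1] [b1 l1 c1].
  have same b i : program_array b -> b != limit -> nats s1 b i = env s j b i.
    move=> ob bl; rewrite /env /update.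
    by case: eqP => [[-> ->] //|/eqP bc]; rewrite n1 ?program_scratch.
  have idxE : neval (nats s1) e = idx j.
    by apply: eq_neval => // b i ob rb; apply: same => //; apply: contraNneq rl => <-.
  have vE : reval (nats s1) r = v j.
    by apply: eq_reval => // b i ob rb; apply: same => //; apply: contraNneq rlr => <-.
  apply: runs_post (rstore_runs a we wr b1) _ => t; rewrite idxE vE => -[n2 r2]; split.
    split=> [b i nb bl bc|b i b3 ba|i]; first by rewrite n2 // n1.
      by rewrite r2 // /update xpair_eqE (negbTE ba) r1.
    by rewrite r2 // /update xpair_eqE eqxx content1.
  by split=> [b i ob||]; rewrite n2 ?program_scratch // b1.
apply: runs_post (for_loop_runs web ebE nV bs stable start step) _ => t [[nt rt wt] bt].
split=> // b i nb; rewrite !inE !negb_or => /andP[bc bl].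
by apply: nt; rewrite // xpair_eqE (negbTE bc).
Qed.

End Loops.

#[local] Hint Resolve is_poly_fill_cost is_poly_rfill_cost : poly.

(** * Simulation of a program in interleaved memory *)

Local Notation slot := 8.
Local Notation stride := 10.

Section Simulation.
Variable R : realType.
Implicit Types (s t : state R) (P : prog R) (x y z : addr).

Lemma bits_exec P s N s' : exec P s N s' -> forall a i,
  bits (nats s' a i) <= bits (nats s a i) + N.
Proof.
have nats_nset u x v a i :
  nats (nset u x v) a i = if (a, i) == index_of u x then v else nats u a i by [].
elim=> {P s N s'}; try by move=> *; rewrite leq_addr.
- by move=> x m s a i; rewrite nats_nset; case: ifP => _; lia.
- move=> o x y z s a i; rewrite nats_nset; case: ifP => _; last by lia.
  by have := bits_nat_op o (nget s y) (nget s z); rewrite /nread_cost; lia.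
- by move=> P Q s s1 s2 N1 N2 _ IH1 _ IH2 a i; have := IH1 a i; have := IH2 a i; lia.
- by move=> y z P Q s s1 N _ IH a i; have := IH a i; lia.
- by move=> y z P Q s s1 N _ IH a i; have := IH a i; lia.
- by move=> y z P s s1 s2 N1 N2 _ _ IH1 _ IH2 a i; have := IH1 a i; have := IH2 a i; lia.
Qed.

(* Cell i of array a of the simulated program is cell i * J + j of array 2 a + 1;
   the cells slot and stride hold j and J, and indices are computed in scratch cells. *)
Definition sim_addr (d : nat) x : addr :=
  Indirect (match x with Direct a => a | Indirect a _ => a end).*2.+1 (scratch_array d).

Definition sim_index_prog (d : nat) x : prog R :=
  let acc := Direct (scratch_array d) in
  match x with
  | Direct _ => Seq (NConst acc 0) (NOp NAdd acc acc (Direct slot))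
  | Indirect _ b => Seq (NOp NMul acc (Indirect b.*2.+1 slot) (Direct stride))
      (NOp NAdd acc acc (Direct slot))
  end.

Definition sim_indices_prog y z : prog R := Seq (sim_index_prog 0 y) (sim_index_prog 1 z).

Fixpoint sim_prog P : prog R :=
  match P with
  | NConst x m => Seq (sim_index_prog 0 x) (NConst (sim_addr 0 x) m)
  | NOp o x y z => Seq (sim_indices_prog y z) (Seq (sim_index_prog 2 x)
      (NOp o (sim_addr 2 x) (sim_addr 0 y) (sim_addr 1 z)))
  | Seq P Q => Seq (sim_prog P) (sim_prog Q)
  | IfNLe y z P Q => Seq (sim_indices_prog y z)
      (IfNLe (sim_addr 0 y) (sim_addr 1 z) (sim_prog P) (sim_prog Q))
  | WhileNLt y z P => Seq (sim_indices_prog y z)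
      (WhileNLt (sim_addr 0 y) (sim_addr 1 z) (Seq (sim_prog P) (sim_indices_prog y z)))
  | _ => Skip
  end.

Lemma discrete_ncompile e d : discrete (ncompile R e d).
Proof. by elim: e d => //= [a e IH d|o e1 IH1 e2 IH2 d]; rewrite ?IH ?IH1 ?IH2. Qed.

Lemma discrete_sim_prog P : discrete (sim_prog P).
Proof.
have index d x : discrete (sim_index_prog d x) by case: x.
by elim: P => //= *; rewrite ?index //=; apply/andP.
Qed.

Variables J j : nat.
Hypothesis jJ : j < J.

Definition sim s t : Prop :=
  [/\ forall a i, nats t a.*2.+1 (i * J + j) = nats s a i, nats t slot 0 = j
    & nats t stride 0 = J].

Definition frame t t' : Prop :=
  forall a i, ~~ scratch_from 0 a -> (odd a -> i %% J != j) -> nats t' a i = nats t a i.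

Definition sim_index s x : nat := (index_of s x).2 * J + j.

Definition index_ready (d : nat) s x t : Prop :=
  nats t (scratch_array d) 0 = sim_index s x.

Lemma frame_trans t1 t2 t3 : frame t1 t2 -> frame t2 t3 -> frame t1 t3.
Proof. by move=> f1 f2 a i na ia; rewrite f2 // f1. Qed.

Lemma frame_scratch d t t' : eq_but_scratch d t t' -> frame t t'.
Proof. by move=> [_ n] a i na _; apply: n; exact: leq_scratch na. Qed.

Lemma sim_scratch d s t t' : eq_but_scratch d t t' -> sim s t -> sim s t'.
Proof.
move=> tt' [tE tj tJ]; split; last 2 first.
- by rewrite (nats_program _ tt').
- by rewrite (nats_program _ tt').
by move=> a i; rewrite tt'.2 ?tE // odd_scratch //= odd_double.
Qed.

Lemma sim_index_runs d x s t : sim s t ->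
  runs (sim_index_prog d x) t (12 * bits J * addr_cost s x)
    (fun t' => index_ready d s x t' /\ eq_but_scratch d t t').
Proof.
move=> [tE tj tJ]; have bj : bits j <= bits J by apply/leq_bits/ltnW.
have bJ := bits_gt0 J.
have add_slot v t1 : eq_but_scratch d t t1 -> nats t1 (scratch_array d) 0 = v ->
    runs (NOp NAdd (Direct (scratch_array d)) (Direct (scratch_array d)) (Direct slot)) t1
      (bits v + bits J + 3)
      (fun t' => nats t' (scratch_array d) 0 = v + j /\ eq_but_scratch d t t').
  move=> tt1 t1v; have t1j : nats t1 slot 0 = j by rewrite (nats_program _ tt1).
  apply: runs_nop; first by rewrite /nread_cost !addr_cost_direct !nget_direct t1v t1j; lia.
  rewrite !nget_direct t1v t1j; split; first exact: nats_nset_direct.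
  exact: eq_but_scratch_trans tt1 (eq_but_scratch_nset _ _ _).
case: x => [a|a b].
  apply: (@runs_leq _ _ _ (2 + (bits 0 + bits J + 3))).
    by rewrite bits0 addr_cost_direct; lia.
  apply: (runs_seq (Q := eq (nset t (Direct (scratch_array d)) 0))).
    by apply: runs_nconst; rewrite ?addr_cost_direct ?bits0.
  move=> _ <-; rewrite /index_ready /sim_index mul0n.
  by apply: add_slot; [exact: eq_but_scratch_nset|exact: nats_nset_direct].
pose v := nats s b 0.
have tv : nget t (Indirect b.*2.+1 slot) = v.
  by rewrite nget_indirect tj -[j]add0n -(mul0n J) tE.
have bv := bits_gt0 v; have bvJ : bits (v * J) <= bits v + bits J.
  by apply: leq_trans (bits_mulD v jJ); apply: leq_bits; rewrite leq_addr.
apply: (@runs_leq _ _ _ ((bits j + bits v + bits J + 2) + (bits (v * J) + bits J + 3))).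
  rewrite addr_cost_indirect -/v.
  by move: (bits (v * J)) (bits v) (bits J) (bits j) bj bJ bv bvJ => A B C D; nia.
apply: (runs_seq (Q := eq (nset t (Direct (scratch_array d)) (v * J)))).
  apply: runs_nop; last by rewrite tv nget_direct tJ.
  rewrite /nread_cost tv nget_direct tJ !addr_cost_direct addr_cost_indirect tj; lia.
move=> _ <-; rewrite /index_ready /sim_index.
by apply: add_slot; [exact: eq_but_scratch_nset|exact: nats_nset_direct].
Qed.

Lemma nget_sim_addr d x s t : sim s t -> index_ready d s x t ->
  nget t (sim_addr d x) = nget s x.
Proof.
by move=> [tE _ _]; case: x => [a|a b] tx; rewrite (nget_indirect t) tx /sim_index tE.
Qed.

Lemma addr_cost_sim d x s t : index_ready d s x t ->
  addr_cost t (sim_addr d x) <= 2 * bits J * addr_cost s x.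
Proof.
move=> tx; rewrite addr_cost_indirect tx /addr_cost.
have := bits_mulD (index_of s x).2 jJ; have := bits_gt0 (index_of s x).2; have := bits_gt0 J.
rewrite /sim_index; move: (bits (_ + _)) (bits (index_of s x).2) (bits J) => A B C; nia.
Qed.

Lemma nread_cost_sim d x s t : sim s t -> index_ready d s x t ->
  nread_cost t (sim_addr d x) <= 2 * bits J * nread_cost s x.
Proof.
move=> st tx; rewrite /nread_cost (nget_sim_addr st tx) mulnDr leq_add ?addr_cost_sim //.
by rewrite leq_pmull // muln_gt0.
Qed.

Lemma sim_nset d x s t v : sim s t -> index_ready d s x t ->
  sim (nset s x v) (nset t (sim_addr d x) v) /\ frame t (nset t (sim_addr d x) v).
Proof.
move=> [tE tj tJ] tx.
have nsetE a i : nats (nset t (sim_addr d x) v) a i =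
    if (a == (index_of s x).1.*2.+1) && (i == sim_index s x) then v else nats t a i.
  by rewrite -xpair_eqE /= /update /= tx; case: (x).
have J0 : 0 < J by exact: leq_ltn_trans jJ.
have even_neq a i : ~~ odd a -> nats (nset t (sim_addr d x) v) a i = nats t a i.
  move=> ea; rewrite nsetE; case: eqP => // aE.
  by rewrite aE /= odd_double in ea.
split; first split; rewrite ?even_neq //.
  by move=> a i; rewrite nsetE tE eqSS (inj_eq double_inj) eqn_add2r eqn_pmul2r.
move=> a i na ia; have [oa|/even_neq //] := boolP (odd a).
rewrite nsetE; case: (i =P sim_index s x) => [iE|]; last by rewrite andbF.
by have := ia oa; rewrite iE modnMDl modn_small // eqxx.
Qed.

Lemma sim_indices_runs y z s t : sim s t ->
  runs (sim_indices_prog y z) t (12 * bits J * (addr_cost s y + addr_cost s z))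
    (fun t' => [/\ sim s t', frame t t', index_ready 0 s y t' & index_ready 1 s z t']).
Proof.
move=> st; rewrite mulnDr; apply: runs_seq (sim_index_runs 0 y st) _ => t1 [y1 tt1].
have st1 := sim_scratch tt1 st; apply: runs_post (sim_index_runs 1 z st1) _ => t2 [z2 t12].
split; [exact: sim_scratch t12 st1| |by rewrite /index_ready (nats_scratch _ _ t12)|exact: z2].
exact: frame_trans (frame_scratch tt1) (frame_scratch t12).
Qed.

Lemma sim_read_cost y z s t : sim s t -> index_ready 0 s y t -> index_ready 1 s z t ->
  12 * bits J * (addr_cost s y + addr_cost s z)
    + (nread_cost t (sim_addr 0 y) + nread_cost t (sim_addr 1 z))
  <= 14 * bits J * (nread_cost s y + nread_cost s z).
Proof.
move=> st ty tz; have ry := nread_cost_sim st ty; have rz := nread_cost_sim st tz.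
have : 12 * bits J * (addr_cost s y + addr_cost s z) <=
    12 * bits J * (nread_cost s y + nread_cost s z).
  by rewrite leq_mul2l leq_add ?leq_addr ?orbT.
have -> : 14 * bits J * (nread_cost s y + nread_cost s z) =
    12 * bits J * (nread_cost s y + nread_cost s z)
      + (2 * bits J * nread_cost s y + 2 * bits J * nread_cost s z) by ring.
by move=> idx; rewrite !leq_add.
Qed.

Definition simulates P s N s' : Prop := forall t, sim s t ->
  runs (sim_prog P) t (14 * bits J * N) (fun t' => sim s' t' /\ frame t t').

Lemma simulates_nconst x m s : simulates (NConst x m) s (addr_cost s x + bits m) (nset s x m).
Proof.
move=> t st; apply: (@runs_leq _ _ _
  (12 * bits J * addr_cost s x + (2 * bits J * addr_cost s x + bits m))).
  by have := bits_gt0 J; move: (bits J) (addr_cost s x) (bits m) => A B C; nia.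
apply: runs_seq (sim_index_runs 0 x st) _ => t1 [tx tt1].
have [st1 tt'] := sim_nset m (sim_scratch tt1 st) tx.
apply: runs_nconst; first by rewrite leq_add2r addr_cost_sim.
by split=> //; exact: frame_trans (frame_scratch tt1) tt'.
Qed.

Lemma simulates_nop o x y z s : simulates (NOp o x y z) s
  (addr_cost s x + nread_cost s y + nread_cost s z)
  (nset s x (nat_op_fun o (nget s y) (nget s z))).
Proof.
move=> t st; apply: (@runs_leq _ _ _ (12 * bits J * (addr_cost s y + addr_cost s z)
  + (12 * bits J * addr_cost s x
     + 2 * bits J * (addr_cost s x + (nread_cost s y + nread_cost s z))))).
  have : addr_cost s y <= nread_cost s y by exact: leq_addr.
  have : addr_cost s z <= nread_cost s z by exact: leq_addr.
  move: (addr_cost s x) (addr_cost s y) (addr_cost s z) (nread_cost s y) (nread_cost s z).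
  by move: (bits J) => b a1 a2 a3 n2 n3 ? ?; nia.
apply: runs_seq (sim_indices_runs y z st) _ => t1 [st1 tt1 ty tz].
apply: runs_seq (sim_index_runs 2 x st1) _ => t2 [tx t12].
have st2 := sim_scratch t12 st1.
have {}ty : index_ready 0 s y t2 by rewrite /index_ready (nats_scratch _ _ t12).
have {}tz : index_ready 1 s z t2 by rewrite /index_ready (nats_scratch _ _ t12).
apply: runs_nop.
  have := addr_cost_sim tx; have := nread_cost_sim st2 ty; have := nread_cost_sim st2 tz.
  by rewrite !(mulnDr (2 * bits J)); lia.
rewrite (nget_sim_addr st2 ty) (nget_sim_addr st2 tz).
have [st3 t23] := sim_nset (nat_op_fun o (nget s y) (nget s z)) st2 tx.
by split=> //; apply: frame_trans t23; exact: frame_trans tt1 (frame_scratch t12).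
Qed.

Lemma simulates_seq P Q s s1 s2 N1 N2 :
  simulates P s N1 s1 -> simulates Q s1 N2 s2 -> simulates (Seq P Q) s (N1 + N2) s2.
Proof.
move=> simP simQ t st; rewrite mulnDr; apply: runs_seq (simP t st) _ => t1 [st1 tt1].
apply: runs_post (simQ t1 st1) _ => t2 [st2 t12].
by split=> //; exact: frame_trans tt1 t12.
Qed.

Lemma simulates_ifn y z P Q s s' N :
  simulates (if nget s y <= nget s z then P else Q) s N s' ->
  simulates (IfNLe y z P Q) s (nread_cost s y + nread_cost s z + N) s'.
Proof.
move=> simPQ t st; have [N1 [t1 [ex1 N1_le [st1 tt1 ty tz]]]] := sim_indices_runs y z st.
have [N2 [t2 [ex2 N2_le [st2 t12]]]] := simPQ t1 st1.
do 2!eexists; split; first apply: exec_seq ex1 _; first apply: exec_ifn.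
- rewrite (nget_sim_addr st1 ty) (nget_sim_addr st1 tz).
  by move: ex2; case: ifP => _ ex2; exact: ex2.
- by have := sim_read_cost st1 ty tz; rewrite [14 * bits J * (_ + N)]mulnDr; lia.
by split=> //; exact: frame_trans tt1 t12.
Qed.

Lemma simulates_while_stop y z P s : nget s z <= nget s y ->
  simulates (WhileNLt y z P) s (nread_cost s y + nread_cost s z) s.
Proof.
move=> zy t st; have [N1 [t1 [ex1 N1_le [st1 tt1 ty tz]]]] := sim_indices_runs y z st.
do 2!eexists; split; first apply: exec_seq ex1 _; first apply: exec_while_stop.
- by rewrite (nget_sim_addr st1 ty) (nget_sim_addr st1 tz).
- by have := sim_read_cost st1 ty tz; lia.
by [].
Qed.

Lemma exec_seq_inv P Q s N s' : exec (Seq P Q) s N s' -> exists s1 N1 N2,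
  [/\ exec P s N1 s1, exec Q s1 N2 s' & N = N1 + N2].
Proof.
move=> ex; inversion ex as [| | | | | |P1 Q1 u u1 u2 N1 N2 ex1 ex2| | | |]; subst.
by exists u1, N1, N2.
Qed.

Lemma simulates_while_step y z P s s1 s2 N1 N2 : nget s y < nget s z ->
  simulates P s N1 s1 -> simulates (WhileNLt y z P) s1 N2 s2 ->
  simulates (WhileNLt y z P) s (nread_cost s y + nread_cost s z + N1 + N2) s2.
Proof.
move=> yz simP simW t st.
have [M [t1 [ex M_le [st1 tt1 ty tz]]]] := sim_indices_runs y z st.
have [M1 [t2 [ex1 M1_le [st2 t12]]]] := simP t1 st1.
have [M2 [t3 [/exec_seq_inv [u [L1 [L2 [exu exw LE]]]] M2_le [st3 t23]]]] := simW t2 st2.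
do 2!eexists; split.
- apply: exec_seq ex _; apply: exec_while_step (exec_seq ex1 exu) exw.
  by rewrite (nget_sim_addr st1 ty) (nget_sim_addr st1 tz).
- have := sim_read_cost st1 ty tz; rewrite !(mulnDr (14 * bits J)); lia.
by split=> //; apply: frame_trans tt1 _; exact: frame_trans t12 t23.
Qed.

Lemma sim_exec P s N s' : exec P s N s' -> discrete P -> simulates P s N s'.
Proof.
elim=> {P s N s'} //=.
- move=> s _ t st; exists 1, t; split; [exact: exec_skip|by rewrite muln1 muln_gt0|by []].
- by move=> *; exact: simulates_nconst.
- by move=> *; exact: simulates_nop.
- move=> P Q s s1 s2 N1 N2 _ IH1 _ IH2 /andP[dP dQ].
  exact: simulates_seq (IH1 dP) (IH2 dQ).
- move=> y z P Q s s1 N _ IH /andP[dP dQ]; apply: simulates_ifn; apply: IH.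
  by case: ifP.
- by move=> y z P s zy _; exact: simulates_while_stop.
- move=> y z P s s1 s2 N1 N2 yz _ IH1 _ IH2 dP.
  exact: simulates_while_step yz (IH1 dP) (IH2 dP).
Qed.

End Simulation.

Local Open Scope classical_set_scope.
Local Open Scope ring_scope.

(** * Signed means of powers *)

Section SignedMeans.
Variable R : realType.
Implicit Types (e h x y c : R) (g f : R -> R) (j n : nat).

(* For independent uniform signs u_1, ..., u_j this is the expectation of
   g (x + h (u_1 + ... + u_j)) if e = 1, and the expectation of the same
   quantity multiplied by u_1 ... u_j if e = -1. *)
Fixpoint signed_mean (e h : R) (j : nat) (g : R -> R) (x : R) : R :=
  if j is j'.+1 then
    (signed_mean e h j' g (x + h) + e * signed_mean e h j' g (x - h)) / 2
  else g x.

Lemma signed_meanS e h j g x : signed_mean e h j.+1 g x =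
  (signed_mean e h j g (x + h) + e * signed_mean e h j g (x - h)) / 2.
Proof. by []. Qed.

Lemma eq_signed_mean e h j g f : g =1 f -> signed_mean e h j g =1 signed_mean e h j f.
Proof. by move=> gf; elim: j => [|j IH] x //=; rewrite !IH. Qed.

Lemma signed_meanD e h j g f x :
  signed_mean e h j (fun z => g z + f z) x =
  signed_mean e h j g x + signed_mean e h j f x.
Proof. by elim: j x => [|j IH] x //=; rewrite !IH; field. Qed.

Lemma signed_meanZ e h j c g x :
  signed_mean e h j (fun z => c * g z) x = c * signed_mean e h j g x.
Proof. by elim: j x => [|j IH] x //=; rewrite !IH; field. Qed.

Lemma signed_mean_sum e h j (I : Type) (r : seq I) (F : I -> R -> R) x :
  signed_mean e h j (fun z => \sum_(i <- r) F i z) x =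
  \sum_(i <- r) signed_mean e h j (F i) x.
Proof.
elim: r x => [|i r IH] x.
  rewrite big_nil -[RHS](mul0r (signed_mean e h j (fun=> 0) x)) -signed_meanZ.
  by apply: eq_signed_mean => z; rewrite big_nil mul0r.
rewrite big_cons -IH -signed_meanD; apply: eq_signed_mean => z.
by rewrite big_cons.
Qed.

Lemma signed_meanSr e h j g x : signed_mean e h j.+1 g x =
  signed_mean e h j (fun z => (g (z + h) + e * g (z - h)) / 2) x.
Proof. by elim: j x => [//|j IH] x; rewrite signed_meanS !IH. Qed.

Lemma signed_mean_even e h j g x : (e == 1) || (e == -1) ->
  (forall z, g (- z) = g z) ->
  signed_mean e h j g (- x) = e ^+ j * signed_mean e h j g x.
Proof.
move=> e_sign gE; elim: j x => [|j IH] x /=; first by rewrite expr0 mul1r gE.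
have -> : - x + h = - (x - h) by ring.
have -> : - x - h = - (x + h) by ring.
by rewrite !IH exprS; case/orP: e_sign => /eqP ->; rewrite ?expr1n; field.
Qed.

Lemma normr_sub_shift (z x u b : R) : `|z - (x + u)| <= b -> `|z - x| <= b + `|u|.
Proof.
have -> : z - x = z - (x + u) + u by ring.
by move=> zb; apply: le_trans (ler_normD _ _) _; rewrite lerD2r.
Qed.

Lemma signed_mean_near e h j (r : R -> R -> Prop) g f x :
  (forall u v u' v', r u v -> r u' v' -> r ((u + e * u') / 2) ((v + e * v') / 2)) ->
  (forall z, `|z - x| <= j%:R * `|h| -> r (g z) (f z)) ->
  r (signed_mean e h j g x) (signed_mean e h j f x).
Proof.
move=> rmean; elim: j x => [|j IH] x gf /=.
  by apply: gf; rewrite subrr normr0 mul0r.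
apply: rmean; apply: IH => z /normr_sub_shift; rewrite ?normrN => zx; apply: gf;
by rewrite -natr1 mulrDl mul1r.
Qed.

Lemma eq_signed_mean_near e h j g f x :
  (forall z, `|z - x| <= j%:R * `|h| -> g z = f z) ->
  signed_mean e h j g x = signed_mean e h j f x.
Proof. by move=> gf; apply: (signed_mean_near (r := eq)) gf => u v u' v' -> ->. Qed.

Lemma le_signed_mean h j g f x :
  (forall z, `|z - x| <= j%:R * `|h| -> g z <= f z) ->
  signed_mean 1 h j g x <= signed_mean 1 h j f x.
Proof.
move=> gf; apply: (signed_mean_near (r := <=%R)) gf => u v u' v' uv uv'.
by rewrite !mul1r ler_pM2r ?invr_gt0 // lerD.
Qed.

Lemma signed_mean_ge0 h j g x : (forall z, 0 <= g z) -> 0 <= signed_mean 1 h j g x.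
Proof.
by move=> g0; elim: j x => [|j IH] x //=; rewrite mul1r divr_ge0 // addr_ge0.
Qed.

Lemma normr_signed_mean_le h j g x : (forall z, 0 <= g z) ->
  `|signed_mean (-1) h j g x| <= signed_mean 1 h j g x.
Proof.
move=> g0; elim: j x => [|j IH] x /=; first by rewrite ger0_norm.
rewrite normrM (@ger0_norm _ 2^-1) ?invr_ge0 // ler_pM2r ?invr_gt0 //.
by rewrite mul1r mulN1r; apply: le_trans (ler_normB _ _) _; exact: lerD.
Qed.

Lemma signed_mean_expR h c j x :
  signed_mean 1 h j (fun z => expR (c * z)) x =
  ((expR (c * h) + expR (- (c * h))) / 2) ^+ j * expR (c * x).
Proof.
elim: j x => [|j IH] x /=; first by rewrite expr0 mul1r.
by rewrite !IH exprS !mulrDr !expRD mulrN; field.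
Qed.

Lemma signed_mean_pow n j x : (j < n)%N ->
  signed_mean (-1) 1 n (fun z => z ^+ j) x = 0.
Proof.
elim: n j x => [//|n IH] j x; rewrite ltnS => jn; rewrite signed_meanSr.
transitivity (signed_mean (-1) 1 n (fun z => \sum_(i < j)
    ((1 - (-1) ^+ (j - i)) / 2 *+ 'C(j, i)) * z ^+ i) x).
  apply: eq_signed_mean => z.
  rewrite [z + 1]addrC [z - 1]addrC !exprDn !big_ord_recr /= subnn binn.
  rewrite !expr0 !mulr1n !mul1r.
  set A := \sum_(i < j) _; set B := \sum_(i < j) _.
  have -> : (A + z ^+ j + -1 * (B + z ^+ j)) / 2 = (A - B) / 2 by field.
  rewrite -sumrB mulr_suml; apply: eq_bigr => i _.
  by rewrite expr1n mul1r -mulrnBl !mulrnAl; congr (_ *+ _); field.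
rewrite signed_mean_sum big1 // => i _.
by rewrite signed_meanZ IH ?mulr0 // (leq_trans (ltn_ord i)).
Qed.

Lemma signed_mean_cos (t x : R) l :
  signed_mean (-1) 1 l.*2 (fun z => cos (z * t)) x =
  (-1) ^+ l * sin t ^+ l.*2 * cos (x * t).
Proof.
elim: l x => [|l IH] x; first by rewrite !expr0 !mul1r.
rewrite doubleS !signed_meanS !IH !exprS.
have -> : x + 1 - 1 = x by ring.
have -> : x - 1 + 1 = x by ring.
have -> : (x + 1 + 1) * t = x * t + 2 * t by ring.
have -> : (x - 1 - 1) * t = x * t - 2 * t by ring.
rewrite !cosD cosN sinN.
have -> : cos (2 * t) = 1 - 2 * sin t ^+ 2.
  by rewrite mulr_natl mulr2n cosD; have := cos2Dsin2 t; nra.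
by field.
Qed.

End SignedMeans.

Section HyperbolicCosine.
Variable R : realType.
Implicit Types (x t : R) (f df : R -> R).

Lemma ge0_derive_le f df x : 0 <= x -> (forall t, is_derive t 1 f (df t)) ->
  (forall t, 0 <= t -> 0 <= df t) -> f 0 <= f x.
Proof.
move=> x0 dfE df0; apply: (@ger0_derive1_ndecry _ _ 0) => //.
- by move=> t; rewrite in_itv /= andbT derive1E derive_val => /ltW /df0.
- by apply: continuous_subspaceT => t; apply: differentiable_continuous;
    apply/derivable1_diffP.
Qed.

Lemma sinh_le_mul_cosh x : 0 <= x -> expR x - expR (- x) <= x * (expR x + expR (- x)).
Proof.
move=> x0; rewrite -subr_ge0.
have := @ge0_derive_le (fun t => t * (expR t + expR (- t)) - (expR t - expR (- t)))
  (fun t => t * (expR t - expR (- t))) x x0.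
rewrite mul0r oppr0 expR0 !subrr; apply.
  by move=> t; apply: is_derive_eq; rewrite /GRing.scale /=; ring.
by move=> t t0; rewrite mulr_ge0 // subr_ge0 ler_expR; lra.
Qed.

(* The quotient of the two sides is nonincreasing on [0, +oo[. *)
Lemma cosh_le_gauss x : (expR x + expR (- x)) / 2 <= expR (x ^+ 2 / 2).
Proof.
wlog x0 : x / 0 <= x => [wlog_ge0|].
  have [/wlog_ge0//|xn] := lerP 0 x.
  by have := wlog_ge0 (- x); rewrite opprK sqrrN addrC; apply; lra.
have := @ge0_derive_le
  (fun t => - ((expR t + expR (- t)) * expR (- (t ^+ 2 / 2))))
  (fun t => (t * (expR t + expR (- t)) - (expR t - expR (- t)))
              * expR (- (t ^+ 2 / 2))) x x0.
rewrite expr0n /= mul0r !oppr0 expR0 mulr1 lerN2 (expRN (x ^+ 2 / 2)).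
have gauss_gt0 := expR_gt0 (x ^+ 2 / 2).
move=> monotone; rewrite ler_pdivrMr // [leRHS]mulrC -ler_pdivrMr //.
have -> : (2 : R) = 1 + 1 by [].
apply: monotone => t; first by apply: is_derive_eq; rewrite /GRing.scale /=; field.
by move=> t0; rewrite mulr_ge0 ?expR_ge0 // subr_ge0 sinh_le_mul_cosh.
Qed.

End HyperbolicCosine.

Section SmallOrderDifferences.
Variable R : realType.
Implicit Types (h p q x z m : R) (j n : nat).

Lemma is_derive_signed_mean_powR h q j x : 0 < h -> j%:R * h < x ->
  is_derive x 1 (signed_mean (-1) h j (fun z => z `^ q))
    (q * signed_mean (-1) h j (fun z => z `^ (q - 1)) x).
Proof.
move=> h0; elim: j x => [|j IH] x jhx /=.
  by apply: is_derive1_powR; move: jhx; rewrite mul0r; lra.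
move: jhx; rewrite -natr1 mulrDl mul1r => jhx.
pose S := signed_mean (-1) h j (fun z => z `^ q).
pose S' := signed_mean (-1) h j (fun z => z `^ (q - 1)).
have dSl := IH (x + h) ltac:(lra); have dSr := IH (x - h) ltac:(lra).
have -> : (fun y => (S (y + h) + -1 * S (y - h)) / 2) =
   2^-1 *: ((S \o (fun y => y + h)) - (S \o (fun y => y - h))).
  by apply/funext => y; rewrite !fctE /= /GRing.scale /=; ring.
by apply: is_derive_eq; rewrite /GRing.scale /= -/S'; ring.
Qed.

(* Each difference is expressed by the mean value theorem. *)
Lemma signed_mean_powR_ge h q j x : 0 < h -> j%:R <= q -> j%:R * h < x ->
  h ^+ j * \prod_(i < j) (q - i%:R) * (x - j%:R * h) `^ (q - j%:R)
  <= signed_mean (-1) h j (fun z => z `^ q) x.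
Proof.
move=> h0; elim: j q x => [|j IH] q x.
  by rewrite expr0 big_ord0 !mul1r mul0r !subr0.
rewrite -natr1 mulrDl mul1r => jq hx.
set S := signed_mean (-1) h j (fun z => z `^ q).
pose S' := signed_mean (-1) h j (fun z => z `^ (q - 1)).
have dS z : x - h <= z -> is_derive z 1 S (q * S' z).
  by move=> xz; apply: is_derive_signed_mean_powR => //; lra.
have [z] : exists2 z, z \in `]x - h, x + h[ & S (x + h) - S (x - h) = q * S' z * (x + h - (x - h)).
  apply: MVT; first by lra.
    by move=> z; rewrite in_itv /= => /andP[/ltW /dS].
  apply: derivable_within_continuous => z; rewrite in_itv /= => /andP[/dS dz _].
  exact: ex_derive.
rewrite in_itv /= => /andP[z1 z2] SE.
have -> : (S (x + h) + -1 * S (x - h)) / 2 = q * h * S' z.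
  by rewrite mulN1r SE; field.
have q0 : 0 <= q by apply: le_trans jq; rewrite addr_ge0.
apply: le_trans (ler_wpM2l _ (IH (q - 1) z _ _)); [|by rewrite mulr_ge0 // ltW|lra|lra].
rewrite exprS big_ord_recl /= subr0.
under eq_bigr do rewrite /bump /= natrD opprD addrA.
have prod_ge0 : 0 <= \prod_(i < j) (q - 1 - i%:R).
  apply: prodr_ge0 => i _; have : (i%:R : R) <= j%:R by rewrite ler_nat ltnW.
  by lra.
have -> : q - (j%:R + 1) = q - 1 - j%:R by ring.
rewrite [leRHS](_ : _ = h * h ^+ j * (q * \prod_(i < j) (q - 1 - i%:R)) *
  (z - j%:R * h) `^ (q - 1 - j%:R)); last by ring.
apply: ler_wpM2l; first by rewrite !mulr_ge0 // ?exprn_ge0 ?ltW.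
by apply: ge0_ler_powR; rewrite ?nnegrE; lra.
Qed.

Lemma expRN1_le m : 2 <= m -> expR (-1) <= (1 - m^-1) `^ (m - 2).
Proof.
move=> m2; have base : expR (- (m - 1)^-1) <= 1 - m^-1.
  rewrite expRN.
  have -> : 1 - m^-1 = (1 + (m - 1)^-1)^-1 by field; lra.
  rewrite lef_pV2 ?posrE ?expR_gt0 ?expR_ge1Dx // ltr_wpDr //.
  by rewrite invr_ge0; lra.
apply: (@le_trans _ _ (expR (- (m - 1)^-1) `^ (m - 2))).
  by rewrite -expRM ler_expR mulNr lerN2 mulrC ler_pdivrMr; lra.
apply: ge0_ler_powR; rewrite ?nnegrE ?expR_ge0 //; first by lra.
exact: le_trans (expR_ge0 _) base.
Qed.

Lemma falling_powR_ge p j : 0 < p -> j%:R <= p ->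
  expR (- j%:R) * (p - j%:R + 1) / (p + 1) <=
  (p + 1)^-1 ^+ j * \prod_(i < j) (p - i%:R)
    * (1 - j%:R * (p + 1)^-1) `^ (p - j%:R).
Proof.
move=> p0; elim: j => [|j IH].
  move=> _; rewrite ?mulr0n oppr0 expR0 expr0 big_ord0 mul0r !subr0 powR1.
  by rewrite [leLHS](_ : _ = 1) ?mulr1 //; field; lra.
rewrite -natr1 => jp.
have {}IH := IH ltac:(lra); set m := p - j%:R + 1; have m2 : 2 <= m by rewrite /m; lra.
set b := p + 1 in IH *; have b0 : 0 < b by rewrite /b; lra.
set X := 1 - j%:R * b^-1 in IH; have X0 : 0 < X by rewrite subr_gt0 ltr_pdivrMr // /b; lra.
have -> : 1 - (j%:R + 1) * b^-1 = X * (1 - m^-1) by rewrite /X /m /b; field; rewrite /b; lra.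
rewrite powRM; [|exact: ltW|by rewrite subr_ge0 invf_le1; lra].
rewrite exprS big_ord_recr /=.
have -> : p - (j%:R + 1) = m - 2 by rewrite /m; ring.
have XE : X `^ (p - j%:R) = X `^ (m - 2) * X.
  rewrite -[X in _ = _ * X]powRr1 ?ltW // -powRD; last by apply/implyP => _; rewrite gt_eqF.
  by congr (_ `^ _); rewrite /m; ring.
rewrite XE in IH; set P := \prod_(i < j) _ in IH *; set c := (1 - m^-1) `^ (m - 2).
have -> : b^-1 * b^-1 ^+ j * (P * (p - j%:R)) * (X `^ (m - 2) * c) =
   (b^-1 ^+ j * P * (X `^ (m - 2) * X)) * ((p - j%:R) / m * c).
  by rewrite /X /m /b; field; rewrite /b; lra.
apply: (@le_trans _ _ (expR (- j%:R) * m / b * ((p - j%:R) / m * c))); last first.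
  apply: ler_wpM2r => //; apply: mulr_ge0; last exact: powR_ge0.
  by rewrite divr_ge0; lra.
have -> : expR (- (j%:R + 1)) * (m - 2 + 1) / b =
   (expR (- j%:R) * m / b) * ((p - j%:R) / m * expR (-1)).
  by rewrite opprD expRD /m /b; field; rewrite /b; lra.
apply: ler_wpM2l; first by rewrite !mulr_ge0 ?expR_ge0 ?invr_ge0; lra.
by apply: ler_wpM2l (expRN1_le m2); rewrite divr_ge0; lra.
Qed.

Lemma small_order_difference_ge p j : 1 <= p -> j%:R <= p ->
  expR (- j%:R) / (p + 1) <= signed_mean (-1) (p + 1)^-1 j (fun z => `|z| `^ p) 1.
Proof.
move=> p1 jp; set h := (p + 1)^-1; have h0 : 0 < h by rewrite invr_gt0; lra.
have jh : j%:R * h < 1 by rewrite ltr_pdivrMr; lra.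
rewrite [leRHS](@eq_signed_mean_near _ _ _ _ _ (fun z => z `^ p)); last first.
  move=> z; rewrite (gtr0_norm h0) => hz.
  by rewrite ger0_norm //; move: hz; rewrite ler_norml; lra.
apply: le_trans (signed_mean_powR_ge h0 jp jh).
apply: le_trans (falling_powR_ge _ jp); last by lra.
by rewrite ler_pM2r ?invr_gt0; [rewrite ler_peMr ?expR_ge0 //; lra|lra].
Qed.

Lemma small_order_mean_le p j : 1 <= p -> j%:R <= p ->
  signed_mean 1 (p + 1)^-1 j (fun z => `|z| `^ p) 1 <= expR (j%:R / 2).
Proof.
move=> p1 jp; set h := (p + 1)^-1; have h0 : 0 < h by rewrite invr_gt0; lra.
have jh : j%:R * h < 1 by rewrite ltr_pdivrMr; lra.
apply: (@le_trans _ _ (signed_mean 1 h j (fun z => expR (- p) * expR (p * z)) 1)).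
  apply: le_signed_mean => z; rewrite (gtr0_norm h0) => hz.
  have z0 : 0 <= z by move: hz; rewrite ler_norml; lra.
  rewrite ger0_norm // -expRD.
  have -> : - p + p * z = (z - 1) * p by ring.
  rewrite expRM; apply: ge0_ler_powR; rewrite ?nnegrE ?expR_ge0 //; first by lra.
  by have := expR_ge1Dx (z - 1); lra.
rewrite signed_meanZ signed_mean_expR mulr1 mulrCA -expRD addNr expR0 mulr1.
rewrite expRM_natl; apply: lerXn2r; rewrite ?nnegrE ?expR_ge0 //.
apply: le_trans (cosh_le_gauss _) _; rewrite ler_expR ler_pdivrMr // mulVf //.
by rewrite expr_le1 //; [rewrite ler_pdivrMr; lra|rewrite divr_ge0; lra].
Qed.

Lemma small_order_ratio p j : 1 <= p -> j%:R <= p ->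
  let h := (p + 1)^-1 in
  0 < signed_mean 1 h j (fun z => `|z| `^ p) 1 /\
  (expR (- (3 / 2 * p)) / (p + 1)) * signed_mean 1 h j (fun z => `|z| `^ p) 1
  <= signed_mean (-1) h j (fun z => `|z| `^ p) 1.
Proof.
move=> p1 jp h; have diff_ge := small_order_difference_ge p1 jp.
split.
  apply: lt_le_trans (normr_signed_mean_le _ _ _ _); last by move=> z; exact: powR_ge0.
  apply: lt_le_trans (le_trans diff_ge (ler_norm _)).
  by rewrite divr_gt0 ?expR_gt0 //; lra.
apply: le_trans diff_ge; apply: le_trans (ler_wpM2l _ (small_order_mean_le p1 jp)) _.
  by rewrite divr_ge0 ?expR_ge0; lra.
by rewrite mulrAC -expRD ler_pM2r ?invr_gt0 ?ler_expR; lra.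
Qed.

Lemma powR_le_expR p (th : R) x : 0 < p -> 0 < th -> 0 <= x ->
  x `^ p <= (p / (expR 1 * th)) `^ p * expR (th * x).
Proof.
move=> p0 th0 x0.
have -> : th * x = th * x / p * p by field; lra.
rewrite expRM -powRM ?expR_ge0 //; last by rewrite divr_ge0 ?mulr_ge0 ?ltW //; lra.
apply: ge0_ler_powR; rewrite ?nnegrE ?(ltW p0) //.
  by rewrite ltW // !mulr_gt0 ?invr_gt0 ?mulr_gt0 ?expR_gt0.
have -> : p / (expR 1 * th) * expR (th * x / p) = (p / th) * expR (th * x / p - 1).
  by rewrite expRB; field; rewrite !gt_eqF.
have xE : x = p / th * (th * x / p) by field; rewrite !gt_eqF.
rewrite {1}xE ler_pM2l ?divr_gt0 //.
by have := expR_ge1Dx (th * x / p - 1); lra.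
Qed.

Lemma moment_bound p n : 1 <= p -> (0 < n)%N ->
  signed_mean 1 1 n (fun z => `|z| `^ p) 0 <= 2 * (p * n%:R / expR 1) `^ (p / 2).
Proof.
move=> p1 n0; have n1 : 0 < n%:R :> R by rewrite ltr0n.
have e1 := expR_gt0 (1 : R); pose th := Num.sqrt (p / n%:R).
have th2 : th ^+ 2 = p / n%:R by rewrite sqr_sqrtr // divr_ge0 //; lra.
have th0 : 0 < th by rewrite sqrtr_gt0 divr_gt0 //; lra.
have base_ge0 : 0 <= p / (expR 1 * th) by rewrite divr_ge0 ?mulr_ge0 ?ltW //; lra.
pose c := (p / (expR 1 * th)) `^ p; have c0 : 0 <= c by exact: powR_ge0.
have pow_le z : `|z| `^ p <= c * expR (th * z) + c * expR (- th * z).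
  apply: le_trans (powR_le_expR _ th0 (normr_ge0 z)) _; first by lra.
  have [z0|z0] := lerP 0 z; first by rewrite ger0_norm // lerDl mulr_ge0 ?expR_ge0.
  by rewrite ltr0_norm // mulrN mulNr lerDr mulr_ge0 ?expR_ge0.
apply: le_trans (le_signed_mean (fun z _ => pow_le z)) _.
rewrite signed_meanD !signed_meanZ !signed_mean_expR !mulr0 !mulr1 expR0 !mulr1.
rewrite opprK [expR (- th) + _]addrC.
rewrite [leLHS](_ : _ = 2 * (c * ((expR th + expR (- th)) / 2) ^+ n)); last by ring.
apply: ler_wpM2l => //; apply: (@le_trans _ _ (c * expR (p / 2))).
  apply: ler_wpM2l => //.
  have -> : expR (p / 2) = expR (th ^+ 2 / 2) ^+ n.
    by rewrite -expRM_natl; congr expR; rewrite th2; field; rewrite gt_eqF.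
  by apply: lerXn2r; rewrite ?nnegrE ?expR_ge0 //; exact: cosh_le_gauss.
have -> : c = ((p / (expR 1 * th)) ^+ 2) `^ (p / 2).
  by rewrite -powR_mulrn // -powRrM /c; congr (_ `^ _); field.
have -> : expR (p / 2) = expR 1 `^ (p / 2) by rewrite -expRM mul1r.
rewrite -powRM ?exprn_even_ge0 ?expR_ge0 // exprMn exprVn exprMn th2.
by rewrite le_eqVlt; apply/orP; left; apply/eqP; congr (_ `^ _); field; rewrite !gt_eqF //; lra.
Qed.

End SmallOrderDifferences.

Section CosineRemainder.
Variable R : realType.
Implicit Types (t x s p : R) (q l j : nat).

(* The remainders of the Taylor expansions of cos (up to degree 2q) and sin (up
   to degree 2q + 1), with the sign that makes them nonnegative. *)
Fixpoint cos_rem q t : R :=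
  if q is q'.+1 then t ^+ q.*2 / (q.*2)`!%:R - cos_rem q' t else 1 - cos t.

Fixpoint sin_rem q t : R :=
  if q is q'.+1 then t ^+ q.*2.+1 / (q.*2.+1)`!%:R - sin_rem q' t else t - sin t.

Lemma is_derive_pow_fact n t :
  is_derive t 1 (fun x : R => x ^+ n.+1 / n.+1`!%:R) (t ^+ n / n`!%:R).
Proof.
have -> : (fun x : R => x ^+ n.+1 / n.+1`!%:R) =
    (n.+1`!%:R^-1 : R) *: ((@id R) ^+ n.+1).
  by apply/funext => x; rewrite !fctE /GRing.scale /= mulrC.
apply: is_derive_eq.
rewrite /GRing.scale /= !mulr1.
have fact_neq0 : n`!%:R != 0 :> R by rewrite pnatr_eq0 -lt0n fact_gt0.
have succ_neq0 : n.+1%:R != 0 :> R by rewrite pnatr_eq0.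
rewrite factS natrM -mulr_natl; field.
by rewrite fact_neq0 addrC natr1 succ_neq0.
Qed.

Lemma is_derive_cos_rem q t : is_derive t 1 (cos_rem q.+1) (sin_rem q t).
Proof.
elim: q => [|q IH].
  apply: (@is_deriveB _ _ _ (fun x : R => x ^+ 2 / 2`!%:R) (cos_rem 0) t 1).
    by have := is_derive_pow_fact 1 t; rewrite divr1 expr1.
  have : is_derive t 1 (fun x : R => 1 - cos x) (sin t).
    by apply: is_derive_eq; rewrite /GRing.scale /=; ring.
  by [].
apply: (@is_deriveB _ _ _ (fun x : R => x ^+ q.+2.*2 / (q.+2.*2)`!%:R) (cos_rem q.+1) t 1).
exact: is_derive_pow_fact.
Qed.

Lemma is_derive_sin_rem q t : is_derive t 1 (sin_rem q) (cos_rem q t).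
Proof.
elim: q => [|q IH].
  have : is_derive t 1 (fun x : R => x - sin x) (1 - cos t).
    by apply: is_derive_eq; rewrite /GRing.scale /=; ring.
  by [].
apply: (@is_deriveB _ _ _ (fun x : R => x ^+ q.+1.*2.+1 / (q.+1.*2.+1)`!%:R) (sin_rem q) t 1).
exact: is_derive_pow_fact.
Qed.

Lemma cos_rem_at0 q : cos_rem q 0 = 0.
Proof.
elim: q => [|q IH] /=; first by rewrite cos0 subrr.
by rewrite IH doubleS exprS !mul0r subr0.
Qed.

Lemma sin_rem_at0 q : sin_rem q 0 = 0.
Proof.
elim: q => [|q IH] /=; first by rewrite sin0 subrr.
by rewrite IH exprS !mul0r subr0.
Qed.

Lemma cos_rem_ge0_half q t : 0 <= t -> 0 <= cos_rem q t.
Proof.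
elim: q t => [|q IH] t t0; first by rewrite subr_ge0 cos_le1.
have sin0 u : 0 <= u -> 0 <= sin_rem q u.
  move=> u0; rewrite -(sin_rem_at0 q).
  exact: (ge0_derive_le u0 (is_derive_sin_rem q)).
rewrite -(cos_rem_at0 q.+1).
exact: (ge0_derive_le t0 (is_derive_cos_rem q)).
Qed.

Lemma cos_remN q t : cos_rem q (- t) = cos_rem q t.
Proof.
elim: q => [|q IH] /=; first by rewrite cosN.
by rewrite IH exprNn -signr_odd odd_double mul1r.
Qed.

Lemma cos_rem_ge0 q t : 0 <= cos_rem q t.
Proof.
have [t0|t0] := lerP 0 t; first exact: cos_rem_ge0_half.
by rewrite -cos_remN cos_rem_ge0_half // oppr_ge0 ltW.
Qed.

Lemma cos_rem_le q t : cos_rem q t <= t ^+ q.+1.*2 / (q.+1.*2)`!%:R.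
Proof. by have := cos_rem_ge0 q.+1 t; rewrite /= subr_ge0. Qed.

Lemma cos_rem_le2 q t : cos_rem q t <= 2 * (t ^+ q.*2 / (q.*2)`!%:R).
Proof.
case: q => [|q]; first by rewrite /= expr0 divr1 mulr1; have := cos_geN1 t; lra.
have := cos_rem_ge0 q t; have := cos_rem_ge0 q.+1 t; rewrite /=; lra.
Qed.

Lemma continuous_cos_rem q : continuous (cos_rem q).
Proof.
move=> t; case: q => [|q].
  apply: cvgB; [exact: cvg_cst|exact: continuous_cos].
by apply: differentiable_continuous; apply/derivable1_diffP; apply: ex_derive;
  exact: is_derive_cos_rem.
Qed.

Lemma signed_mean_cos_rem q l t : (q < l)%N ->
  signed_mean (-1) 1 l.*2 (fun z => cos_rem q (z * t)) 0 =
  (-1) ^+ (q.+1 + l) * sin t ^+ l.*2.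
Proof.
have zero j : (j < l.*2)%N -> forall c,
    signed_mean (-1) 1 l.*2 (fun z : R => c * z ^+ j) 0 = 0.
  by move=> jl c; rewrite signed_meanZ signed_mean_pow // mulr0.
elim: q => [|q IH] ql.
  transitivity (signed_mean (-1) 1 l.*2 (fun z : R => 1 * z ^+ 0 + (-1) * cos (z * t)) 0).
    by apply: eq_signed_mean => z /=; rewrite expr0 mulr1 mulN1r.
  rewrite signed_meanD zero; last by rewrite double_gt0.
  by rewrite add0r signed_meanZ signed_mean_cos mul0r cos0 mulr1 add1n exprS mulrA.
transitivity (signed_mean (-1) 1 l.*2 (fun z : R =>
   (t ^+ q.+1.*2 / (q.+1.*2)`!%:R) * z ^+ q.+1.*2 + (-1) * cos_rem q (z * t)) 0).
  by apply: eq_signed_mean => z; rewrite [in LHS]/= mulN1r exprMn; ring.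
rewrite signed_meanD zero ?ltn_double // add0r signed_meanZ IH; last exact: ltnW.
by rewrite [(q.+2 + l)%N]addSn exprS mulrA.
Qed.

End CosineRemainder.

Section ExponentialIntegrals.
Variable R : realType.
Implicit Types (c s a : R).
Local Notation mu := lebesgue_measure.

Lemma continuous_expRM c : continuous (fun s => expR (c * s)).
Proof.
move=> s; apply: (@continuous_comp _ _ _ (fun s => c * s) expR); last exact: continuous_expR.
by apply: cvgM; [exact: cvg_cst|exact: cvg_id].
Qed.

Lemma measurable_expRM c (D : set R) : measurable_fun D (fun s => (expR (c * s))%:E).
Proof.
apply/measurable_EFinP; apply: measurable_funTS; apply: continuous_measurable_fun.
exact: continuous_expRM.
Qed.

Lemma measurable_cst_expRM b c (D : set R) : measurable_fun D (fun s => (b * expR (c * s))%:E).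
Proof.
apply/measurable_EFinP; apply: measurable_funTS; apply: continuous_measurable_fun => s.
by apply: cvgM; [exact: cvg_cst|exact: continuous_expRM].
Qed.

Lemma integral_expR_right c a : 0 < c ->
  (\int[mu]_(s in `[a, +oo[) (expR (- c * s))%:E = (expR (- c * a) / c)%:E)%E.
Proof.
move=> c0; pose F s := - (expR (- c * s) / c).
have dF s : is_derive s 1 F (expR (- c * s)).
  by apply: is_derive_eq; rewrite /GRing.scale /=; field; rewrite gt_eqF.
have cF : continuous F.
  by move=> s; apply: cvgN; apply: cvgM; [exact: continuous_expRM|exact: cvg_cst].
rewrite (@ge0_continuous_FTC2y _ _ F _ 0); first by rewrite sub0e -EFinN opprK.
- by move=> x _; exact: expR_ge0.
- exact/continuous_subspaceT/continuous_expRM.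
- rewrite -oppr0; apply: cvgN; rewrite -[X in _ --> X](mul0r c^-1).
  apply: cvgM; last exact: cvg_cst.
  under eq_fun do rewrite mulNr.
  apply: (@cvg_comp _ _ _ (fun z => c * z) (fun z => expR (- z)) _ (pinfty_nbhs R));
    last exact: cvgr_expR.
  exact: gt0_cvgMry.
- by move=> x _; exact: ex_derive.
- exact/cvg_at_right_filter/cF.
- by move=> z _; rewrite derive1E; apply: derive_val.
Qed.

Lemma integral_expR_left c a : 0 < c ->
  (\int[mu]_(s in `]-oo, a]) (expR (c * s))%:E = (expR (c * a) / c)%:E)%E.
Proof.
move=> c0; rewrite -[a in LHS]opprK ge0_integration_by_substitutionNy; last 2 first.
- exact/continuous_subspaceT/continuous_expRM.
- by move=> s _; exact: expR_ge0.
under eq_integral do rewrite /= mulrN -mulNr.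
by rewrite integral_expR_right // mulrNN.
Qed.

End ExponentialIntegrals.

Section SineNearPeak.
Variable R : realType.
Implicit Types (x y b h : R) (n : nat).

Lemma bernoulli_subr y n : 0 <= y <= 1 -> 1 - n%:R * y <= (1 - y) ^+ n.
Proof.
move=> /andP[y0 y1]; elim: n => [|n IH]; first by rewrite mul0r subr0 expr0.
rewrite exprS -natr1; apply: le_trans (ler_wpM2l _ IH); last by lra.
have : 0 <= n%:R * y ^+ 2 by rewrite mulr_ge0 // sqr_ge0.
by rewrite expr2; nra.
Qed.

Lemma sin_pow_ge_half n x : n%:R * (pi / 2 - x) ^+ 2 <= 1 -> (pi / 2 - x) ^+ 2 <= 2 ->
  2^-1 <= sin x ^+ n.
Proof.
set y := pi / 2 - x => ny y2; have -> : x = pi / 2 - y by rewrite /y; ring.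
have -> : sin (pi / 2 - y) = cos y by rewrite sinB sin_pihalf cos_pihalf mul1r mul0r subr0.
have cos_ge : 1 - y ^+ 2 / 2 <= cos y.
  by have : 1 - cos y <= y ^+ 2 / 2 := cos_rem_le 0 y; lra.
have half_ge0 : 0 <= y ^+ 2 / 2 by rewrite divr_ge0 // sqr_ge0.
apply: (@le_trans _ _ ((1 - y ^+ 2 / 2) ^+ n)).
  by apply: le_trans (bernoulli_subr n _); [lra|apply/andP; split; lra].
by apply: lerXn2r; rewrite ?nnegrE; lra.
Qed.

Lemma ln_subr_ge b h : 0 < h -> h < b -> h / b <= ln b - ln (b - h).
Proof.
move=> h0 hb; have hb1 : h / b < 1 by rewrite ltr_pdivrMr; lra.
have := @le_ln1Dx R (- (h / b)); rewrite ltrN2 => /(_ hb1).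
have -> : 1 - h / b = (b - h) / b by field; lra.
by rewrite ln_div ?posrE; lra.
Qed.

End SineNearPeak.

Section PowerAsCosineIntegral.
Variable R : realType.
Variables (p : R) (q : nat).
Hypotheses (q_lt_p : q.*2%:R < p) (p_lt_q : p < q.+1.*2%:R).
Implicit Types (x s t c : R).
Local Notation mu := lebesgue_measure.

(* The substitution t = exp s turns the integral of cos_rem q (x t) t^(-p-1)
   over t > 0 into an integral over the line, on which rescaling x acts by
   translation. *)
Definition osc x s : R := cos_rem q (x * expR s) * expR (- p * s).

Lemma osc_ge0 x s : 0 <= osc x s.
Proof. by rewrite mulr_ge0 ?cos_rem_ge0 ?expR_ge0. Qed.

Lemma continuous_osc x : continuous (osc x).
Proof.
move=> s; apply: cvgM; last exact: continuous_expRM.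
apply: (@continuous_comp _ _ _ (fun s => x * expR s) (cos_rem q)); last first.
  exact: continuous_cos_rem.
by apply: cvgM; [exact: cvg_cst|exact: continuous_expR].
Qed.

Lemma measurable_osc x (D : set R) : measurable_fun D (fun s => (osc x s)%:E).
Proof.
apply/measurable_EFinP; apply: measurable_funTS; apply: continuous_measurable_fun.
exact: continuous_osc.
Qed.

Lemma osc_translate x s : 0 < x -> osc 1 (s + ln x) = x `^ (- p) * osc x s.
Proof.
move=> x0; have -> : x `^ (- p) = expR (- p * ln x) by rewrite /powR gt_eqF.
by rewrite /osc mul1r expRD lnK ?posrE // mulrDr expRD [expR s * x]mulrC; ring.
Qed.

Lemma integral_osc_scale x : 0 < x ->
  (\int[mu]_s (osc 1 s)%:E = (x `^ (- p))%:E * \int[mu]_s (osc x s)%:E)%E.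
Proof.
move=> x0; have dE : derive1 (fun s : R => s + ln x) = cst 1.
  by apply/funext => s; rewrite derive1E derive_val addr0.
rewrite (@increasing_ge0_integration_by_substitutionT _ (fun s => s + ln x) (osc 1)).
- rewrite -ge0_integralZl //; last by rewrite lee_fin powR_ge0.
  + by apply: eq_integral => s _; rewrite dE /= !fctE /= mulr1 osc_translate.
  + exact: measurable_osc.
  + by move=> s _; rewrite lee_fin osc_ge0.
- by move=> a b ab; rewrite ltrD2r.
- by rewrite dE => s; exact: cvg_cst.
- by rewrite dE; exact: is_cvg_cst.
- by rewrite dE; exact: is_cvg_cst.
- by move=> s; exact: ex_derive.
- exact: cvg_addrr_Ny.
- exact: cvg_addrr.
- exact: continuous_osc.
- exact: osc_ge0.
Qed.

Let a : R := p - q.*2%:R.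

Let a_gt0 : 0 < a.
Proof. by rewrite subr_gt0. Qed.

Let a_lt2 : 0 < 2 - a.
Proof. by have := p_lt_q; rewrite /a doubleS -addn2 natrD; lra. Qed.

Let p_gt0 : 0 < p.
Proof. exact: le_lt_trans q_lt_p. Qed.

Lemma osc_le_left s : osc 1 s <= (q.+1.*2)`!%:R^-1 * expR ((2 - a) * s).
Proof.
rewrite /osc mul1r; apply: (le_trans (ler_wpM2r (expR_ge0 _) (cos_rem_le _ _))).
have -> : expR ((2 - a) * s) = expR s ^+ q.+1.*2 * expR (- p * s).
  by rewrite -expRM_natl -expRD /a doubleS -addn2 natrD; congr expR; ring.
by rewrite le_eqVlt; apply/orP; left; apply/eqP; ring.
Qed.

Lemma osc_le_right s : osc 1 s <= 2 / (q.*2)`!%:R * expR (- a * s).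
Proof.
rewrite /osc mul1r; apply: (le_trans (ler_wpM2r (expR_ge0 _) (cos_rem_le2 _ _))).
have -> : expR (- a * s) = expR s ^+ q.*2 * expR (- p * s).
  by rewrite -expRM_natl -expRD /a; congr expR; ring.
by rewrite le_eqVlt; apply/orP; left; apply/eqP; ring.
Qed.

Lemma integral_osc_le_expR (D : set R) b c : measurable D -> 0 <= b ->
  (forall s, osc 1 s <= b * expR (c * s)) ->
  (\int[mu]_(s in D) (osc 1 s)%:E <= b%:E * \int[mu]_(s in D) (expR (c * s))%:E)%E.
Proof.
move=> mD b0 osc_le; rewrite -ge0_integralZl //; last exact: measurable_expRM.
apply: ge0_le_integral => //.
- by move=> s _; rewrite lee_fin osc_ge0.
- exact: measurable_osc.
- exact: measurable_cst_expRM.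
by move=> s _; rewrite -EFinM lee_fin.
Qed.

Lemma integral_osc_le (t : R) : 0 < t ->
  (\int[mu]_s (osc 1 s)%:E <=
   (t `^ (2 - a) / (2 - a) / (q.+1.*2)`!%:R + 2 * (t `^ (- a) / a) / (q.*2)`!%:R)%:E)%E.
Proof.
move=> t0; rewrite -(setUv `]-oo, (ln t)]%classic) ge0_integral_setU //; last 4 first.
- exact: measurableC.
- exact: measurable_osc.
- by move=> s _; rewrite lee_fin osc_ge0.
- exact/disj_setPCl.
rewrite EFinD; apply: leeD.
  apply: le_trans (integral_osc_le_expR _ _ osc_le_left) _ => //.
  by rewrite integral_expR_left // -EFinM lee_fin mulrC /powR gt_eqF.
rewrite setCitvl integral_itv_obnd_cbnd; last exact: measurable_osc.
apply: le_trans (integral_osc_le_expR _ _ osc_le_right) _ => //.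
by rewrite integral_expR_right // -EFinM lee_fin /powR gt_eqF // mulrAC mulrA.
Qed.

Let K : R := \int[mu]_s (osc 1 s).

Lemma integral_osc1 : (\int[mu]_s (osc 1 s)%:E)%E = K%:E.
Proof.
rewrite /K /Rintegral fineK // ge0_fin_numE.
  by apply: le_lt_trans (integral_osc_le ltr01) _; exact: ltry.
by apply: integral_ge0 => s _; rewrite lee_fin osc_ge0.
Qed.

Lemma integral_osc x : (\int[mu]_s (osc x s)%:E)%E = (`|x| `^ p * K)%:E.
Proof.
wlog x0 : x / 0 <= x => [wlog_ge0|].
  have [|xn] := lerP 0 x; first exact: wlog_ge0.
  have <- : (\int[mu]_s (osc (- x) s)%:E)%E = (\int[mu]_s (osc x s)%:E)%E.
    by apply: eq_integral => s _; rewrite /osc mulNr cos_remN.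
  by rewrite wlog_ge0 ?normrN // oppr_ge0 ltW.
move: x0; rewrite le_eqVlt => /predU1P[<-|x0].
  rewrite normr0 powR0 ?gt_eqF // mul0r; apply: integral0_eq => s _.
  by rewrite /osc mul0r cos_rem_at0 mul0r.
rewrite (gtr0_norm x0) EFinM -integral_osc1 (integral_osc_scale x0) muleA -EFinM -powRD.
  by rewrite subrr powRr0 mul1e.
by apply/implyP => _; rewrite gt_eqF.
Qed.

Lemma integrable_osc x : mu.-integrable setT (fun s => (osc x s)%:E).
Proof.
apply/integrableP; split; first exact: measurable_osc.
have -> : (\int[mu]_s `|(osc x s)%:E| = \int[mu]_s (osc x s)%:E)%E.
  by apply: eq_integral => s _; rewrite gee0_abs // lee_fin osc_ge0.
by rewrite integral_osc ltry.
Qed.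

Lemma integral_signed_mean_osc j x :
  mu.-integrable setT (fun s => (signed_mean (-1) 1 j (osc^~ s) x)%:E) /\
  \int[mu]_s (signed_mean (-1) 1 j (osc^~ s) x) =
  signed_mean (-1) 1 j (fun z => `|z| `^ p) x * K.
Proof.
elim: j x => [|j IH] x /=.
  by split; [exact: integrable_osc|rewrite /Rintegral integral_osc].
have [int_l meanl] := IH (x + 1); have [int_r meanr] := IH (x - 1).
have signed_meanE s : (signed_mean (-1) 1 j (osc^~ s) (x + 1) +
    -1 * signed_mean (-1) 1 j (osc^~ s) (x - 1)) / 2 =
    2^-1 * (signed_mean (-1) 1 j (osc^~ s) (x + 1) -
     signed_mean (-1) 1 j (osc^~ s) (x - 1)) by field.
have int_diff := integrableB measurableT int_l int_r; split.
  by under eq_fun do rewrite signed_meanE EFinM; exact: (integrableZl measurableT _ int_diff).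
under eq_Rintegral do rewrite signed_meanE.
by rewrite RintegralZl // RintegralB // meanl meanr; field.
Qed.

Definition sin_pow_osc n s : R := sin (expR s) ^+ n * expR (- p * s).

Lemma sin_pow_osc_ge0 n s : ~~ odd n -> 0 <= sin_pow_osc n s.
Proof. by move=> en; rewrite mulr_ge0 ?expR_ge0 ?exprn_even_ge0. Qed.

Lemma measurable_sin_pow_osc n (D : set R) : measurable_fun D (fun s => (sin_pow_osc n s)%:E).
Proof.
apply/measurable_EFinP; apply: measurable_funTS; apply: continuous_measurable_fun => s.
apply: cvgM; last exact: continuous_expRM.
apply: (@continuous_comp _ _ _ (fun s => sin (expR s)) (fun x => x ^+ n)).
  by apply: (@continuous_comp _ _ _ expR sin); [exact: continuous_expR|exact: continuous_sin].
exact: exprn_continuous.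
Qed.

(* The integrand is large while exp s is within 1 / sqrt n of pi / 2. *)
Lemma integral_sin_pow_osc_ge n : (1 < n)%N -> ~~ odd n ->
  ((2^-1 * (2 / pi) `^ (p + 1) / Num.sqrt n%:R)%:E <= \int[mu]_s (sin_pow_osc n s)%:E)%E.
Proof.
move=> n1 en; have n2 : 2 <= n%:R :> R by rewrite ler_nat.
have pi2 := pi_ge2 R; pose sn : R := Num.sqrt n%:R.
have sn2 : sn ^+ 2 = n%:R by rewrite sqr_sqrtr.
have sn1 : 1 < sn by rewrite -(ltr_pXn2r (_ : 0 < 2)%N) ?nnegrE ?sqrtr_ge0 // sn2 expr1n; lra.
pose h := sn^-1; have h0 : 0 < h by rewrite invr_gt0; lra.
have h1 : h < 1 by rewrite invf_lt1; lra.
have nh2 : n%:R * h ^+ 2 = 1 by rewrite -sn2 -exprMn divff ?expr1n // gt_eqF //; lra.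
pose s1 := ln (pi / 2 - h : R); pose s2 := ln (pi / 2 : R).
have s12 : s1 < s2 by rewrite ltr_ln ?posrE //; lra.
pose c : R := 2^-1 * (pi / 2) `^ (- p).
have integrand_ge s : s1 <= s <= s2 -> c <= sin_pow_osc n s.
  move=> /andP[s1s ss2]; apply: ler_pM; rewrite ?powR_ge0 //; last first.
    by rewrite /powR gt_eqF ?ler_expR; [rewrite !mulNr lerN2 ler_pM2l|lra].
  have e1 : pi / 2 - h <= expR s by rewrite -[leLHS]lnK ?posrE ?ler_expR //; lra.
  have e2 : expR s <= pi / 2 by rewrite -[leRHS]lnK ?posrE ?ler_expR //; lra.
  have y2 : (pi / 2 - expR s) ^+ 2 <= h ^+ 2 by apply: lerXn2r; rewrite ?nnegrE; lra.
  apply: sin_pow_ge_half; first by rewrite -[leRHS]nh2 ler_wpM2l.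
  by apply: le_trans y2 _; nra.
apply: (@le_trans _ _ (\int[mu]_(s in `[s1, s2]) (sin_pow_osc n s)%:E)%E); last first.
  apply: ge0_subset_integral => //; first exact: measurable_sin_pow_osc.
  by move=> s _; rewrite lee_fin sin_pow_osc_ge0.
apply: (@le_trans _ _ (\int[mu]_(s in `[s1, s2]) (cst c%:E) s)%E); last first.
  apply: ge0_le_integral => //.
    by move=> s _; rewrite lee_fin mulr_ge0 ?powR_ge0.
  exact: measurable_sin_pow_osc.
rewrite integral_cst //= lebesgue_measure_itv /= lte_fin s12 -EFinB -EFinM lee_fin.
apply: le_trans (ler_wpM2l _ (ln_subr_ge h0 _)); [|by rewrite mulr_ge0 ?powR_ge0|lra].
have -> : (2 / pi) `^ (p + 1) = (pi / 2) `^ (- p) / (pi / 2) :> R.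
  have -> : 2 / pi = (pi / 2) `^ (-1) :> R by rewrite powR_inv1 ?invf_div //; lra.
  rewrite -powRrM (_ : -1 * (p + 1) = - p - 1); last by ring.
  by rewrite powRB ?powRr1 //; [lra|apply/implyP => _; rewrite gt_eqF //; lra].
by rewrite le_eqVlt; apply/orP; left; apply/eqP; rewrite /c /h /sn; ring.
Qed.

Lemma signed_mean_powR_sin l : (q < l)%N ->
  2^-1 * (2 / pi) `^ (p + 1) / Num.sqrt l.*2%:R <=
  `|signed_mean (-1) 1 l.*2 (fun z => `|z| `^ p) 0| * K.
Proof.
move=> ql; have K0 : 0 <= K.
  rewrite -lee_fin -integral_osc1; apply: integral_ge0 => s _.
  by rewrite lee_fin osc_ge0.
have sin_powE s : sin_pow_osc l.*2 s =
    (-1) ^+ (q.+1 + l) * signed_mean (-1) 1 l.*2 (osc^~ s) 0.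
  rewrite (@eq_signed_mean _ _ _ _ _ (fun z => expR (- p * s) * cos_rem q (z * expR s))).
    rewrite signed_meanZ signed_mean_cos_rem // [RHS]mulrCA [_ ^+ _ * (_ * _)]mulrA.
    by rewrite -expr2 sqrr_sign mul1r mulrC.
  by move=> z; rewrite /osc mulrC.
have [int_mean meanE] := integral_signed_mean_osc l.*2 0.
have int_sin : mu.-integrable setT (fun s => (sin_pow_osc l.*2 s)%:E).
  under eq_fun do rewrite sin_powE EFinM.
  exact: (integrableZl measurableT _ int_mean).
have l2 : (1 < l.*2)%N by case: (l) ql.
have := integral_sin_pow_osc_ge l2; rewrite odd_double => /(_ isT).
rewrite -[X in (_ <= X)%E](@fineK _ _) ?integrable_fin_num //.
rewrite lee_fin => /le_trans; apply; rewrite -[leLHS]/(\int[mu]_s (sin_pow_osc l.*2 s)).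
under eq_Rintegral do rewrite sin_powE.
rewrite RintegralZl // meanE; apply: le_trans (ler_norm _) _.
by rewrite !normrM normrX normrN normr1 expr1n mul1r (ger0_norm K0).
Qed.

Lemma osc_mass_le (t : R) : 0 < t -> t ^+ 2 = q.*2.+1%:R * q.*2.+2%:R ->
  K <= 4 / ((q.*2)`!%:R * t `^ a * (a * (2 - a))).
Proof.
move=> t0 t2; have fact_gt0 : 0 < (q.*2)`!%:R :> R by rewrite ltr0n fact_gt0.
have ta0 : 0 < t `^ a by exact: powR_gt0.
rewrite -lee_fin -integral_osc1; apply: le_trans (integral_osc_le t0) _; rewrite lee_fin.
have -> : t `^ (2 - a) = t ^+ 2 / t `^ a.
  rewrite powRB; last by apply/implyP => _; rewrite gt_eqF.
  by rewrite powR_mulrn // ltW.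
rewrite powRN t2 doubleS !factS !natrM.
rewrite [leLHS](_ : _ = (4 - a) / ((q.*2)`!%:R * t `^ a * (a * (2 - a)))); last first.
  have : q.*2.+1%:R != 0 :> R by rewrite pnatr_eq0.
  have : q.*2.+2%:R != 0 :> R by rewrite pnatr_eq0.
  move: (q.*2.+1%:R : R) (q.*2.+2%:R : R) (t `^ a) ((q.*2)`!%:R : R) ta0 fact_gt0.
  move: a a_gt0 a_lt2 => b b0 b2 u v w f w0 f0 v0 u0; field.
  by rewrite (gt_eqF f0) (gt_eqF b0) (gt_eqF b2) (gt_eqF w0) u0 v0.
rewrite ler_pM2r ?invr_gt0 ?mulr_gt0 //.
by have := a_gt0; lra.
Qed.

Lemma signed_mean_powR_large l (t : R) : (q < l)%N -> 0 < t ->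
  t ^+ 2 = q.*2.+1%:R * q.*2.+2%:R ->
  (q.*2)`!%:R * t `^ a * (a * (2 - a)) / 8 * (2 / pi) `^ (p + 1) / Num.sqrt l.*2%:R
  <= `|signed_mean (-1) 1 l.*2 (fun z => `|z| `^ p) 0|.
Proof.
move=> ql t0 t2.
have := le_trans (signed_mean_powR_sin ql) (ler_wpM2l (normr_ge0 _) (osc_mass_le t0 t2)).
set D := `| _ |; set c := (2 / pi) `^ _; set r := Num.sqrt _.
set B := (q.*2)`!%:R * _ * _; have B0 : 0 < B by rewrite !mulr_gt0 // powR_gt0.
rewrite -ler_pdivrMr ?divr_gt0 // => /(le_trans _); apply.
have -> : (8 : R)^-1 = 2^-1 * 4^-1 by field.
by rewrite le_eqVlt; apply/orP; left; apply/eqP; rewrite invf_div; ring.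
Qed.

End PowerAsCosineIntegral.

Section NumericBounds.
Variable R : realType.
Implicit Types (a b c p u x : R) (n k q : nat).

Lemma ler_powX n c u : 0 <= c -> c <= u -> c ^+ n <= u ^+ n.
Proof. by move=> c0 cu; apply: lerXn2r => //; rewrite nnegrE; lra. Qed.

Lemma sqr_powR_half a b : 0 <= a -> (a ^+ 2) `^ (b / 2) = a `^ b.
Proof. by move=> a0; rewrite -powR_mulrn // -powRrM; congr (_ `^ _); field. Qed.

Lemma powR_half_add1 a b : 0 < a -> a `^ ((b + 1) / 2) = a `^ 2^-1 * a `^ (b / 2).
Proof.
move=> a0; rewrite -powRD; first by congr (_ `^ _); field.
by apply/implyP => _; rewrite gt_eqF.
Qed.

Lemma pi_ge3 : 3 <= pi :> R.
Proof.
rewrite leNgt; apply/negP => pi_lt3; have pi2 := pi_ge2 R.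
pose x : R := pi / 2.
have : 0 <= x ^+ 6 / 720 - (x ^+ 4 / 24 - (x ^+ 2 / 2 - (1 - cos x))) := cos_rem_ge0 3 x.
rewrite /x cos_pihalf -/x => taylor.
have y1 : 0 <= x ^+ 2 by exact: sqr_ge0.
have y2 : x ^+ 2 <= 9 / 4 by rewrite /x; nra.
have : 1 - x ^+ 2 / 2 + (x ^+ 2) ^+ 2 / 24 - (x ^+ 2) ^+ 3 / 720 <= 0.
  by rewrite -!exprM; lra.
move: (x ^+ 2) y1 y2 => y y1 y2.
have : y ^+ 3 <= 9 / 4 * y ^+ 2 by rewrite exprS; apply: ler_wpM2r => //; exact: sqr_ge0.
by nra.
Qed.

Lemma pi_le : pi <= 16 / 5 :> R.
Proof.
rewrite leNgt; apply/negP => pi_gt.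
have : 0 <= (8 / 5 : R) ^+ 4 / 24 - ((8 / 5) ^+ 2 / 2 - (1 - cos (8 / 5))) := cos_rem_ge0 2 _.
have : 0 <= cos (8 / 5 : R) by apply: cos_ge0_pihalf; lra.
by lra.
Qed.

Lemma expR1_ge : 263 / 100 <= expR 1 :> R.
Proof.
have -> : expR 1 = ((((expR (16%:R^-1)) ^+ 2) ^+ 2) ^+ 2) ^+ 2 :> R.
  by rewrite -!exprM -expRM_natl; congr expR; field.
have sqr_ge u c d : 0 <= c -> c <= u -> d <= c * c -> d <= u ^+ 2 by move=> *; nra.
have root_ge : 17 / 16 <= expR (16%:R^-1 : R) by have := expR_ge1Dx (16%:R^-1 : R); lra.
apply: (sqr_ge _ (1623 / 1000)); [lra| |lra].
apply: (sqr_ge _ (1274 / 1000)); [lra| |lra].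
apply: (sqr_ge _ (11289 / 10000)); [lra| |lra].
by apply: (sqr_ge _ (17 / 16)); lra.
Qed.

Lemma expR1_le3 : expR 1 <= 3 :> R.
Proof.
have root_ge : 5 / 6 <= expR (- 6%:R^-1 : R) by have := expR_ge1Dx (- 6%:R^-1 : R); lra.
have := ler_powX 6 (ltac:(lra) : (0 : R) <= 5 / 6) root_ge.
rewrite -expRM_natl (_ : 6%:R * - 6%:R^-1 = -1); last by field.
rewrite expRN => inv_ge; rewrite -[leLHS]invrK -[leRHS]invrK lef_pV2 ?posrE ?invr_gt0 ?expR_gt0 //.
by lra.
Qed.

Lemma fact_ge n : ((n%:R + 2) / 5) ^+ n <= n`!%:R :> R.
Proof.
elim: n => [|n IH]; first by rewrite expr0.
case: n IH => [|[|n]] IH; try by rewrite /factorial /= ?expr1 ?expr2; lra.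
set m := n.+2 in IH *; have m2 : 2 <= m%:R :> R by rewrite ler_nat.
rewrite factS natrM exprS -natr1.
have -> : ((m%:R + 1 + 2) / 5) ^+ m = ((m%:R + 2) / 5) ^+ m * (1 + (m%:R + 2)^-1) ^+ m :> R.
  by rewrite -exprMn; congr (_ ^+ _); field; lra.
have step_le3 : (1 + (m%:R + 2)^-1) ^+ m <= 3 :> R.
  apply: le_trans expR1_le3.
  have -> : 1 = m%:R * m%:R^-1 :> R by rewrite divff; lra.
  rewrite expRM_natl divff; last by lra.
  apply: ler_powX; first by rewrite addr_ge0 // invr_ge0; lra.
  by apply: le_trans (expR_ge1Dx _) _; rewrite ler_expR lef_pV2 ?posrE; lra.
have base_ge0 : 0 <= ((m%:R + 2) / 5) ^+ m :> R by rewrite exprn_ge0 // divr_ge0; lra.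
apply: (@le_trans _ _ ((m%:R + 1 + 2) / 5 * (m`!%:R * 3))); last by nra.
apply: ler_wpM2l; first by lra.
by apply: ler_pM => //; rewrite exprn_ge0 // addr_ge0 // invr_ge0; lra.
Qed.

Lemma normr_sin_addn a q : `|sin (pi * (q.*2%:R + a) / 2)| = `|sin (pi * a / 2)|.
Proof.
have -> : pi * (q.*2%:R + a) / 2 = pi * a / 2 + pi *+ q :> R.
  by rewrite -muln2 natrM -mulr_natr; field.
by rewrite (alternatingn (@sinDpi R)) normrM normrX normrN1 expr1n mul1r.
Qed.

Lemma sin_le x : 0 <= x -> sin x <= x.
Proof.
move=> x0; have := @ge0_derive_le R (@sin_rem R 0) (@cos_rem R 0) x x0 (is_derive_sin_rem 0).
by rewrite sin_rem_at0 /= => /(_ (fun t _ => cos_rem_ge0 0 t)); lra.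
Qed.

Lemma normr_sin_le a q : 0 < a -> a < 2 ->
  `|sin (pi * (q.*2%:R + a) / 2)| <= pi / 2 * (a * (2 - a)).
Proof.
move=> a0 a2; have pi3 := pi_ge3; rewrite normr_sin_addn.
have b0 : 0 <= pi * a / 2 by rewrite divr_ge0 // mulr_ge0 //; lra.
have b1 : pi * a / 2 <= pi by nra.
rewrite ger0_norm; last by apply: sin_ge0_pi; apply/andP.
have [a1|a1] := lerP a 1; first by apply: le_trans (sin_le b0) _; nra.
have -> : sin (pi * a / 2) = sin (pi - pi * a / 2).
  by rewrite sinB sinpi cospi mul0r mulN1r sub0r opprK.
by apply: le_trans (sin_le _) _; nra.
Qed.

Lemma fact_powR_ge p q (t : R) : 1 <= p -> q.*2%:R < p -> p < q.+1.*2%:R ->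
  0 < t -> t ^+ 2 = q.*2.+1%:R * q.*2.+2%:R ->
  (p / 5) `^ p * (7 / 2) `^ (p - q.*2%:R) <= (q.*2)`!%:R * t `^ (p - q.*2%:R).
Proof.
move=> p1 qp pq t0 t2; set a := p - q.*2%:R; have a0 : 0 < a by rewrite /a; lra.
move: pq; rewrite doubleS -addn2 natrD => pq.
have t_ge : 7 / 10 * p <= t.
  rewrite -(ler_pXn2r (_ : 0 < 2)%N) ?nnegrE; [|by []|lra|exact: ltW].
  have -> : t ^+ 2 = (q.*2%:R + 1) * (q.*2%:R + 2) by rewrite t2 natr1 -natrD addn2.
  rewrite exprMn; have : 0 <= q.*2%:R :> R by [].
  by move: (q.*2%:R) qp pq => z *; nra.
have -> : (p / 5) `^ p = (p / 5) ^+ q.*2 * (p / 5) `^ a.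
  rewrite -powR_mulrn; last by lra.
  rewrite -powRD; first by congr (_ `^ _); rewrite /a; ring.
  by apply/implyP => _; rewrite gt_eqF //; lra.
rewrite -mulrA -powRM; [|lra|lra].
apply: ler_pM; rewrite ?powR_ge0 // ?exprn_ge0 //; first by lra.
  by apply: le_trans (fact_ge _); apply: ler_powX; lra.
by apply: ge0_ler_powR; rewrite ?nnegrE; lra.
Qed.

Definition gap_power p k : R :=
  ((2 * p) / ((expR 1) ^+ 2 * pi ^+ 2 * k%:R)) `^ ((p + 1) / 2).

Lemma gap_power_ge0 p k : 0 <= gap_power p k.
Proof. exact: powR_ge0. Qed.

Lemma gap_power_gt0 p k : 0 < p -> (0 < k)%N -> 0 < gap_power p k.
Proof.
move=> p0 k0; apply: powR_gt0.
by rewrite divr_gt0 ?mulr_gt0 ?exprn_gt0 ?expR_gt0 ?pi_gt0 ?ltr0n.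
Qed.

Lemma gap_power_le_expR p k : 1 <= p -> p < k%:R -> gap_power p k <= expR (- (3 / 2 * p)).
Proof.
move=> p1 pk; have pi3 := pi_ge3; have e3 := expR1_le3; set E := expR 1 in e3.
have E0 : 0 < E by exact: expR_gt0.
apply: (@le_trans _ _ (expR (- 3) `^ ((p + 1) / 2))); last by rewrite -expRM ler_expR; lra.
apply: ge0_ler_powR; rewrite ?nnegrE ?expR_ge0 //; first by lra.
  by rewrite divr_ge0 ?mulr_ge0 ?sqr_ge0 ?expR_ge0 //; lra.
rewrite expRN -/E; have -> : expR 3 = E ^+ 3 :> R by rewrite -expRM_natl mulr1.
have pi9 : 9 <= pi ^+ 2 :> R by rewrite expr2; nra.
rewrite ler_pdivrMr; last by rewrite !mulr_gt0 ?exprn_gt0 ?pi_gt0 //; lra.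
rewrite [leRHS]mulrC ler_pdivlMr ?exprn_gt0 //.
rewrite [leLHS](_ : _ = E ^+ 2 * (2 * p * E)); last by ring.
rewrite -[leRHS]mulrA; apply: ler_wpM2l; first exact: sqr_ge0.
have : 9 * k%:R <= pi ^+ 2 * k%:R :> R by apply: ler_wpM2r => //; lra.
by nra.
Qed.

Lemma ratio_powR_le p n k : 1 <= p -> p < k%:R -> (2 < k)%N -> (n <= k.+1)%N ->
  (n%:R / k%:R) `^ ((p + 1) / 2) <= 21 / 10.
Proof.
move=> p1 pk k3 nk; have k3' : 3 <= k%:R :> R by rewrite ler_nat.
have e3 := expR1_le3.
apply: (@le_trans _ _ (expR (k%:R^-1) `^ ((p + 1) / 2))).
  apply: ge0_ler_powR; rewrite ?nnegrE ?expR_ge0 //; first by lra.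
  apply: le_trans (expR_ge1Dx _); rewrite ler_pdivrMr; last by lra.
  rewrite mulrDl mul1r mulVf; last by lra.
  by rewrite natr1 ler_nat.
rewrite -expRM; apply: (@le_trans _ _ (expR (2 / 3))).
  by rewrite ler_expR mulrC ler_pdivrMr; lra.
rewrite -(ler_pXn2r (_ : 0 < 3)%N) ?nnegrE ?expR_ge0 //.
have -> : expR (2 / 3) ^+ 3 = expR 1 ^+ 2 :> R.
  by rewrite -!expRM_natl; congr expR; field.
apply: (@le_trans _ _ (3 ^+ 2)); last by lra.
by apply: ler_powX => //; exact: ltW.
Qed.

Lemma gap_power_moment p n k : 0 < p -> (0 < n)%N -> (0 < k)%N ->
  let w := p / (2 * expR 1 ^+ 2) in
  gap_power p k * (p * n%:R / expR 1) `^ (p / 2) * (pi / 2) `^ (p + 1) * Num.sqrt n%:R =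
  (n%:R / k%:R) `^ ((p + 1) / 2) * w `^ 2^-1 * (w * (p / expR 1)) `^ (p / 2).
Proof.
move=> p0 n0 k0 w; set E := expR 1; have E0 : 0 < E by exact: expR_gt0.
have n0' : 0 < n%:R :> R by rewrite ltr0n.
have k0' : 0 < k%:R :> R by rewrite ltr0n.
have pi0 := pi_gt0 R; have w0 : 0 < w by rewrite divr_gt0 ?mulr_gt0 ?exprn_gt0.
rewrite -(@sqr_powR_half (pi / 2)) ?divr_ge0 ?ltW // -powR12_sqrt ?ler0n //.
have -> : (p * n%:R / E) `^ (p / 2) = (p / E) `^ (p / 2) * n%:R `^ (p / 2).
  by rewrite -powRM ?divr_ge0 ?ltW //; congr (_ `^ _); rewrite mulrAC.
have den_gt0 : 0 < E ^+ 2 * pi ^+ 2 * k%:R by rewrite !mulr_gt0 ?exprn_gt0.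
have -> : (w * (p / E)) `^ (p / 2) = w `^ (p / 2) * (p / E) `^ (p / 2).
  by rewrite powRM ?divr_ge0 ?ltW.
have wE : (n%:R / k%:R) `^ ((p + 1) / 2) * (w `^ 2^-1 * w `^ (p / 2)) =
    gap_power p k * ((pi / 2) ^+ 2) `^ ((p + 1) / 2) * (n%:R `^ 2^-1 * n%:R `^ (p / 2)).
  rewrite -!powR_half_add1 // /gap_power -/E.
  rewrite -!powRM ?sqr_ge0 ?mulr_ge0 ?invr_ge0 ?(ltW den_gt0) ?ltW //; congr (_ `^ _).
  rewrite /w -/E; move: (pi : R) pi0 => c c0.
  by field; rewrite !gt_eqF.
transitivity ((n%:R / k%:R) `^ ((p + 1) / 2) * (w `^ 2^-1 * w `^ (p / 2)) * (p / E) `^ (p / 2)).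
  by rewrite wE; ring.
by ring.
Qed.

Lemma gap_power_moment_le p n k : 1 <= p -> p < k%:R -> (2 < k)%N -> (n <= k.+1)%N ->
  (0 < n)%N ->
  gap_power p k * (p * n%:R / expR 1) `^ (p / 2) * (pi / 2) `^ (p + 1) * Num.sqrt n%:R
  <= 21 / 10 * (p / (2 * expR 1 ^+ 2)) `^ 2^-1 * (p / 6) `^ p.
Proof.
move=> p1 pk k3 nk n0; rewrite gap_power_moment //; [|lra|exact: ltn_trans k3].
have e_ge := expR1_ge; set E := expR 1 in e_ge *; have E0 : 0 < E by lra.
set w := p / (2 * E ^+ 2).
have w0 : 0 <= w by rewrite divr_ge0 ?mulr_ge0 ?sqr_ge0 //; lra.
apply: ler_pM; rewrite ?mulr_ge0 ?powR_ge0 //.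
  by apply: ler_wpM2r (ratio_powR_le p1 pk k3 nk); exact: powR_ge0.
rewrite -(@sqr_powR_half (p / 6)); last by lra.
have wp : 0 <= w * (p / E) by rewrite mulr_ge0 // divr_ge0; lra.
apply: ge0_ler_powR; rewrite ?nnegrE ?sqr_ge0 //; first by lra.
have -> : w * (p / E) = p ^+ 2 / (2 * E ^+ 3) by rewrite /w; field; rewrite gt_eqF.
rewrite exprMn; apply: ler_wpM2l; first exact: sqr_ge0.
have -> : (6^-1 : R) ^+ 2 = 36^-1 by field.
rewrite lef_pV2 ?posrE ?mulr_gt0 ?exprn_gt0 //.
by have := ler_powX 3 (ltac:(lra) : (0 : R) <= 263 / 100) e_ge; lra.
Qed.

Lemma powR_half_le p c : 1 <= p -> 0 < c -> c ^+ 2 <= 12 * p ^+ 3 ->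
  (p / (2 * expR 1 ^+ 2)) `^ 2^-1 <= p ^+ 2 / c.
Proof.
move=> p1 c0 c2; have e_ge := expR1_ge.
have den : 12 <= 2 * expR 1 ^+ 2 :> R by nra.
have pc : 0 <= p ^+ 2 / c by rewrite divr_ge0 ?sqr_ge0 // ltW.
rewrite -[leRHS]powRr1 // -(sqr_powR_half 1 pc) mul1r.
apply: ge0_ler_powR; rewrite ?nnegrE ?sqr_ge0 //; first by rewrite divr_ge0; lra.
apply: (@le_trans _ _ (p / 12)); first by rewrite ler_wpM2l ?lef_pV2 ?posrE; lra.
rewrite exprMn exprVn ler_pdivlMr ?exprn_gt0 // mulrAC ler_pdivrMr //.
have -> : (p ^+ 2) ^+ 2 * 12 = p * (12 * p ^+ 3) by ring.
by rewrite ler_pM2l; lra.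
Qed.

Lemma growth_factor_ge p q : 1 <= p -> q.*2%:R < p ->
  4 * (16 / 5) * (21 / 20) * (p / (2 * expR 1 ^+ 2)) `^ 2^-1
  <= p ^+ 2 * ((6 / 5) `^ p * (7 / 2) `^ (p - q.*2%:R)).
Proof.
move=> p1 qp.
have reduce c d : 0 < c -> c ^+ 2 <= 12 * p ^+ 3 ->
    4 * (16 / 5) * (21 / 20) / c <= d ->
    4 * (16 / 5) * (21 / 20) * (p / (2 * expR 1 ^+ 2)) `^ 2^-1 <= p ^+ 2 * d.
  move=> c0 c2 cd; have := powR_half_le p1 c0 c2.
  move=> /(ler_wpM2l (ltac:(lra) : 0 <= 4 * (16 / 5) * (21 / 20) :> R)) /le_trans; apply.
  rewrite [leLHS](_ : _ = p ^+ 2 * (4 * (16 / 5) * (21 / 20) / c)); last by ring.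
  by apply: ler_wpM2l cd; exact: sqr_ge0.
have le_base b x y : 1 <= b -> x <= y -> b `^ x <= b `^ y :> R.
  by move=> b1 xy; exact: ler_powR.
case: q qp => [_|q qp].
  rewrite subr0; have p3 : 1 <= p ^+ 3 by exact: exprn_ege1.
  apply: (reduce (346 / 100)); [lra|lra|].
  have := le_base (6 / 5) 1 p ltac:(lra) p1; rewrite powRr1; last by lra.
  have := le_base (7 / 2) 1 p ltac:(lra) p1; rewrite powRr1; last by lra.
  by move=> ? ?; apply: (@le_trans _ _ (6 / 5 * (7 / 2))); [lra|apply: ler_pM; lra].
have p2 : 2 <= p.
  have : 2 <= q.+1.*2%:R :> R by rewrite (ler_nat R 2).
  by lra.
have p3 : 2 ^+ 3 <= p ^+ 3 by apply: ler_powX; lra.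
apply: (reduce (979 / 100)); [lra|lra|].
have := le_base (6 / 5) 2 p ltac:(lra) p2; rewrite (powR_mulrn 2); last by lra.
have := le_base (7 / 2) 0 (p - q.+1.*2%:R) ltac:(lra) ltac:(lra); rewrite powRr0.
by move=> ? ?; apply: (@le_trans _ _ ((6 / 5) ^+ 2 * 1)); [lra|apply: ler_pM; lra].
Qed.

Lemma growth_numeric p (f : R) q : 1 <= p -> q.*2%:R < p ->
  (p / 5) `^ p * (7 / 2) `^ (p - q.*2%:R) <= f ->
  4 * pi * (21 / 20) * (p / (2 * expR 1 ^+ 2)) `^ 2^-1 * (p / 6) `^ p <= p ^+ 2 * f.
Proof.
move=> p1 qp f_ge; have pi16 := pi_le.
apply: le_trans (ler_wpM2l (sqr_ge0 _) f_ge).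
have -> : (p / 5) `^ p = (p / 6) `^ p * (6 / 5) `^ p.
  by rewrite -powRM; [congr (_ `^ _); field|lra|lra].
rewrite [leRHS](_ : _ =
  (p ^+ 2 * ((6 / 5) `^ p * (7 / 2) `^ (p - q.*2%:R))) * (p / 6) `^ p); last by ring.
apply: ler_wpM2r; first exact: powR_ge0.
apply: le_trans (growth_factor_ge p1 qp).
by apply: ler_wpM2r; [exact: powR_ge0|lra].
Qed.

End NumericBounds.

Section GadgetGap.
Variable R : realType.
Implicit Types (p : R) (j k l q n : nat).

Definition not_even (p : R) : Prop := forall z : int, p <> 2 * z%:~R.

Definition gadget_gap p k : R := `|sin (pi * p / 2)| * gap_power p k / (4 * p ^+ 2).

Lemma even_floor p : 0 <= p -> not_even p ->
  exists q : nat, q.*2%:R < p /\ p < q.+1.*2%:R.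
Proof.
move=> p0 p_not_even; have /andP[q_le q_gt] := truncn_itv (divr_ge0 p0 (ler0n R 2)).
exists (Num.trunc (p / 2)); rewrite -!muln2 !natrM; split; last by lra.
rewrite lt_neqAle; apply/andP; split; last by lra.
apply/eqP => pE; apply: (p_not_even (Num.trunc (p / 2))%:Z).
exact: etrans (esym pE) (mulrC _ _).
Qed.

Lemma normr_sin_gt0 p : 0 <= p -> not_even p -> 0 < `|sin (pi * p / 2)|.
Proof.
move=> p0 p_not_even; have [q [q_lt lt_q]] := even_floor p0 p_not_even; have pi3 := pi_ge3 R.
rewrite -(subrKC q.*2%:R p) normr_sin_addn normr_gt0 gt_eqF // sin_gt0_pi //.
by move: lt_q; rewrite doubleS -addn2 natrD => lt_q; apply/andP; split; nra.
Qed.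

Lemma gadget_gap_gt0 p k : 1 <= p -> not_even p -> p < k%:R -> 0 < gadget_gap p k.
Proof.
move=> p1 p_not_even pk; have k0 : (0 < k)%N by rewrite -(ltr_nat R); lra.
rewrite divr_gt0 ?mulr_gt0 ?normr_sin_gt0 ?gap_power_gt0 ?exprn_gt0 //; lra.
Qed.

Lemma gadget_gap_le p k : 1 <= p -> p < k%:R ->
  gadget_gap p k <= expR (- (3 / 2 * p)) / (p + 1).
Proof.
move=> p1 pk; have sin1 : `|sin (pi * p / 2)| <= 1 by rewrite ler_norml sin_geN1 sin_le1.
apply: ler_pM; rewrite ?mulr_ge0 ?gap_power_ge0 ?invr_ge0 ?mulr_ge0 ?(le_trans ler01 p1) //.
  rewrite -[leRHS]mul1r; apply: ler_pM; rewrite ?gap_power_ge0 //.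
  exact: gap_power_le_expR.
by rewrite lef_pV2 ?posrE ?mulr_gt0 ?exprn_gt0; nra.
Qed.

Lemma gadget_gap_le1 p k : 1 <= p -> p < k%:R -> gadget_gap p k <= 1.
Proof.
move=> p1 pk; apply: le_trans (gadget_gap_le p1 pk) _.
rewrite ler_pdivrMr; last by lra.
by apply: (@le_trans _ _ 1); [rewrite expR_le1; lra|lra].
Qed.

Definition has_gap (g : R -> R) (rho : R) j : Prop := exists h t : R,
  0 < signed_mean 1 h j g t /\ rho * signed_mean 1 h j g t <= `|signed_mean (-1) h j g t|.

Definition abs_powR p (z : R) : R := `|z| `^ p.

Lemma small_order_gap p k j : 1 <= p -> p < k%:R -> j%:R <= p ->
  has_gap (abs_powR p) (gadget_gap p k) j.
Proof.
move=> p1 pk jp; have [mean0 ratio] := small_order_ratio p1 jp.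
exists (p + 1)^-1, 1; split => //; apply: le_trans (ler_norm _); apply: le_trans ratio.
by apply: ler_wpM2r (gadget_gap_le p1 pk); exact: ltW.
Qed.

Lemma gap_power_moment_growth p q n k (f : R) :
  1 <= p -> p < k%:R -> (2 < k)%N -> (0 < n <= k.+1)%N -> q.*2%:R < p ->
  (p / 5) `^ p * (7 / 2) `^ (p - q.*2%:R) <= f ->
  2 * pi * (gap_power p k * (p * n%:R / expR 1) `^ (p / 2) * (pi / 2) `^ (p + 1)
    * Num.sqrt n%:R) <= p ^+ 2 * f.
Proof.
move=> p1 pk k3 /andP[n0 nk] qp f_ge; apply: le_trans (growth_numeric p1 qp f_ge).
have pi0 : 0 <= pi :> R by exact: pi_ge0.
apply: (le_trans (ler_wpM2l _ (gap_power_moment_le p1 pk k3 nk n0))); first by rewrite mulr_ge0.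
by rewrite le_eqVlt; apply/orP; left; apply/eqP; field.
Qed.

Lemma large_order_even_gap p k l : 1 <= p -> not_even p -> p < k%:R -> (2 < k)%N ->
  p < l.*2%:R -> (l.*2 <= k.+1)%N ->
  gadget_gap p k * signed_mean 1 1 l.*2 (abs_powR p) 0
  <= `|signed_mean (-1) 1 l.*2 (abs_powR p) 0|.
Proof.
move=> p1 p_not_even pk k3 pl lk; have [q [qp pq]] := even_floor (le_trans ler01 p1) p_not_even.
have ql : (q < l)%N by rewrite -ltn_double -(ltr_nat R); lra.
have l0 : (0 < l.*2)%N by rewrite double_gt0; exact: leq_ltn_trans ql.
pose t : R := Num.sqrt (q.*2.+1%:R * q.*2.+2%:R).
have t0 : 0 < t by rewrite sqrtr_gt0 mulr_gt0.
have t2 : t ^+ 2 = q.*2.+1%:R * q.*2.+2%:R by rewrite sqr_sqrtr // mulr_ge0.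
apply: le_trans (signed_mean_powR_large qp pq ql t0 t2).
have mean_le := moment_bound p1 l0.
have n_range : (0 < l.*2 <= k.+1)%N by rewrite l0.
have num := gap_power_moment_growth p1 pk k3 n_range qp (fact_powR_ge p1 qp pq t0 t2).
set a := p - q.*2%:R in num *; have a0 : 0 < a by rewrite /a; lra.
have a2 : a < 2 by rewrite /a; move: pq; rewrite doubleS -addn2 natrD; lra.
have sin_le : `|sin (pi * p / 2)| <= pi / 2 * (a * (2 - a)).
  by rewrite -(subrKC q.*2%:R p); exact: normr_sin_le.
have pi0 := pi_gt0 R.
have -> : (2 / pi) `^ (p + 1) = ((pi / 2) `^ (p + 1))^-1 :> R.
  have -> : 2 / pi = (pi / 2) `^ (-1) :> R by rewrite powR_inv1 ?invf_div ?divr_ge0 ?ltW.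
  by rewrite -powRrM mulN1r powRN.
rewrite /gadget_gap; set X := gap_power p k in num *; set f := _ * t `^ a in num *.
set Y := (p * _ / _) `^ (p / 2) in num mean_le; set Z := (pi / 2) `^ (p + 1) in num *.
set r := Num.sqrt _ in num *.
have X0 : 0 <= X by exact: gap_power_ge0.
have Z0 : 0 < Z by apply: powR_gt0; rewrite divr_gt0.
have r0 : 0 < r by rewrite sqrtr_gt0 ltr0n.
apply: (@le_trans _ _ (pi / 2 * (a * (2 - a)) * X / (4 * p ^+ 2) * (2 * Y))).
  apply: ler_pM => //; first by rewrite !mulr_ge0 // invr_ge0 mulr_ge0 // sqr_ge0.
    by apply: signed_mean_ge0 => z; exact: powR_ge0.
  apply: ler_wpM2r; first by rewrite invr_ge0 mulr_ge0 // sqr_ge0.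
  exact: ler_wpM2r.
rewrite ler_pdivlMr // ler_pdivlMr //.
rewrite [leLHS](_ : _ =
  (a * (2 - a)) / 8 * ((2 * pi * (X * Y * Z * r)) / p ^+ 2)); last by field; lra.
rewrite [leRHS](_ : _ = (a * (2 - a)) / 8 * f); last by ring.
apply: ler_wpM2l; first by rewrite divr_ge0 // mulr_ge0; lra.
by rewrite ler_pdivrMr ?exprn_gt0 // 1?mulrC //; lra.
Qed.

Lemma signed_mean_abs_powR_gt0 p j (x : R) : (0 < j)%N ->
  0 < signed_mean 1 1 j (abs_powR p) x.
Proof.
have abs_gt0 z : z != 0 -> 0 < abs_powR p z by move=> z0; apply: powR_gt0; rewrite normr_gt0.
have abs_ge0 z : 0 <= abs_powR p z by exact: powR_ge0.
case: j => // j _; elim: j x => [|j IH] x; last first.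
  by rewrite signed_meanS mul1r divr_gt0 // addr_gt0.
rewrite /= mul1r divr_gt0 //; have [xN1|xN1] := eqVneq (x + 1) 0.
  by rewrite ltr_wpDl // abs_gt0 //; apply/eqP; lra.
by rewrite ltr_wpDr // abs_gt0.
Qed.

(* For odd j, signed means of order j at 1 are signed means of order j + 1 at 0. *)
Lemma abs_powR_gap p k j : 1 <= p -> not_even p -> p < k%:R -> (2 < k)%N -> (j <= k)%N ->
  has_gap (abs_powR p) (gadget_gap p k) j.
Proof.
move=> p1 p_not_even pk k3 jk; have [jp|pj] := lerP j%:R p; first exact: small_order_gap.
have absN z : abs_powR p (- z) = abs_powR p z by rewrite /abs_powR normrN.
have j0 : (0 < j)%N by rewrite -(ltr_nat R); lra.
have [oj|ej] := boolP (odd j); last first.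
  exists 1, 0; split; first exact: signed_mean_abs_powR_gt0.
  have jE : j = (j./2).*2 by rewrite -[LHS]odd_double_half (negbTE ej).
  by rewrite jE; apply: large_order_even_gap; rewrite -?jE // ltnW.
exists 1, 1; split; first exact: signed_mean_abs_powR_gt0.
have jE : j.+1 = (j.+1)./2.*2 by rewrite -[LHS]odd_double_half /= oj.
have := @large_order_even_gap p k (j.+1)./2 p1 p_not_even pk k3; rewrite -jE.
have pj1 : p < j.+1%:R by apply: lt_trans pj _; rewrite ltr_nat.
move=> /(_ pj1 jk); rewrite !signed_meanS !add0r.
rewrite !signed_mean_even ?eqxx ?orbT // expr1n !mul1r.
rewrite -signr_odd oj expr1 mulN1r mulN1r opprK.
have half (y : R) : (y + y) / 2 = y by field.
by rewrite !half.
Qed.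

End GadgetGap.

(** * Clause gadgets *)

(* The g-th affine form of G maps y to \sum_i coef G g i * y i + const G g. *)
Record forms (K : Type) : Type := Forms {
  nforms : nat;
  coef : nat -> nat -> K;
  const : nat -> K
}.

Section GadgetCost.
Variable R : realType.
Implicit Types (p : R) (G : forms R) (y : nat -> R).

Definition gadget_cost p k G y : R :=
  \sum_(g < nforms G) abs_powR p (\sum_(i < k) coef G g i * y i + const G g).

Lemma gadget_cost_ge0 p k G y : 0 <= gadget_cost p k G y.
Proof. by apply: sumr_ge0 => i _; exact: powR_ge0. Qed.

Lemma eq_gadget_cost p k G y y' : (forall i, (i < k)%N -> y i = y' i) ->
  gadget_cost p k G y = gadget_cost p k G y'.
Proof.
move=> yy; apply: eq_bigr => g _; congr (abs_powR _ (_ + _)).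
by apply: eq_bigr => i _; rewrite yy.
Qed.

Definition sign_vector k y : Prop := forall i, (i < k)%N -> y i = 1 \/ y i = -1.

Definition exact_gadget p k (rho : R) G : Prop := forall y, sign_vector k y ->
  gadget_cost p k G y = 1 + rho * [forall i : 'I_k, y i == -1]%:R.

End GadgetCost.

Section SignWords.
Variable R : realType.
Implicit Types (e h x : R) (y : nat -> R) (w : seq R) (j k : nat).

Fixpoint words k : seq (seq R) :=
  if k is k'.+1 then
    [seq 0 :: w | w <- words k'] ++
    ([seq 1 :: w | w <- words k'] ++ [seq -1 :: w | w <- words k'])
  else [:: [::]].

Definition support_size w : nat := count (fun a => a != 0) w.

Definition sign_weight e (a : R) : R := if a == -1 then e else 1.

Definition word_sign e w : R := \prod_(a <- w) sign_weight e a.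

Definition dot k w y : R := \sum_(i < k) nth 0 w i * y i.

Lemma size_words k w : w \in words k -> size w = k.
Proof.
elim: k w => [|k IH] w /=; first by rewrite inE => /eqP ->.
by rewrite !mem_cat => /or3P[] /mapP[w' /IH <- ->].
Qed.

Lemma support_size_words k w : w \in words k -> (support_size w <= k)%N.
Proof. by move=> /size_words <-; exact: count_size. Qed.

Lemma dot_cons k a w y : dot k.+1 (a :: w) y = a * y 0%N + dot k w (fun i => y i.+1).
Proof. by rewrite /dot big_ord_recl. Qed.

Lemma sign_weight0 e : sign_weight e 0 = 1.
Proof. by rewrite /sign_weight ifN //; apply/eqP; lra. Qed.

Lemma sign_weight1 e : sign_weight e 1 = 1.
Proof. by rewrite /sign_weight ifN //; apply/eqP; lra. Qed.

Lemma sign_weightN1 e : sign_weight e (-1) = e.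
Proof. by rewrite /sign_weight eqxx. Qed.

Lemma word_sign1 w : word_sign 1 w = 1.
Proof. by rewrite /word_sign big1 // => a _; rewrite /sign_weight if_same. Qed.

Lemma normr_word_signN1 w : `|word_sign (-1) w| = 1.
Proof.
rewrite /word_sign normr_prod big1 // => a _.
by rewrite /sign_weight; case: ifP; rewrite ?normrN normr1.
Qed.

(* The j-th elementary symmetric polynomial in the weights of y 0, ..., y (k - 1). *)
Fixpoint sign_esym e k j y : R :=
  if k is k'.+1 then
    sign_esym e k' j (fun i => y i.+1) +
    (if j is j'.+1 then sign_weight e (y 0%N) * sign_esym e k' j' (fun i => y i.+1) else 0)
  else (j == 0%N)%:R.

Lemma sign_esym_gt e k j y : (k < j)%N -> sign_esym e k j y = 0.
Proof.
elim: k j y => [|k IH] [|j] y //= kj; rewrite !IH ?mulr0 ?addr0 //.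
exact: ltnW.
Qed.

Lemma sum_sign_esym e c k y :
  \sum_(j < k.+1) c ^+ j * sign_esym e k j y = \prod_(i < k) (1 + c * sign_weight e (y i)).
Proof.
elim: k y => [|k IH] y; first by rewrite big_ord_recl !big_ord0 /= expr0 mulr1 addr0.
rewrite [LHS]big_ord_recl [RHS]big_ord_recl -[\prod_(i < k) _](IH (fun i => y i.+1)).
rewrite mulrDl mul1r /=.
under eq_bigr do rewrite /bump /= mulrDr.
rewrite big_split /= addrA; congr (_ + _).
  rewrite addr0 [RHS]big_ord_recl [X in _ + X = _]big_ord_recr /=.
  by rewrite (sign_esym_gt _ _ (_ : k < 1 + k)%N) ?add1n // mulr0 addr0.
rewrite mulr_sumr; apply: eq_bigr => i _; rewrite add1n add0n exprS.
by ring.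
Qed.

Lemma sum_words e h (g : R -> R) j k y x : e * e = 1 -> sign_vector k y ->
  \sum_(w <- words k | support_size w == j) word_sign e w * g (x + h * dot k w y) =
  sign_esym e k j y * 2 ^+ j * signed_mean e h j g x.
Proof.
move=> ee; elim: k j y x => [|k IH] j y x ysign.
  rewrite /= big_mkcond big_seq1 /word_sign big_nil /support_size /dot big_ord0 mulr0 addr0.
  by rewrite eq_sym; case: j => [|j] /=; rewrite ?mul1r ?mul0r.
have ysign' : sign_vector k (fun i => y i.+1) by move=> i ik; exact: ysign.
have sum_cons (a u : R) j' : ((a != 0%R) + j')%N = j -> a * y 0%N = u ->
    \sum_(w <- words k | support_size (a :: w) == j)
      word_sign e (a :: w) * g (x + h * dot k.+1 (a :: w) y) =
    sign_weight e a * (sign_esym e k j' (fun i => y i.+1) * 2 ^+ j'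
      * signed_mean e h j' g (x + h * u)).
  move=> jE uE; rewrite -IH // mulr_sumr; apply: eq_big => [w|w _].
    by rewrite /support_size /= -jE eqn_add2l.
  by rewrite dot_cons uE /word_sign big_cons mulrA mulrDr addrA.
rewrite /= !big_cat /= !big_map (sum_cons 0 0 j) ?eqxx ?mul0r //.
rewrite sign_weight0 mul1r mulr0 addr0 mulrDl mulrDl; congr (_ + _).
case: j sum_cons => [|j] sum_cons.
  by rewrite !mul0r !big_pred0 ?addr0 // => w; rewrite /support_size /= ?oppr_eq0 oner_neq0.
rewrite (sum_cons 1 (y 0%N) j) ?oner_neq0 ?mul1r // sign_weight1 mul1r.
rewrite (sum_cons (-1) (- y 0%N) j) ?oppr_eq0 ?oner_neq0 ?mulN1r // sign_weightN1.
rewrite mulrN signed_meanS exprS; case: (ysign 0%N isT) => ->.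
  by rewrite !mulr1 sign_weight1; field.
rewrite !mulrN1 opprK sign_weightN1; set l := signed_mean e h j g (x - h).
set r := signed_mean e h j g (x + h); set z := sign_esym _ _ _ _.
have -> : e * z * (2 * 2 ^+ j) * ((r + e * l) / 2) = z * 2 ^+ j * (e * r + (e * e) * l) by field.
by rewrite ee; ring.
Qed.

End SignWords.

Section WordGadget.
Variables (R : realType) (p rho : R) (k : nat) (h t : nat -> R).
Local Notation mean j := (signed_mean 1 (h j) j (abs_powR p) (t j)).
Local Notation diff j := (signed_mean (-1) (h j) j (abs_powR p) (t j)).
Hypotheses (p_neq0 : p != 0) (rho_gt0 : 0 < rho).
Hypothesis gap : forall j, (j <= k)%N -> 0 < mean j /\ rho * mean j <= `|diff j|.

Definition correction j : R := rho * (-1) ^+ j * mean j / diff j.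

Definition word_weight (w : seq R) : R :=
  let j := support_size w in 2 ^- (k + j) * (1 + correction j * word_sign (-1) w) / mean j.

(* The row of w is theta_j <w, y> + tau_j, scaled by the p-th root of its weight. *)
Definition word_gadget : forms R :=
  let word g := nth [::] (words R k) g in
  let scale g := word_weight (word g) `^ p^-1 in
  Forms (size (words R k))
    (fun g i => scale g * h (support_size (word g)) * nth 0 (word g) i)
    (fun g => scale g * t (support_size (word g))).

Lemma mean_gt0 j : (j <= k)%N -> 0 < mean j. Proof. by move=> /gap[]. Qed.

Lemma diff_neq0 j : (j <= k)%N -> diff j != 0.
Proof.
move=> /gap[mean0 ratio]; rewrite -normr_gt0; apply: lt_le_trans ratio.
exact: mulr_gt0.
Qed.

Lemma normr_correction_le1 j : (j <= k)%N -> `|correction j| <= 1.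
Proof.
move=> jk; have [mean0 ratio] := gap jk.
rewrite /correction !normrM normfV normrX normrN normr1 expr1n mulr1.
by rewrite ler_pdivrMr ?normr_gt0 ?diff_neq0 // mul1r (gtr0_norm rho_gt0) (gtr0_norm mean0).
Qed.

Lemma word_weight_ge0 w : w \in words R k -> 0 <= word_weight w.
Proof.
move=> /support_size_words jk; rewrite divr_ge0 ?(ltW (mean_gt0 jk)) //.
rewrite mulr_ge0 ?invr_ge0 ?exprn_ge0 //.
have : `|correction (support_size w) * word_sign (-1) w| <= 1.
  by rewrite normrM normr_word_signN1 mulr1 normr_correction_le1.
by rewrite ler_norml; lra.
Qed.

Lemma word_gadget_cost y : gadget_cost p k word_gadget y =
  \sum_(w <- words R k) word_weight w
    * abs_powR p (t (support_size w) + h (support_size w) * dot k w y).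
Proof.
rewrite /gadget_cost (big_nth [::]) big_mkord; apply: eq_bigr => g _ /=.
set w := nth _ _ _; have w_in : w \in words R k by exact: mem_nth.
set c := word_weight w `^ p^-1.
have -> : \sum_(i < k) c * h (support_size w) * nth 0 w i * y i + c * t (support_size w) =
    c * (t (support_size w) + h (support_size w) * dot k w y).
  rewrite /dot mulrDr addrC; congr (_ + _).
  by rewrite !mulr_sumr; apply: eq_bigr => i _; rewrite !mulrA.
rewrite /abs_powR normrM powRM // ger0_norm ?powR_ge0 //.
by rewrite -powRrM mulVf // powRr1 // word_weight_ge0.
Qed.

Lemma sum_word_weight j y : (j <= k)%N -> sign_vector k y ->
  \sum_(w <- words R k | support_size w == j)
    word_weight w * abs_powR p (t (support_size w) + h (support_size w) * dot k w y) =
  2 ^- k * (1 ^+ j * sign_esym 1 k j y) + 2 ^- k * rho * ((-1) ^+ j * sign_esym (-1) k j y).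
Proof.
move=> jk ysign; pose level e := \sum_(w <- words R k | support_size w == j)
  word_sign e w * abs_powR p (t j + h j * dot k w y).
transitivity (2 ^- (k + j) / mean j * (level 1 + correction j * level (-1))).
  rewrite /level mulr_sumr -big_split /= mulr_sumr; apply: eq_bigr => w /eqP wj.
  by rewrite /word_weight wj word_sign1; ring.
rewrite /level !sum_words ?mulrNN ?mulr1 // expr1n mul1r /correction exprD.
have := diff_neq0 jk; have /gt_eqF := mean_gt0 jk.
move: (mean j) (diff j) => A D /negbT A0 D0.
by field; rewrite A0 D0 /= ?andbT ?expf_neq0.
Qed.

Lemma word_gadget_exact : exact_gadget p k rho word_gadget.
Proof.
move=> y ysign; rewrite word_gadget_cost.
pose F w := word_weight w * abs_powR p (t (support_size w) + h (support_size w) * dot k w y).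
have -> : \sum_(w <- words R k) F w =
    \sum_(j < k.+1) \sum_(w <- words R k | support_size w == j) F w.
  rewrite [RHS](exchange_big_dep xpredT) //= big_seq [RHS]big_seq.
  apply: eq_bigr => w /support_size_words wk.
  by rewrite (big_pred1 (Ordinal (wk : support_size w < k.+1)%N)).
under eq_bigr => j _ do rewrite sum_word_weight ?leq_ord //.
rewrite big_split /= -!mulr_sumr !sum_sign_esym.
have -> : \prod_(i < k) (1 + 1 * sign_weight 1 (y i)) = 2 ^+ k.
  rewrite -[in RHS](card_ord k) -prodr_const; apply: eq_bigr => i _.
  by rewrite /sign_weight if_same mulr1.
have -> : \prod_(i < k) (1 + -1 * sign_weight (-1) (y i)) =
    2 ^+ k * [forall i : 'I_k, y i == -1]%:R.
  case: forallP => [all1|not_all]; rewrite ?mulr1 ?mulr0.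
    rewrite -[in RHS](card_ord k) -prodr_const; apply: eq_bigr => i _.
    by rewrite (eqP (all1 i)) sign_weightN1 mulrNN mulr1.
  have /existsP [i yi] : [exists i : 'I_k, y i != -1].
    by rewrite -negb_forall; apply/negP => /forallP.
  by rewrite (bigD1 i) //= /sign_weight (negbTE yi) mulr1 subrr mul0r.
by rewrite mulVf // mulrA [_ * rho * _]mulrAC mulVf // mul1r.
Qed.

End WordGadget.

Lemma exists_exact_gadget (R : realType) (p rho : R) k : p != 0 -> 0 < rho ->
  (forall j, (j <= k)%N -> has_gap (abs_powR p) rho j) ->
  exists G : forms R, exact_gadget p k rho G.
Proof.
move=> p0 rho0 gap.
have /choice [ht htP] : forall j, exists ht : R * R, (j <= k)%N ->
     0 < signed_mean 1 ht.1 j (abs_powR p) ht.2 /\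
     rho * signed_mean 1 ht.1 j (abs_powR p) ht.2
       <= `|signed_mean (-1) ht.1 j (abs_powR p) ht.2|.
  move=> j; have [/gap [h [t ht]]|_] := leqP j k; first by exists (h, t).
  by exists (0, 0).
exists (word_gadget p rho k (fun j => (ht j).1) (fun j => (ht j).2)).
exact: word_gadget_exact.
Qed.

Section FormsOperations.

Definition map_forms (K K' : Type) (f : K -> K') (G : forms K) : forms K' :=
  Forms (nforms G) (fun g i => f (coef G g i)) (fun g => f (const G g)).

(* The k extra forms alpha * y i make the values |y i| >= 3 expensive. *)
Definition penalise (K : nmodType) k (G : forms K) (alpha : K) : forms K :=
  Forms (nforms G + k)
    (fun g i => if (g < nforms G)%N then coef G g i
                else if (g - nforms G == i)%N then alpha else 0)
    (fun g => if (g < nforms G)%N then const G g else 0).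

Definition isolates_variables (K : nmodType) k (G : forms K) : Prop :=
  exists2 alpha, alpha != 0 & forall i, (i < k)%N -> exists2 g, (g < nforms G)%N
    & forall i', (i' < k)%N -> coef G g i' = if i' == i then alpha else 0.

Lemma map_penalise (K K' : nmodType) (f : {additive K -> K'}) k (G : forms K) alpha :
  map_forms f (penalise k G alpha) = penalise k (map_forms f G) (f alpha).
Proof.
congr Forms; apply/funext => g; last by rewrite /=; case: ifP; rewrite ?raddf0.
by apply/funext => i /=; do 2!case: ifP => // _; rewrite raddf0.
Qed.

Lemma isolates_penalise (K : nmodType) k (G : forms K) alpha : alpha != 0 ->
  isolates_variables k (penalise k G alpha).
Proof.
exists alpha => // i ik; exists (nforms G + i)%N; first by rewrite ltn_add2l.
by move=> i' _ /=; rewrite ltnNge leq_addr /= addKn eq_sym.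
Qed.

End FormsOperations.

Section ClauseGadgets.
Variable R : realType.
Implicit Types (p c alpha rho : R) (k : nat) (G : forms R) (y : nat -> R).

Definition satisfying k y : Prop := sign_vector k y /\ exists2 i, (i < k)%N & y i = 1.

Definition falsifying k y : Prop := forall i, (i < k)%N -> y i = -1.

Definition far_vector k y : Prop :=
  (forall i, (i < k)%N -> 1 <= `|y i|) /\ exists2 i, (i < k)%N & 3 <= `|y i|.

Definition clause_gadget p k G (lo hi lo' hi' : R) : Prop :=
  [/\ forall y, satisfying k y -> lo <= gadget_cost p k G y <= hi,
      forall y, falsifying k y -> lo' <= gadget_cost p k G y <= hi'
    & forall y, far_vector k y -> lo' <= gadget_cost p k G y].

Lemma falsifying_sign_vector k y : falsifying k y -> sign_vector k y.
Proof. by move=> yN i ik; right; exact: yN. Qed.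

Lemma exact_gadget_satisfying p k rho G y : exact_gadget p k rho G -> satisfying k y ->
  gadget_cost p k G y = 1.
Proof.
move=> exactG [ysign [i ik yi]]; rewrite exactG // (_ : [forall i : 'I_k, y i == -1] = false).
  by rewrite mulr0 addr0.
apply/negbTE; rewrite negb_forall; apply/existsP; exists (Ordinal ik).
by rewrite /= yi; apply/eqP; lra.
Qed.

Lemma exact_gadget_falsifying p k rho G y : exact_gadget p k rho G -> falsifying k y ->
  gadget_cost p k G y = 1 + rho.
Proof.
move=> exactG yN; rewrite exactG; last exact: falsifying_sign_vector.
have -> : [forall i : 'I_k, y i == -1] by apply/forallP => i; rewrite yN.
by rewrite mulr1.
Qed.

Lemma gadget_cost_scale p k c G y : 0 <= c ->
  gadget_cost p k (map_forms ( *%R c) G) y = c `^ p * gadget_cost p k G y.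
Proof.
move=> c0; rewrite /gadget_cost mulr_sumr; apply: eq_bigr => g _ /=.
rewrite /abs_powR -powRM // -[in RHS](ger0_norm c0) -normrM mulrDr mulr_sumr.
by under eq_bigr do rewrite -mulrA.
Qed.

Lemma gadget_cost_penalise p k G alpha y :
  gadget_cost p k (penalise k G alpha) y =
  gadget_cost p k G y + \sum_(i < k) abs_powR p (alpha * y i).
Proof.
rewrite /gadget_cost big_split_ord /=; congr (_ + _); apply: eq_bigr => g _.
  by rewrite ltn_ord.
rewrite ltnNge leq_addr /= addKn addr0; congr (abs_powR _ _).
rewrite (bigD1 g) //= eqxx big1 ?addr0 // => i ig.
by rewrite eq_sym (negbTE (_ : val i != g)) ?mul0r.
Qed.

Lemma gadget_cost_penalise_sign p k G alpha y : 0 <= alpha -> sign_vector k y ->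
  gadget_cost p k (penalise k G alpha) y = gadget_cost p k G y + k%:R * alpha `^ p.
Proof.
move=> a0 ysign; rewrite gadget_cost_penalise; congr (_ + _).
rewrite -[k in RHS]card_ord mulr_natl -sumr_const; apply: eq_bigr => i _.
rewrite /abs_powR normrM (ger0_norm a0).
by case: (ysign i (ltn_ord i)) => ->; rewrite ?normrN normr1 mulr1.
Qed.

Lemma gadget_cost_penalise_far p k G alpha y : 0 < alpha -> 0 <= p -> far_vector k y ->
  alpha `^ p * (k%:R + 3 `^ p - 1) <= gadget_cost p k (penalise k G alpha) y.
Proof.
move=> a0 p0 [y1 [i0 i0k y3]]; rewrite gadget_cost_penalise -[leLHS]add0r.
apply: lerD; first exact: gadget_cost_ge0.
have term_ge u v : 0 <= u -> u <= `|v| -> alpha `^ p * u `^ p <= abs_powR p (alpha * v).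
  move=> u0 uv; rewrite /abs_powR normrM (gtr0_norm a0) -powRM ?(ltW a0) //.
  by apply: ge0_ler_powR; rewrite ?nnegrE ?mulr_ge0 ?(ltW a0) // ler_wpM2l // ltW.
rewrite (bigD1 (Ordinal i0k)) //=.
have -> : alpha `^ p * (k%:R + 3 `^ p - 1) =
    alpha `^ p * 3 `^ p + \sum_(i < k | i != Ordinal i0k) alpha `^ p * 1 `^ p.
  rewrite powR1 mulr1 sumr_const cardC1 card_ord -mulr_natr.
  have -> : k%:R = k.-1%:R + 1 :> R by rewrite natr1 prednK // (leq_ltn_trans _ i0k).
  by ring.
apply: lerD; first exact: term_ge.
by apply: ler_sum => i _; apply: term_ge => //; exact: y1.
Qed.

(* Chosen so that one coordinate of absolute value at least 3 costs as much as
   an unsatisfied clause. *)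
Definition penalty p rho : R := ((1 + rho) / (3 `^ p - 1)) `^ p^-1.

Definition sat_cost p rho k : R := 1 + k%:R * penalty p rho `^ p.

Lemma powR3_ge3 p : 1 <= p -> 3 <= 3 `^ p :> R.
Proof. by move=> p1; rewrite -{1}(@powRr1 R 3) // ler_powR // ler1n. Qed.

Lemma penalty_powR p rho : 1 <= p -> 0 < rho -> penalty p rho `^ p = (1 + rho) / (3 `^ p - 1).
Proof.
move=> p1 rho0; have p3 := powR3_ge3 p1.
rewrite /penalty -powRrM mulVf ?gt_eqF ?(lt_le_trans ltr01 p1) // powRr1 //.
by rewrite divr_ge0; lra.
Qed.

Lemma penalty_gt0 p rho : 1 <= p -> 0 < rho -> 0 < penalty p rho.
Proof.
by move=> p1 rho0; have p3 := powR3_ge3 p1; apply: powR_gt0; rewrite divr_gt0; lra.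
Qed.

Lemma sat_cost_ge1 p rho k : 1 <= sat_cost p rho k.
Proof. by rewrite lerDl mulr_ge0 ?powR_ge0. Qed.

Lemma sat_cost_le p rho k : 1 <= p -> 0 < rho <= 1 -> sat_cost p rho k <= 1 + k%:R.
Proof.
move=> p1 /andP[rho0 rho1]; have p3 := powR3_ge3 p1.
by rewrite lerD2l ler_piMr // penalty_powR // ler_pdivrMr; lra.
Qed.

Lemma sat_cost_penalty p rho k : 1 <= p -> 0 < rho ->
  sat_cost p rho k + rho = penalty p rho `^ p * (k%:R + 3 `^ p - 1).
Proof.
move=> p1 rho0; have p3 := powR3_ge3 p1; rewrite /sat_cost penalty_powR //.
by field; lra.
Qed.

Lemma clause_gadget_penalise p k rho G : 1 <= p -> 0 < rho -> exact_gadget p k rho G ->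
  clause_gadget p k (penalise k G (penalty p rho)) (sat_cost p rho k) (sat_cost p rho k)
    (sat_cost p rho k + rho) (sat_cost p rho k + rho).
Proof.
move=> p1 rho0 exactG; have pen0 := penalty_gt0 p1 rho0; split=> y.
- move=> ysat; rewrite gadget_cost_penalise_sign ?(ltW pen0) //; last by case: ysat.
  by rewrite (exact_gadget_satisfying exactG) // lexx.
- move=> yN; have ysign := falsifying_sign_vector yN.
  rewrite gadget_cost_penalise_sign ?(ltW pen0) // (exact_gadget_falsifying exactG) //.
  by rewrite addrAC lexx.
- move=> yfar; rewrite sat_cost_penalty //; apply: gadget_cost_penalise_far => //.
  exact: le_trans p1.
Qed.

End ClauseGadgets.

Section PowerContinuity.
Variable R : realType.
Implicit Types (p a v : R).

Lemma cvg_abs_powR (T : Type) (F : set_system T) (u : T -> R) a p : Filter F -> 1 <= p ->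
  u x @[x --> F] --> a -> abs_powR p (u x) @[x --> F] --> abs_powR p a.
Proof.
move=> FF p1 ua; have p0 : 0 < p by exact: lt_le_trans p1.
have [a0|a0] := eqVneq a 0; last first.
  apply: (@continuous_cvg _ _ _ F FF (fun x => `|u x|) (fun z => z `^ p)); last exact: cvg_norm.
  apply: differentiable_continuous; apply/derivable1_diffP.
  by apply: ex_derive; apply: is_derive1_powR; rewrite normr_gt0.
rewrite a0 /abs_powR normr0 powR0 ?gt_eqF //; rewrite a0 in ua.
apply/cvgr0Pnorm_le => e e0; have e1 : 0 < Num.min e 1 by rewrite lt_min e0 ltr01.
move/cvgr0Pnorm_le : ua => /(_ _ e1); apply: filterS => x.
rewrite le_min => /andP[ue u1]; rewrite ger0_norm ?powR_ge0 //.
apply: le_trans ue; rewrite -[leRHS]powRr1 //.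
have [-> |ux] := eqVneq (u x) 0; first by rewrite normr0 !powR0 ?gt_eqF.
by apply: ger_powR => //; rewrite u1 normr_gt0 ux.
Qed.

Lemma cvg_round (z : nat -> int) v : (forall S, `|(z S)%:~R - S%:R * v| <= 1) ->
  (z S)%:~R / S%:R @[S --> \oo] --> v.
Proof.
move=> round; apply/cvgrPdist_le => e e0; near=> S.
have Se : e^-1 <= S%:R by near: S; exact: nbhs_infty_ger.
have S0 : 0 < S%:R :> R by apply: lt_le_trans Se; rewrite invr_gt0.
have -> : v - (z S)%:~R / S%:R = - ((z S)%:~R - S%:R * v) / S%:R by field; rewrite gt_eqF.
rewrite normrM normrN normfV (gtr0_norm S0) ler_pdivrMr //.
by apply: le_trans (round S) _; rewrite mulrC -ler_pdivrMr // div1r.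
Unshelve. all: by end_near.
Qed.

Lemma cvg_floor v : (Num.floor (S%:R * v))%:~R / S%:R @[S --> \oo] --> v.
Proof.
apply: cvg_round => S; have /andP[le_v lt_v] := floor_itv (S%:R * v).
by rewrite intrD in lt_v; rewrite ler_norml; apply/andP; split; lra.
Qed.

Lemma cvg_floorD1 v : (Num.floor (S%:R * v) + 1)%:~R / S%:R @[S --> \oo] --> v.
Proof.
apply: (cvg_round (z := fun S => Num.floor (S%:R * v) + 1)) => S.
have /andP[le_v lt_v] := floor_itv (S%:R * v); rewrite intrD in lt_v *.
by rewrite ler_norml; apply/andP; split; lra.
Qed.

Lemma cvg_gadget_cost (T : Type) (F : set_system T) p k L (al : T -> nat -> nat -> R)
    (be : T -> nat -> R) al' be' y : Filter F -> 1 <= p ->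
  (forall g i, al S g i @[S --> F] --> al' g i) -> (forall g, be S g @[S --> F] --> be' g) ->
  gadget_cost p k (Forms L (al S) (be S)) y @[S --> F] --> gadget_cost p k (Forms L al' be') y.
Proof.
move=> FF p1 cvg_al cvg_be; rewrite /gadget_cost /=.
apply: cvg_big => [|g _]; first exact: add_continuous.
apply: cvg_abs_powR => //; apply: cvgD; last exact: cvg_be.
apply: cvg_big => [|i _]; first exact: add_continuous.
by apply: cvgMl; exact: cvg_al.
Qed.

End PowerContinuity.

Section IntegerGadget.
Variables (R : realType) (p rho : R) (k : nat) (G : forms R).
Hypotheses (p_ge1 : 1 <= p) (rho_gt0 : 0 < rho) (exactG : exact_gadget p k rho G).
Local Notation w := (penalty p rho).
Local Notation C := (sat_cost p rho k).

Definition integer_gadget (S : nat) : forms int :=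
  penalise k (map_forms (fun a => Num.floor (S%:R * a)) G) (Num.floor (S%:R * w) + 1).

Local Notation realG S := (map_forms intr (integer_gadget S) : forms R).

Lemma realG_penalise S : realG S =
  penalise k (map_forms (fun a => (Num.floor (S%:R * a))%:~R) G) (Num.floor (S%:R * w) + 1)%:~R.
Proof. exact: (map_penalise (intr : {additive int -> R})). Qed.

Lemma integer_penalty_gt0 S : 0 < (Num.floor (S%:R * w) + 1)%:~R :> R.
Proof.
have /andP[_] := floor_itv (S%:R * w); apply: le_lt_trans.
by apply: mulr_ge0 => //; exact: ltW (penalty_gt0 p_ge1 rho_gt0).
Qed.

Lemma isolates_integer_gadget S : isolates_variables k (realG S).
Proof.
by rewrite realG_penalise; apply: isolates_penalise; rewrite gt_eqF // integer_penalty_gt0.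
Qed.

Lemma integer_gadget_far S y : far_vector k y ->
  S%:R `^ p * (C + rho) <= gadget_cost p k (realG S) y.
Proof.
move=> yfar; have p0 : 0 <= p by exact: le_trans p_ge1.
rewrite realG_penalise.
apply: le_trans (gadget_cost_penalise_far _ (integer_penalty_gt0 S) p0 yfar).
have w0 := ltW (penalty_gt0 p_ge1 rho_gt0).
rewrite sat_cost_penalty // mulrA -powRM //; apply: ler_wpM2r.
  by have := powR3_ge3 p_ge1; have : 0 <= k%:R :> R by []; lra.
apply: ge0_ler_powR => //; rewrite ?nnegrE ?mulr_ge0 // ?ltW ?integer_penalty_gt0 //.
by have /andP[_] := floor_itv (S%:R * w).
Qed.

(* Only finitely many sign vectors are to be considered. *)
Lemma integer_gadget_near (eps : R) : 0 < eps -> \forall S \near \oo, forall y,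
  sign_vector k y ->
  `|gadget_cost p k (penalise k G w) y * S%:R `^ p - gadget_cost p k (realG S) y|
    <= eps * S%:R `^ p.
Proof.
move=> eps0; pose scaled S := map_forms ( *%R S%:R^-1) (realG S).
pose signs (b : {ffun 'I_k -> bool}) (i : nat) : R :=
  if (insub i : option 'I_k) is Some i' then (if b i' then 1 else -1) else 0.
have near_signs (b : {ffun 'I_k -> bool}) : \forall S \near \oo,
    `|gadget_cost p k (penalise k G w) (signs b) - gadget_cost p k (scaled S) (signs b)| <= eps.
  apply: cvgr_dist_le => //; apply: cvg_gadget_cost => // [g i|g] /=; under eq_fun do rewrite mulrC.
    case: ifP => _; first exact: cvg_floor.
    case: ifP => _; first exact: cvg_floorD1.
    by under eq_fun do rewrite mul0r; exact: cvg_cst.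
  case: ifP => _; first exact: cvg_floor.
  by under eq_fun do rewrite mul0r; exact: cvg_cst.
have {}near_signs := filter_forall _ near_signs.
near=> S => y ysign.
have S0 : 0 < S%:R :> R by rewrite ltr0n; near: S; exact: nbhs_infty_gt.
have scaled_cost z : gadget_cost p k (realG S) z = S%:R `^ p * gadget_cost p k (scaled S) z.
  rewrite -gadget_cost_scale //; congr gadget_cost; congr Forms; apply/funext => g.
    by apply/funext => i /=; rewrite mulVKf // gt_eqF.
  by rewrite /= mulVKf // gt_eqF.
have signsE i : (i < k)%N -> y i = signs [ffun i : 'I_k => y i == 1] i.
  move=> ik; rewrite /signs insubT ffunE /=; case: (ysign i ik) => ->; rewrite ?eqxx //.
  by rewrite ifN //; apply/eqP; lra.
rewrite scaled_cost !(eq_gadget_cost _ _ signsE) [_ * S%:R `^ p]mulrC -mulrBr normrM mulrC.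
rewrite (ger0_norm (powR_ge0 S%:R p)) ler_wpM2r ?powR_ge0 //.
by move: [ffun _ => _]; near: S; exact: near_signs.
Unshelve. all: by end_near.
Qed.

Lemma clause_gadget_integer (eps M : R) : 0 < eps -> exists S : nat,
  [/\ (0 < S)%N, M <= S%:R & clause_gadget p k (realG S) ((C - eps) * S%:R `^ p)
    ((C + eps) * S%:R `^ p) ((C + rho - eps) * S%:R `^ p) ((C + rho + eps) * S%:R `^ p)].
Proof.
move=> eps0; have [sat unsat _] := clause_gadget_penalise p_ge1 rho_gt0 exactG.
near \oo => S; exists S.
have close y : sign_vector k y ->
    `|gadget_cost p k (penalise k G w) y * S%:R `^ p - gadget_cost p k (realG S) y|
      <= eps * S%:R `^ p.
  by move: y; near: S; exact: integer_gadget_near.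
split; [by near: S; exact: nbhs_infty_gt|by near: S; exact: nbhs_infty_ger|split=> y].
- move=> ysat; have := close y ysat.1; have /le_anti <- := sat y ysat.
  by rewrite ler_norml => /andP[]; lra.
- move=> yN; have := close y (falsifying_sign_vector yN); have /le_anti <- := unsat y yN.
  by rewrite ler_norml => /andP[]; lra.
- move=> yfar; apply: le_trans (integer_gadget_far S yfar).
  by rewrite mulrC; apply: ler_wpM2l; [exact: powR_ge0|lra].
Unshelve. all: by end_near.
Qed.

End IntegerGadget.

(** * From formulas to lattices *)

Section LiteralCodes.
Variables (k n : nat).
Implicit Types (phi : formula k n) (C : k.-tuple (literal n)) (l : literal n).

Definition codes phi : seq nat :=
  flatten [seq map (@enc_literal n) C | C : k.-tuple (literal n) <- phi].

Definition occurs phi (j : nat) : bool := has (fun c => c./2 == j) (codes phi).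

Lemma half_enc_literal l : (enc_literal l)./2 = l.1.
Proof. by rewrite /enc_literal addnC half_bit_double. Qed.

Lemma odd_enc_literal l : odd (enc_literal l) = l.2.
Proof. by rewrite /enc_literal oddD odd_double; case: l.2. Qed.

Lemma size_codes phi : size (codes phi) = (size phi * k)%N.
Proof.
by elim: phi => //= C phi IH; rewrite size_cat size_map size_tuple IH mulSn.
Qed.

Lemma nth_codes phi c (i : 'I_k) C0 : (c < size phi)%N ->
  nth 0%N (codes phi) (c * k + i) = enc_literal (tnth (nth C0 phi c) i).
Proof.
rewrite /codes; elim: phi c => //= C phi IH [|c] cm.
  rewrite mul0n add0n nth_cat size_map size_tuple ltn_ord.
  by rewrite /= (nth_map (tnth C i)) ?size_tuple // -tnth_nth.
rewrite nth_cat size_map size_tuple mulSn -addnA ltnNge leq_addr /= addKn.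
exact: IH.
Qed.

Lemma occurs_literal phi C l : C \in phi -> l \in C -> occurs phi l.1.
Proof.
move=> C_phi lC; apply/hasP; exists (enc_literal l); last by rewrite half_enc_literal.
by apply/flattenP; exists (map (@enc_literal n) C); exact: map_f.
Qed.

Lemma occursP phi (j : 'I_n) C0 : occurs phi j -> exists c (i : 'I_k),
  (c < size phi)%N /\ (tnth (nth C0 phi c) i).1 = j.
Proof.
move=> /hasP[_ /(nthP 0%N)[x x_lt <-] /eqP xj]; rewrite size_codes in x_lt.
have k0 : (0 < k)%N by have := leq_ltn_trans (leq0n _) x_lt; rewrite muln_gt0 => /andP[].
have cm : (x %/ k < size phi)%N by rewrite ltn_divLR.
exists (x %/ k)%N, (Ordinal (ltn_pmod x k0)); split=> //; apply: val_inj => /=.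
by rewrite -[LHS]half_enc_literal -nth_codes // -divn_eq.
Qed.

End LiteralCodes.

Lemma ltn_block c g m L : (c < m)%N -> (g < L)%N -> (c * L + g < L * m)%N.
Proof.
move=> cm gL; rewrite [(L * m)%N]mulnC; apply: (@leq_trans (c.+1 * L)).
  by rewrite mulSn addnC ltn_add2r.
by rewrite leq_mul2r cm orbT.
Qed.

Lemma divn_block c g L : (g < L)%N -> ((c * L + g) %/ L)%N = c.
Proof. by move=> gL; rewrite divnMDl ?(leq_ltn_trans _ gL) // divn_small // addn0. Qed.

Lemma modn_block c g L : (g < L)%N -> ((c * L + g) %% L)%N = g.
Proof. by move=> gL; rewrite modnMDl modn_small. Qed.

Lemma big_nat_blocks (V : nmodType) (F : nat -> V) m L :
  \sum_(0 <= i < m * L) F i = \sum_(0 <= c < m) \sum_(0 <= g < L) F (c * L + g)%N.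
Proof.
rewrite big_nat_mul; apply: eq_bigr => c _.
by rewrite -{1}[(c * L)%N]add0n big_addn mulSn addnK; apply: eq_bigr => g _; rewrite addnC.
Qed.

Section Instance.
Variables (K : comUnitRingType) (k n : nat) (G : forms K) (phi : formula k n).
Implicit Types (C : k.-tuple (literal n)) (x : 'I_n -> K).
Local Notation L := (nforms G).
Local Notation m := (size phi).
Local Notation code c i := (nth 0%N (codes phi) (c * k + i)%N).

Definition literal_sign (b : bool) : K := if b then 1 else -1.

(* The rows of clause c are the forms of G at the vector y of its literals, where
   y i = (2 x_j - 1) for a literal x_j and y i = - (2 x_j - 1) for its negation. *)
Definition clause_coef (c g j : nat) : K :=
  \sum_(i < k) (if (code c i)./2 == j then 2 * literal_sign (odd (code c i)) * coef G g i else 0).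

Definition clause_target (c g : nat) : K :=
  \sum_(i < k) literal_sign (odd (code c i)) * coef G g i - const G g.

(* Unused variables get a row of their own to keep the columns independent. *)
Definition matrix_entry (i j : nat) : K :=
  if (i < L * m)%N then clause_coef (i %/ L) (i %% L) j
  else ((i - L * m == j)%N && ~~ occurs phi j)%:R.

Definition target_entry (i : nat) : K :=
  if (i < L * m)%N then clause_target (i %/ L) (i %% L) else 0.

Definition sat_matrix : 'M[K]_((L * m + n)%N, n) := \matrix_(i, j) matrix_entry i j.
Definition sat_target : 'cV[K]_((L * m + n)%N) := \col_i target_entry i.

Definition literal_value x (l : literal n) : K := literal_sign l.2 * (2 * x l.1 - 1).

Definition clause_vector C x (i : nat) : K :=
  if (insub i : option 'I_k) is Some i' then literal_value x (tnth C i') else 0.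

Lemma clause_vectorE C x (i : 'I_k) : clause_vector C x i = literal_value x (tnth C i).
Proof. by rewrite /clause_vector valK. Qed.

Lemma matrix_entry_clause c g j : (c < m)%N -> (g < L)%N ->
  matrix_entry (c * L + g) j = clause_coef c g j.
Proof. by move=> cm gL; rewrite /matrix_entry ltn_block // divn_block // modn_block. Qed.

Lemma target_entry_clause c g : (c < m)%N -> (g < L)%N ->
  target_entry (c * L + g) = clause_target c g.
Proof. by move=> cm gL; rewrite /target_entry ltn_block // divn_block // modn_block. Qed.

Lemma matrix_entry_unused i j :
  matrix_entry (L * m + i) j = ((i == j) && ~~ occurs phi j)%:R.
Proof. by rewrite /matrix_entry ltnNge leq_addr /= addKn. Qed.

Lemma target_entry_unused i : target_entry (L * m + i) = 0.
Proof. by rewrite /target_entry ltnNge leq_addr. Qed.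

Lemma sum_clause_coef c g x C0 : (c < m)%N ->
  \sum_(j < n) clause_coef c g j * x j =
  \sum_(i < k) 2 * literal_sign (tnth (nth C0 phi c) i).2 * coef G g i
     * x (tnth (nth C0 phi c) i).1.
Proof.
move=> cm; under eq_bigr do rewrite /clause_coef mulr_suml.
rewrite exchange_big /=; apply: eq_bigr => i _.
rewrite (nth_codes _ C0) // odd_enc_literal half_enc_literal.
set l := tnth _ _; rewrite (bigD1 l.1) //= eqxx big1 ?addr0 // => j jl.
by rewrite eq_sym (negbTE (_ : val j != l.1)) ?mul0r.
Qed.

Lemma clause_row c g x C0 : (c < m)%N -> (g < L)%N ->
  \sum_(j < n) matrix_entry (c * L + g) j * x j - target_entry (c * L + g) =
  \sum_(i < k) coef G g i * clause_vector (nth C0 phi c) x i + const G g.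
Proof.
move=> cm gL; rewrite target_entry_clause //.
under eq_bigr do rewrite matrix_entry_clause //.
rewrite (sum_clause_coef _ _ C0) // /clause_target opprB addrCA [RHS]addrC; congr (_ + _).
rewrite -sumrB; apply: eq_bigr => i _.
by rewrite (nth_codes _ C0) // odd_enc_literal clause_vectorE /literal_value; ring.
Qed.

Lemma unused_row (i : 'I_n) x :
  \sum_(j < n) matrix_entry (L * m + i) j * x j - target_entry (L * m + i) =
  (~~ occurs phi i)%:R * x i.
Proof.
rewrite target_entry_unused subr0 (bigD1 i) //= matrix_entry_unused eqxx /= big1 ?addr0 //.
move=> j ji; rewrite matrix_entry_unused.
by rewrite eq_sym (negbTE (_ : val j != i)) // mul0r.
Qed.

End Instance.

Section InstanceMorphism.
Variables (K K' : comUnitRingType) (f : {rmorphism K -> K'}) (k n : nat).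
Variables (G : forms K) (phi : formula k n).

Lemma rmorph_literal_sign b : f (literal_sign K b) = literal_sign K' b.
Proof. by case: b; rewrite /= ?rmorphN1 ?rmorph1. Qed.

Lemma map_sat_matrix : map_mx f (sat_matrix G phi) = sat_matrix (map_forms f G) phi.
Proof.
apply/matrixP => i j; rewrite !mxE /matrix_entry /=; case: ifP => _; last by rewrite rmorph_nat.
rewrite rmorph_sum; apply: eq_bigr => x _.
by case: ifP => _; rewrite ?rmorph0 // !rmorphM rmorph_nat rmorph_literal_sign.
Qed.

Lemma map_sat_target : map_mx f (sat_target G phi) = sat_target (map_forms f G) phi.
Proof.
apply/colP => i; rewrite !mxE /target_entry /=; case: ifP => _; last by rewrite rmorph0.
rewrite rmorphB rmorph_sum; congr (_ - _).
by apply: eq_bigr => x _; rewrite rmorphM rmorph_literal_sign.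
Qed.

End InstanceMorphism.

Lemma sat_matrix_row_free (F : numFieldType) k n (G : forms F) (phi : formula k n) :
  isolates_variables k G -> row_free (sat_matrix G phi)^T.
Proof.
move=> [alpha alpha0 isolated]; apply: inj_row_free => v vB.
have rowE (i : nat) : (i < nforms G * size phi + n)%N ->
    \sum_(j < n) matrix_entry G phi i j * v 0 j = 0.
  move=> i_lt; have := congr1 (fun M : 'rV_(_ + n) => M 0 (Ordinal i_lt)) vB; rewrite !mxE => vB0.
  by rewrite -[RHS]vB0; apply: eq_bigr => j _; rewrite !mxE mulrC.
apply/rowP => j; rewrite [RHS]mxE.
have [j_in|j_notin] := boolP (occurs phi j); last first.
  have := unused_row G phi j (fun j => v 0 j).
  by rewrite rowE ?ltn_add2l // target_entry_unused subrr j_notin mul1r.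
have C0 : k.-tuple (literal n) by case: (phi) j_in => // C.
have [c [i [cm ij]]] := occursP C0 j_in; have [g gL gE] := isolated i (ltn_ord i).
have := rowE _ (leq_trans (ltn_block cm gL) (leq_addr _ _)).
under eq_bigr do rewrite matrix_entry_clause //.
rewrite (sum_clause_coef _ _ _ C0) // (bigD1 i) //= gE // eqxx big1 ?addr0; last first.
  by move=> i' ii'; rewrite gE // (negbTE (_ : val i' != i)) // mulr0 mul0r.
rewrite ij => /eqP; rewrite !mulf_eq0 (negbTE alpha0) orbF pnatr_eq0 /=.
by rewrite /literal_sign; case: (_.2); rewrite ?oppr_eq0 oner_eq0 /= => /eqP.
Qed.

Section Distance.
Variables (R : realType) (p : R) (d n : nat) (M : 'M[R]_(d, n)) (u : 'cV[R]_d).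
Hypothesis p_gt0 : 0 < p.

Definition cost (x : 'cV[R]_d) : R := \sum_(i < d) `|x i 0| `^ p.

Lemma cost_ge0 x : 0 <= cost x.
Proof. by apply: sumr_ge0 => i _; exact: powR_ge0. Qed.

Lemma le_root (a b : R) : 0 <= a -> a <= b -> a `^ p^-1 <= b `^ p^-1.
Proof.
by move=> a0 ab; apply: ge0_ler_powR; rewrite ?nnegrE ?invr_ge0 ?(ltW p_gt0) ?(le_trans a0).
Qed.

Lemma dist_le_cost (x : 'cV[int]_n) c :
  cost (M *m map_mx intr x - u) <= c -> dist p (lattice M) u <= c `^ p^-1.
Proof.
move=> xc; apply: (@le_trans _ _ (lpnorm p (M *m map_mx intr x - u))).
  apply: ge_inf; first by exists 0 => _ [z _ <-]; exact: powR_ge0.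
  by exists (M *m map_mx intr x) => //; exists x.
by apply: le_root xc; exact: cost_ge0.
Qed.

Lemma dist_ge_cost c : 0 <= c ->
  (forall x : 'cV[int]_n, c <= cost (M *m map_mx intr x - u)) ->
  c `^ p^-1 <= dist p (lattice M) u.
Proof.
move=> c0 c_le; apply: lb_le_inf.
  by exists (lpnorm p (M *m map_mx intr 0 - u)), (M *m map_mx intr 0) => //; exists 0.
by move=> _ [_ [x _ <-] <-]; exact: le_root (c_le x).
Qed.

Lemma dist_ge0 : 0 <= dist p (lattice M) u.
Proof.
apply: le_trans (powR_ge0 0 p^-1) _; apply: dist_ge_cost => // x.
exact: cost_ge0.
Qed.

End Distance.

Section MaximumValue.
Variables (R : realType) (k n : nat) (phi : formula k n).
Hypothesis phi_gt0 : (0 < size phi)%N.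
Local Notation satisfied a := (count (sat_clause a) phi).

Lemma count_val_sat (a : {ffun 'I_n -> bool}) :
  (satisfied a)%:R <= val_sat R phi * (size phi)%:R.
Proof.
rewrite /val_sat mulfVK ?pnatr_eq0 ?gt_eqF // ler_nat.
exact: (leq_bigmax (F := fun a : {ffun 'I_n -> bool} => satisfied a)).
Qed.

Lemma val_sat_attained : exists a : {ffun 'I_n -> bool},
  (satisfied a)%:R = val_sat R phi * (size phi)%:R.
Proof.
have [|a aE] := @bigop.eq_bigmax _ (fun a : {ffun 'I_n -> bool} => satisfied a).
  by apply/card_gt0P; exists [ffun=> false].
by exists a; rewrite /val_sat aE mulfVK // pnatr_eq0 gt_eqF.
Qed.

Lemma val_sat_ge0 : 0 <= val_sat R phi.
Proof. by rewrite divr_ge0. Qed.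

Lemma val_sat_le1 : val_sat R phi <= 1.
Proof.
have [a aE] := val_sat_attained.
by rewrite -(ler_pM2r (_ : 0 < (size phi)%:R)) ?ltr0n // -aE mul1r ler_nat count_size.
Qed.

End MaximumValue.

Section DistanceBounds.
Variables (R : realType) (p : R) (k n : nat) (G : forms R) (phi : formula k n).
Variables (lo hi lo' hi' : R).
Hypotheses (p_gt0 : 0 < p) (gadget : clause_gadget p k G lo hi lo' hi').
Implicit Types (a : {ffun 'I_n -> bool}) (x : 'cV[int]_n) (C : k.-tuple (literal n)).
Local Notation m := (size phi).
Local Notation B := (sat_matrix G phi).
Local Notation t := (sat_target G phi).
Local Notation vec C x := (clause_vector C (fun j => (x j 0)%:~R : R)).

Lemma cost_instance x :
  cost p (B *m map_mx intr x - t) = \sum_(C <- phi) gadget_cost p k G (vec C x) +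
  \sum_(j < n) `|(~~ occurs phi j)%:R * (x j 0)%:~R| `^ p.
Proof.
pose row i := abs_powR p
  (\sum_(j < n) matrix_entry G phi i j * (x j 0)%:~R - target_entry G phi i).
transitivity (\sum_(i < nforms G * m + n) row i).
  apply: eq_bigr => i _; rewrite !mxE /row; congr (`| _ - _ | `^ _).
  by apply: eq_bigr => j _; rewrite !mxE.
rewrite big_split_ord /=; congr (_ + _); last first.
  by apply: eq_bigr => j _; rewrite /row unused_row.
rewrite -(big_mkord xpredT row) mulnC big_nat_blocks.
case: (posnP m) => [m0|m_gt0]; first by rewrite m0 big_geq // (size0nil m0) big_nil.
have C0 : k.-tuple (literal n) by case: (phi) m_gt0 => // C.
rewrite (big_nth C0); apply: eq_big_nat => c /andP[_ cm].
by rewrite big_mkord; apply: eq_bigr => g _; rewrite /row (clause_row _ C0).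
Qed.

Lemma sum_if_sat a (u v : R) :
  \sum_(C <- phi) (if sat_clause a C then u else v) =
  (count (sat_clause a) phi)%:R * u + (m%:R - (count (sat_clause a) phi)%:R) * v.
Proof.
rewrite -(count_predC (sat_clause a)) natrD [X in X - _]addrC addrK.
elim: (phi) => [|C phi' IH]; first by rewrite big_nil !mul0r addr0.
by rewrite big_cons IH /= !natrD; case: (sat_clause a C) => /=; ring.
Qed.

Lemma gadget_cost_assignment a C (y : nat -> R) :
  (forall i : 'I_k, y i = if a (tnth C i).1 == (tnth C i).2 then 1 else -1) ->
  (if sat_clause a C then lo else lo') <= gadget_cost p k G y
    <= (if sat_clause a C then hi else hi').
Proof.
have [sat_bounds unsat_bounds _] := gadget.
move=> yE; case: ifPn => [/hasP [l lC al]|/hasPn unsat].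
  apply: sat_bounds; split.
    by move=> i ik; rewrite -[i]/(val (Ordinal ik)) yE; case: ifP; [left|right].
  by have /tnthP [i lE] := lC; exists (i : nat) => //; rewrite yE -lE al.
apply: unsat_bounds => i ik; rewrite -[i]/(val (Ordinal ik)) yE ifN //.
by apply: unsat; exact: mem_tnth.
Qed.

Lemma cost_assignment a : exists x,
  cost p (B *m map_mx intr x - t) <=
  (count (sat_clause a) phi)%:R * hi + (m%:R - (count (sat_clause a) phi)%:R) * hi'.
Proof.
pose x : 'cV[int]_n := \col_j (if occurs phi j then (a j)%:Z else 0); exists x.
rewrite cost_instance [X in _ + X]big1 ?addr0; last first.
  move=> j _; rewrite mxE.
  by case: (occurs phi j); rewrite ?mul0r ?mulr0 normr0 powR0 // gt_eqF.
rewrite -sum_if_sat big_seq [leRHS]big_seq; apply: ler_sum => C C_phi.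
have vecE (i : 'I_k) : vec C x i = if a (tnth C i).1 == (tnth C i).2 then 1 else -1.
  rewrite clause_vectorE /literal_value /literal_sign mxE.
  rewrite (occurs_literal C_phi (mem_tnth i C)).
  by case: (a _); case: (_.2); rewrite /= ?mulr1 ?mulr0; ring.
by have /andP[] := gadget_cost_assignment vecE.
Qed.

Lemma normr_clause_vector C x (i : 'I_k) :
  `|vec C x i| = `|2 * x (tnth C i).1 0 - 1|%:~R.
Proof.
rewrite clause_vectorE /literal_value normrM intr_norm rmorphB rmorphM /= /literal_sign.
by case: (_.2); rewrite ?normrN normr1 mul1r.
Qed.

(* An integer point is rounded to the assignment that sets the positive coordinates. *)
Lemma gadget_cost_lattice x C : lo <= lo' ->
  (if sat_clause [ffun j => 0 < x j 0 :> int] C then lo else lo') <= gadget_cost p k G (vec C x).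
Proof.
move=> lo_le; have [_ _ far_bound] := gadget.
have [/existsP [i i3]|/existsPn small] :=
    boolP [exists i : 'I_k, (3 <= `|2 * x (tnth C i).1 0 - 1| :> int)].
  apply: (@le_trans _ _ lo'); first by case: ifP.
  apply: far_bound; split; last first.
    by exists (i : nat) => //; rewrite normr_clause_vector (_ : 3 = (3%:Z)%:~R) // ler_int.
  by move=> i' ik; rewrite -[i']/(val (Ordinal ik)) normr_clause_vector ler1z; lia.
pose a := [ffun j => 0 < x j 0 :> int].
have vecE (i : 'I_k) : vec C x i = if a (tnth C i).1 == (tnth C i).2 then 1 else -1.
  have xi : x (tnth C i).1 0 = 0 \/ x (tnth C i).1 0 = 1 by have := small i; lia.
  rewrite clause_vectorE /literal_value /literal_sign ffunE.
  by case: xi => ->; case: (_.2); rewrite /= ?mulr1 ?mulr0; ring.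
by have /andP[] := gadget_cost_assignment vecE.
Qed.

Lemma cost_lattice x : lo <= lo' -> exists a,
  (count (sat_clause a) phi)%:R * lo + (m%:R - (count (sat_clause a) phi)%:R) * lo'
  <= cost p (B *m map_mx intr x - t).
Proof.
move=> lo_le; exists [ffun j => 0 < x j 0 :> int].
rewrite -sum_if_sat cost_instance -[leLHS]addr0; apply: lerD.
  by apply: ler_sum => C _; exact: gadget_cost_lattice.
by apply: sumr_ge0 => j _; exact: powR_ge0.
Qed.

Definition mean_cost (u v : R) : R := val_sat R phi * u + (1 - val_sat R phi) * v.

Lemma dist_sat_le : (0 < m)%N ->
  dist p (lattice B) t <= (m%:R * mean_cost hi hi') `^ p^-1.
Proof.
move=> m_gt0; have [a aE] := val_sat_attained R m_gt0; have [x x_le] := cost_assignment a.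
apply: (dist_le_cost p_gt0 (x := x)); apply: le_trans x_le _.
by rewrite aE /mean_cost le_eqVlt; apply/orP; left; apply/eqP; ring.
Qed.

Lemma dist_sat_ge : (0 < m)%N -> 0 <= lo <= lo' ->
  (m%:R * mean_cost lo lo') `^ p^-1 <= dist p (lattice B) t.
Proof.
move=> m_gt0 /andP[lo0 lo_le].
have mean_le a : m%:R * mean_cost lo lo' <=
    (count (sat_clause a) phi)%:R * lo + (m%:R - (count (sat_clause a) phi)%:R) * lo'.
  have := ler_wpM2r (_ : 0 <= lo' - lo) (count_val_sat R m_gt0 a).
  by rewrite subr_ge0 => /(_ lo_le); rewrite /mean_cost; lra.
apply: dist_ge_cost => // [|x]; last by have [a /(le_trans (mean_le a))] := cost_lattice x lo_le.
have v0 := val_sat_ge0 R phi; have v1 := val_sat_le1 R m_gt0.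
by rewrite /mean_cost mulr_ge0 // addr_ge0 // mulr_ge0; lra.
Qed.

End DistanceBounds.

Local Close Scope ring_scope.
Local Close Scope classical_set_scope.

(** * The reduction as a program *)

Local Notation flags := 2.

Section DerivedExpressions.
Implicit Types (e : nexp) (f : nat -> nat -> nat).
Local Open Scope nexp_scope.

Definition leE e1 e2 : nexp := 1 - (e1 - e2).
Definition ltE e1 e2 : nexp := leE (e1 + 1) e2.
Definition eqE e1 e2 : nexp := leE e1 e2 * leE e2 e1.
Definition halfE e : nexp := e %/ 2.
Definition oddE e : nexp := e - 2 * halfE e.
Definition modE e1 e2 : nexp := e1 - (e1 %/ e2) * e2.

Local Close Scope nexp_scope.

Lemma neval_le f e1 e2 : neval f (leE e1 e2) = (neval f e1 <= neval f e2).
Proof. by rewrite /=; case: leqP => /= ?; lia. Qed.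

Lemma neval_lt f e1 e2 : neval f (ltE e1 e2) = (neval f e1 < neval f e2).
Proof. by rewrite neval_le /= addn1. Qed.

Lemma neval_eq f e1 e2 : neval f (eqE e1 e2) = (neval f e1 == neval f e2).
Proof. by rewrite /=; case: eqP => /= ?; nia. Qed.

Lemma neval_half f e : neval f (halfE e) = (neval f e)./2.
Proof. by rewrite /= divn2. Qed.

Lemma neval_odd f e : neval f (oddE e) = odd (neval f e).
Proof. by rewrite /= divn2 mul2n; have := odd_double_half (neval f e); lia. Qed.

Lemma neval_mod f e1 e2 : neval f (modE e1 e2) = neval f e1 %% neval f e2.
Proof. by rewrite /= {1}(divn_eq (neval f e1) (neval f e2)) addKn. Qed.

Lemma neval_Cst f (m : nat) : neval f m = m. Proof. by []. Qed.

Lemma neval_Cell f a e : neval f (Cell a e) = f a (neval f e). Proof. by []. Qed.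

Lemma neval_Bin f o e1 e2 : neval f (Bin o e1 e2) = nat_op_fun o (neval f e1) (neval f e2).
Proof. by []. Qed.

(* The order matters: neval_Bin also applies to the derived operations. *)
Definition nevalE := (neval_lt, neval_eq, neval_le, neval_odd, neval_mod, neval_half,
  neval_Bin, neval_Cell, neval_Cst).

End DerivedExpressions.

Local Notation "e1 <= e2" := (leE e1 e2) : nexp_scope.
Local Notation "e1 < e2" := (ltE e1 e2) : nexp_scope.
Local Notation "e1 == e2" := (eqE e1 e2) : nexp_scope.
Local Notation "e1 %% e2" := (modE e1 e2) : nexp_scope.

Definition num_vars : nexp := Cell 0 0.
Definition num_clauses : nexp := Cell 0 1.

Definition holds_formula k n (phi : formula k n) (f : nat -> nat -> nat) : Prop :=
  forall x, f 0 x = nth 0 (enc_formula phi) x.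

Definition holds_flags k n (phi : formula k n) (f : nat -> nat -> nat) : Prop :=
  forall x, f flags x = occurs phi x.

Section Combinations.
Variable K : comUnitRingType.
Implicit Types (ts : seq (K * nexp)) (f : nat -> nat -> nat) (e : nexp) (b : nat).
Local Open Scope ring_scope.

Definition combination ts f : K := \sum_(t <- ts) t.1 * (neval f t.2)%:R.

Definition avoids b e : bool := nwf e && ~~ nreads b e.

Definition all_avoid b ts : bool := all (fun t => avoids b t.2) ts.

Lemma combination_cat ts1 ts2 f :
  combination (ts1 ++ ts2) f = combination ts1 f + combination ts2 f.
Proof. exact: big_cat. Qed.

End Combinations.

Section InstanceExpressions.
Variables (k L : nat) (row col : nexp).
Local Open Scope nexp_scope.

Definition code_at (i : nat) : nexp := Cell 0 (2 + (row %/ L * k + i)).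

Definition in_form (g : nat) : nexp := (row < L * num_clauses) * (row %% L == g).

Definition plain_literal (i : nat) : nexp := oddE (code_at i).

Definition negated_literal (i : nat) : nexp := 1 - oddE (code_at i).

Definition literal_of_col (i : nat) : nexp := halfE (code_at i) == col.

Definition unused_entry : nexp := (L * num_clauses <= row) *
  ((row - L * num_clauses == col) * (1 - Cell flags col)).

End InstanceExpressions.

Section InstanceTerms.
Local Arguments neval : simpl never.
Variables (K : comUnitRingType) (k : nat) (G : forms K) (row col : nexp).
Implicit Types (c : nat -> nat -> K) (e : nat -> nexp).
Local Notation L := (nforms G).
Local Notation in_form := (in_form L row).
Local Notation code_at := (code_at k L row).
Local Open Scope ring_scope.

Definition signed_terms c e : seq (K * nexp) :=
  [seq (c gi.1 gi.2, in_form gi.1 * plain_literal k L row gi.2 * e gi.2)%nexp |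
     gi <- allpairs pair (iota 0 L) (iota 0 k)] ++
  [seq (- c gi.1 gi.2, in_form gi.1 * negated_literal k L row gi.2 * e gi.2)%nexp |
     gi <- allpairs pair (iota 0 L) (iota 0 k)].

Definition matrix_terms : seq (K * nexp) :=
  signed_terms (fun g i => 2 * coef G g i) (literal_of_col k L row col) ++
  [:: (1, unused_entry L row col)].

Definition target_terms : seq (K * nexp) :=
  signed_terms (coef G) (fun=> 1%N) ++ [seq (- const G g, in_form g) | g <- iota 0 L].

Lemma signed_terms_avoid b c e : b != 0%N -> avoids b row -> (forall i, avoids b (e i)) ->
  all_avoid b (signed_terms c e).
Proof.
rewrite eq_sym => /negbTE b0 /andP[row_wf /negbTE row_b] e_b.
rewrite /all_avoid all_cat !all_map; apply/andP; split; apply/allP => gi _ /=;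
by have /andP[ewf /negbTE er] := e_b gi.2; rewrite /avoids /= !row_wf ewf !row_b !b0 er.
Qed.

Lemma matrix_terms_avoid b : b != 0%N -> b != flags -> avoids b row -> avoids b col ->
  all_avoid b matrix_terms.
Proof.
move=> b0 b_flags row_b col_b; rewrite /all_avoid all_cat; apply/andP; split.
  apply: signed_terms_avoid => // i; move: row_b col_b b0; rewrite /avoids /= eq_sym.
  by move=> /andP[-> /negbTE->] /andP[-> /negbTE->] /negbTE->.
move: row_b col_b b0 b_flags; rewrite /avoids /= ![b == _]eq_sym.
by move=> /andP[-> /negbTE->] /andP[-> /negbTE->] /negbTE-> /negbTE->.
Qed.

Lemma target_terms_avoid b : b != 0%N -> avoids b row -> all_avoid b target_terms.
Proof.
move=> b0 row_b; rewrite /all_avoid all_cat; apply/andP; split; first exact: signed_terms_avoid.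
rewrite all_map; apply/allP => g _; move: row_b b0; rewrite /avoids /= eq_sym.
by move=> /andP[-> /negbTE->] /negbTE->.
Qed.

Variables (n : nat) (phi : formula k n) (f : nat -> nat -> nat) (i : nat).
Hypotheses (f_formula : holds_formula phi f) (row_i : neval f row = i) (L_gt0 : (0 < L)%N).
Local Notation m := (size phi).
Local Notation code x := (nth 0%N (codes phi) (i %/ L * k + x)%N).

Lemma neval_num_clauses : neval f num_clauses = m. Proof. exact: f_formula. Qed.

Lemma neval_code_at x : neval f (code_at x) = code x.
Proof. by rewrite /code_at !nevalE f_formula row_i. Qed.

Lemma neval_in_form g : neval f (in_form g) = ((i < L * m) && (i %% L == g))%N :> nat.
Proof. by rewrite /in_form !(neval_num_clauses, nevalE) /= row_i mulnb. Qed.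

Lemma sum_in_form (F : nat -> K) :
  \sum_(g <- iota 0 L) F g * (neval f (in_form g))%:R = if (i < L * m)%N then F (i %% L)%N else 0.
Proof.
under eq_bigr do rewrite neval_in_form.
case: ltnP => _ /=; last by rewrite big1 // => g _; rewrite mulr0.
rewrite -[L in iota _ L]subn0 big_mkord (bigD1 (Ordinal (ltn_pmod i L_gt0))) //= eqxx mulr1.
rewrite big1 ?addr0 // => g gi.
by rewrite eq_sym (negbTE (_ : val g != (i %% L)%N)) ?mulr0.
Qed.

Lemma signed_termsE c e : combination (signed_terms c e) f =
  if (i < L * m)%N then
    \sum_(x < k) literal_sign K (odd (code x)) * c (i %% L)%N x * (neval f (e x))%:R
  else 0.
Proof.
rewrite -(sum_in_form (fun g => \sum_(x < k) literal_sign K (odd (code x)) * c g x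
  * (neval f (e x))%:R)) combination_cat /combination !big_map !big_allpairs -big_split /=.
apply: eq_bigr => g _; rewrite mulr_suml -[k in iota _ k]subn0 !big_mkord -big_split /=.
apply: eq_bigr => x _; rewrite /plain_literal /negated_literal.
rewrite !(neval_odd, neval_Bin, neval_Cst) !neval_code_at /literal_sign.
rewrite /nat_op_fun; case: (odd _) => /=; rewrite ?subnn ?subn0 ?muln1 ?muln0 ?mul0n !natrM; ring.
Qed.

Lemma target_termsE : combination target_terms f = target_entry G phi i.
Proof.
rewrite combination_cat signed_termsE /combination big_map /=.
rewrite (sum_in_form (fun g => - const G g)) /target_entry /clause_target.
case: ifP => _; last exact: addr0.
by congr (_ - _); apply: eq_bigr => x _; rewrite neval_Cst mulr1.
Qed.

Lemma matrix_termsE j : holds_flags phi f -> neval f col = j ->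
  combination matrix_terms f = matrix_entry G phi i j.
Proof.
move=> f_flags col_j; rewrite combination_cat signed_termsE /combination big_seq1 mul1r /=.
rewrite /unused_entry !(neval_num_clauses, nevalE) /= row_i col_j f_flags.
rewrite /matrix_entry /clause_coef.
case: ltnP => im /=; last by rewrite add0r mul1n /=; case: (occurs _ _); case: eqP.
rewrite mul0n addr0; apply: eq_bigr => x _; rewrite /literal_of_col.
rewrite neval_eq neval_half neval_code_at col_j.
by case: eqP => _; rewrite ?mulr0 // mulr1; ring.
Qed.

End InstanceTerms.

Section OccurrenceFlags.
Local Arguments neval : simpl never.
Variables (R : realType) (k : nat).

Definition flag_prog : prog R := fill R flags (k * num_clauses)%nexp
  (halfE (Cell 0 (2 + Var counter)%nexp)) 1.

Definition flag_cost : nat -> nat := fill_cost (k * num_clauses)%nexp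
  (halfE (Cell 0 (2 + Var counter)%nexp)) 1.

Lemma has_nth (T : Type) (x0 : T) (P : pred T) (s : seq T) :
  has P s = has (fun x => P (nth x0 s x)) (iota 0 (size s)).
Proof. by rewrite -{1}(mkseq_nth x0 s) has_map. Qed.

Lemma flag_runs n (phi : formula k n) s V :
  holds_formula phi (nats s) -> (forall x, nats s flags x = 0) ->
  bounded V s -> 0 < V -> k * size phi <= V ->
  runs flag_prog s (flag_cost V) (fun t =>
    [/\ same_outside [:: flags; counter; limit] s t, holds_flags phi (nats t) & bounded V t]).
Proof.
move=> s_phi s_flags bs V0 kV.
have lengthE : neval (nats s) (k * num_clauses)%nexp = k * size phi.
  by rewrite !(neval_num_clauses s_phi, nevalE).
apply: runs_post (fill_runs _ lengthE kV bs _) _ => // t [_ nt wt bt]; split=> // x.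
rewrite wt written_cst s_flags; set found := has _ _.
have -> : occurs phi x = found; last by case: found.
rewrite /occurs (has_nth 0) size_codes mulnC; apply: eq_in_has => y _.
by rewrite !nevalE /env /update /= s_phi.
Qed.

Lemma is_poly_flag_cost : is_poly flag_cost.
Proof. exact: is_poly_fill_cost. Qed.

End OccurrenceFlags.

#[local] Hint Resolve is_poly_flag_cost : poly.

Section InputWord.
Variables (R : realType) (k n : nat).
Implicit Types (phi : formula k n).

Lemma enc_formula_leq phi x : nth 0 (enc_formula phi) x <= 2 * (n + size phi) + 2.
Proof.
case: x => [|[|x]] /=; [lia|lia|].
have [x_lt|x_ge] := ltnP x (size (codes phi)); last by rewrite nth_default.
have /flattenP [w /mapP [C C_phi ->] /mapP [l lC ->]] := mem_nth 0 x_lt.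
rewrite /enc_literal; have := ltn_ord l.1; move: (nat_of_ord _) (l.2) => a b an.
by case: b; rewrite -muln2 /=; lia.
Qed.

Lemma bounded_init_state phi V : 2 * (n + size phi) + 2 <= V ->
  bounded V (init_state R (enc_formula phi)).
Proof.
move=> V_ge a i _; rewrite /=; case: ifP => // _.
exact: leq_trans (enc_formula_leq phi i) V_ge.
Qed.

End InputWord.

Lemma neval_counter (R : realType) (s : state R) j : neval (env s j) (Var counter) = j.
Proof. by rewrite /= /env /update eqxx. Qed.

Section RealCombinations.
Variable R : realType.
Implicit Types (ts : seq (R * nexp)).

Definition rsum ts : rexp R :=
  foldr (fun t acc => RBin RAdd (RBin RMul (RCst t.1) (RNat R t.2)) acc) (RCst 0%R) ts.

Lemma reval_rsum ts f : reval f (rsum ts) = combination ts f.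
Proof.
rewrite /combination; elim: ts => [|t ts IH] /=; first by rewrite big_nil.
by rewrite big_cons IH.
Qed.

Lemma rsum_avoids b ts : all_avoid b ts -> rwf (rsum ts) /\ ~~ rreads b (rsum ts).
Proof. by elim: ts => //= t ts IH /andP[/andP[-> /negbTE->] /IH]. Qed.

End RealCombinations.

Section Reduction.
Local Arguments neval : simpl never.
Variables (R : realType) (k : nat) (G : forms R) (D q : R).
Hypothesis nforms_gt0 : 0 < nforms G.
Local Notation L := (nforms G).

Definition dimE (L : nat) : nexp := (L * num_clauses + num_vars)%nexp.

Definition matrixR : rexp R := rsum
  (matrix_terms k G (Var counter %/ num_vars)%nexp (Var counter %% num_vars)%nexp).

Definition targetR : rexp R := rsum (target_terms k G (Var counter)).

Definition radiusR : rexp R := RBin RPow (RBin RMul (RNat R num_clauses) (RCst D)) (RCst q).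

Definition reduction : prog R :=
  Seq (flag_prog R k)
  (Seq (rfill 2 (dimE L * num_vars)%nexp (Var counter) matrixR)
  (Seq (rfill 1 (dimE L) (Var counter) targetR)
  (Seq (rstore 0 0 radiusR) (store R 0 1 (dimE L))))).

Definition reduction_cost V : nat :=
  flag_cost k V + (rfill_cost (dimE L * num_vars)%nexp (Var counter) matrixR V
  + (rfill_cost (dimE L) (Var counter) targetR V
  + (rstore_cost 0 radiusR V + store_cost 1 (dimE L) V))).

(* Bounds every number handled on formulas with n + m = N. *)
Definition reduction_bound N : nat := (L * N + N) * (N + 1) + k * N + 2 * N + 2.

Lemma is_poly_reduction_bound : is_poly reduction_bound.
Proof. by rewrite /reduction_bound; auto 20 with poly. Qed.

Lemma is_poly_reduction_cost : is_poly reduction_cost.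
Proof. by rewrite /reduction_cost; auto 20 with poly. Qed.

Section Input.
Variables (n : nat) (phi : formula k n).
Local Notation m := (size phi).

Lemma neval_num_vars f : holds_formula phi f -> neval f num_vars = n.
Proof. by move=> f_phi; exact: f_phi. Qed.

Lemma neval_dim L' f : holds_formula phi f -> neval f (dimE L') = L' * m + n.
Proof.
move=> f_phi; rewrite /dimE.
by rewrite !(neval_num_clauses f_phi, neval_num_vars f_phi, nevalE).
Qed.

Lemma holds_formula_env (s : state R) j : holds_formula phi (nats s) -> holds_formula phi (env s j).
Proof. by move=> s_phi x; rewrite -s_phi. Qed.

Definition holds_matrix (s : state R) : Prop :=
  forall (i : 'I_(L * m + n)) (j : 'I_n), reals s 2 (i * n + j) = sat_matrix G phi i j.

Lemma matrix_runs s V : holds_formula phi (nats s) -> holds_flags phi (nats s) ->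
  bounded V s -> (L * m + n) * n <= V ->
  runs (rfill 2 (dimE L * num_vars)%nexp (Var counter) matrixR) s
    (rfill_cost (dimE L * num_vars)%nexp (Var counter) matrixR V)
    (fun t => [/\ same_outside [:: counter; limit] s t, holds_matrix t & bounded V t]).
Proof.
move=> s_phi s_flags bs sizeV.
have sizeE : neval (nats s) (dimE L * num_vars)%nexp = (L * m + n) * n.
  by rewrite neval_Bin (neval_dim L s_phi) (neval_num_vars s_phi).
have [wf_matrix no_limit] : rwf matrixR /\ ~~ rreads limit matrixR.
  by apply: rsum_avoids; exact: matrix_terms_avoid.
apply: runs_post (rfill_runs _ _ sizeE sizeV bs) _ => //.
  by rewrite wf_matrix no_limit.
move=> t [nt _ rt bt]; split=> // i j; have n0 : 0 < n by exact: leq_ltn_trans (ltn_ord j).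
have s_phi' := holds_formula_env (i * n + j) s_phi.
rewrite rt written_id; last by move=> x; exact: neval_counter.
rewrite ifT; last first.
  have : i.+1 * n <= (L * m + n) * n by rewrite leq_mul2r ltn_ord orbT.
  by have := ltn_ord j; rewrite mulSn; move: (i * n) (_ * n) => x y; lia.
rewrite reval_rsum mxE; apply: matrix_termsE => //.
- by rewrite neval_Bin (neval_num_vars s_phi') neval_counter /= divnMDl // divn_small ?addn0.

- by rewrite neval_mod (neval_num_vars s_phi') neval_counter modnMDl modn_small.
Qed.

Lemma target_runs s V : holds_formula phi (nats s) -> bounded V s -> L * m + n <= V ->
  holds_matrix s ->
  runs (rfill 1 (dimE L) (Var counter) targetR) s (rfill_cost (dimE L) (Var counter) targetR V)
    (fun t => [/\ same_outside [:: counter; limit] s t, holds_matrix t,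
       forall i : 'I_(L * m + n), reals t 1 i = sat_target G phi i 0%R & bounded V t]).
Proof.
move=> s_phi bs dimV s_matrix.
have [wf_target no_limit] : rwf targetR /\ ~~ rreads limit targetR.
  by apply: rsum_avoids; exact: target_terms_avoid.
apply: runs_post (rfill_runs _ _ (neval_dim L s_phi) dimV bs) _ => //.
  by rewrite wf_target no_limit.
move=> t [nt keep rt bt]; split=> //; first by move=> i j; rewrite keep.
move=> i; rewrite rt written_id; last by move=> x; exact: neval_counter.
by rewrite ltn_ord reval_rsum mxE; apply: target_termsE.
Qed.

Lemma output_runs s V : holds_formula phi (nats s) -> bounded V s -> holds_matrix s ->
  (forall i : 'I_(L * m + n), reals s 1 i = sat_target G phi i 0%R) ->
  runs (Seq (rstore 0 0 radiusR) (store R 0 1 (dimE L))) s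
    (rstore_cost 0 radiusR V + store_cost 1 (dimE L) V)
    (fun t => outputs_cvp t (sat_matrix G phi) (sat_target G phi) ((m%:R * D) `^ q)%R).
Proof.
move=> s_phi bs s_matrix s_target.
apply: runs_seq (rstore_runs 0 _ _ bs) _ => // s1 [n1 r1].
have s1_phi : holds_formula phi (nats s1) by move=> x; rewrite n1.
have b1 : bounded V s1 by move=> b i ob; rewrite n1 ?bs // program_scratch.
apply: runs_post (store_runs 0 _ _ b1) _ => // t [rt nt].
split; first by rewrite !nt // (neval_dim L s1_phi); split=> //; exact: s1_phi.
- by rewrite rt r1 // /update /= (neval_num_clauses s_phi).
- by move=> i; rewrite rt r1 // -s_target.
- by move=> i j; rewrite rt r1 // -s_matrix.
Qed.

Lemma reduction_runs : runs reduction (init_state R (enc_formula phi))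
  (reduction_cost (reduction_bound (n + m)))
  (fun t => outputs_cvp t (sat_matrix G phi) (sat_target G phi) ((m%:R * D) `^ q)%R).
Proof.
set V := reduction_bound _; set s := init_state _ _.
have bs : bounded V s by apply: bounded_init_state; rewrite /V /reduction_bound; nia.
have V0 : 0 < V by rewrite /V /reduction_bound; nia.
have lengthV : k * m <= V by rewrite /V /reduction_bound; nia.
have sizeV : (L * m + n) * n <= V by rewrite /V /reduction_bound; nia.
have dimV : L * m + n <= V by rewrite /V /reduction_bound; nia.
apply: runs_seq (flag_runs _ _ bs V0 lengthV) _ => // s1 [n1 flags1 b1].
have phi1 : holds_formula phi (nats s1) by move=> x; rewrite n1.
apply: runs_seq (matrix_runs phi1 flags1 b1 sizeV) _ => s2 [n2 matrix2 b2].
have phi2 : holds_formula phi (nats s2) by move=> x; rewrite n2.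
apply: runs_seq (target_runs phi2 b2 dimV matrix2) _ => s3 [n3 matrix3 target3 b3].
by apply: output_runs => // x; rewrite n3.
Qed.

End Input.

End Reduction.

#[local] Hint Resolve is_poly_reduction_bound is_poly_reduction_cost : poly.

(** * Writing rational instances *)

Section RationalWords.
Local Open Scope ring_scope.
Implicit Types (z : int) (zs : seq int).

Definition enc_int z : seq nat := [:: nat_of_bool (z < 0)%R; `|z|%N; 1%N].

Lemma enc_rat_int z : enc_rat z%:~R = enc_int z.
Proof. by rewrite /enc_rat numq_int denq_int ltrz0. Qed.

Lemma size_enc_ints zs : size (flatten (map enc_int zs)) = (3 * size zs)%N.
Proof. by elim: zs => //= z zs ->; rewrite mulnS. Qed.

Lemma nth_enc_ints zs x : (x < 3 * size zs)%N ->
  nth 0%N (flatten (map enc_int zs)) x = nth 0%N (enc_int (nth 0 zs (x %/ 3))) (x %% 3).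
Proof.
elim: zs x => [|z zs IH] x /=; first by rewrite muln0.
case: x => [|[|[|x]]] // xs.
have -> : (x.+3 %/ 3 = (x %/ 3).+1)%N by lia.
have -> : (x.+3 %% 3 = x %% 3)%N by lia.
by rewrite /= IH //; lia.
Qed.

Lemma nth_allpairs_iota (T : Type) (x0 : T) (F : nat -> nat -> T) a d n x : (x < d * n)%N ->
  nth x0 [seq F i j | i <- iota a d, j <- iota 0 n] x = F (a + x %/ n)%N (x %% n)%N.
Proof.
elim: d a x => [|d IH] a x //= xd.
have n0 : (0 < n)%N by move: xd; case: (n) => //; rewrite muln0.
rewrite nth_cat size_map size_iota; case: ltnP => xn.
  by rewrite (nth_map 0%N) ?size_iota // nth_iota // add0n divn_small // addn0 modn_small.
rewrite IH; last by rewrite -(ltn_add2l n) subnKC // -mulSn.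
by rewrite -[in RHS](subnK xn) modnDr divnDr ?dvdnn // divnn n0 addn1 addnS addSn.
Qed.

Section Entries.
Variables (d n : nat) (B : nat -> nat -> int) (t : nat -> int).

Definition entries : seq int :=
  [seq t i | i <- iota 0 d] ++ [seq B i j | i <- iota 0 d, j <- iota 0 n].

Lemma size_entries : size entries = (d + d * n)%N.
Proof. by rewrite size_cat size_map size_allpairs !size_iota. Qed.

Lemma nth_entries e : (e < d + d * n)%N -> nth 0 entries e =
  if (e < d)%N then t e else B ((e - d) %/ n)%N ((e - d) %% n)%N.
Proof.
move=> e_lt; rewrite nth_cat size_map size_iota; case: ltnP => de.
  by rewrite (nth_map 0%N) ?size_iota // nth_iota.
by rewrite nth_allpairs_iota // -(ltn_add2l d) subnKC.
Qed.

Lemma enc_cvp_int (r : nat) :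
  enc_cvp (map_mx intr (\matrix_(i < d, j < n) B i j)) (map_mx intr (\col_(i < d) t i)) r%:R =
  [:: n; d; 0; r; 1]%N ++ flatten (map enc_int entries).
Proof.
rewrite /enc_cvp pmulrn enc_rat_int /enc_int ltz_nat /= map_cat flatten_cat.
rewrite /entries -!val_enum_ord -map_comp allpairs_mapl allpairs_mapr.
congr [:: _, _, _, _, _ & _ ++ _]; congr flatten.
  by rewrite -map_comp; apply: eq_map => i /=; rewrite !mxE enc_rat_int.
by rewrite map_allpairs; apply: eq_allpairs => i j; rewrite !mxE enc_rat_int.
Qed.

End Entries.

Section SignedExpressions.
Implicit Types (ts : seq (int * nexp)) (f : nat -> nat -> nat).

Definition positive_part ts : nexp :=
  foldr (fun t acc => ((if (0 <= t.1)%R then `|t.1|%N else 0%N) * t.2 + acc)%nexp) 0%N ts.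

Definition negative_part ts : nexp :=
  foldr (fun t acc => ((if (0 <= t.1)%R then 0%N else `|t.1|%N) * t.2 + acc)%nexp) 0%N ts.

Lemma combination_parts ts f :
  combination ts f = (neval f (positive_part ts))%:Z - (neval f (negative_part ts))%:Z.
Proof.
elim: ts => [|t ts IH]; first by rewrite /combination big_nil.
rewrite /combination big_cons -/(combination ts f) IH /= !PoszD !PoszM natz.
by case: (lerP 0 t.1) => t0; [rewrite (gez0_abs t0)|rewrite (ltz0_abs t0)]; ring.
Qed.

Lemma parts_avoid b ts : all_avoid b ts ->
  avoids b (positive_part ts) /\ avoids b (negative_part ts).
Proof.
elim: ts => //= t ts IH /andP[/andP[wt /negbTE rt] /IH [/andP[wp /negbTE rp] /andP[wn /negbTE rn]]].
by rewrite /avoids /= wt rt wp rp wn rn.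
Qed.

End SignedExpressions.

End RationalWords.

Local Notation radius := 20.

Section WordExpressions.
Variables (k : nat) (G : forms int).
Local Notation L := (nforms G).
Local Notation x := (Var counter).
Local Open Scope nexp_scope.

Definition entry_index : nexp := (x - 5) %/ 3.

Definition component : nexp := (x - 5) %% 3.

Definition in_target : nexp := entry_index < dimE L.

Definition word_target_terms : seq (int * nexp) := target_terms k G entry_index.

Definition word_matrix_terms : seq (int * nexp) := matrix_terms k G
  ((entry_index - dimE L) %/ num_vars) ((entry_index - dimE L) %% num_vars).

Definition entry_positive : nexp := in_target * positive_part word_target_terms
  + (1 - in_target) * positive_part word_matrix_terms.

Definition entry_negative : nexp := in_target * negative_part word_target_terms
  + (1 - in_target) * negative_part word_matrix_terms.

Definition entry_letter : nexp := (component == 0) * (entry_positive < entry_negative)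
  + ((component == 1) * ((entry_positive - entry_negative) + (entry_negative - entry_positive))
  + (component == 2)).

Definition header_letter : nexp :=
  (x == 0) * num_vars + ((x == 1) * dimE L + ((x == 3) * Var radius + (x == 4))).

Definition word_letter : nexp := (x < 5) * header_letter + (5 <= x) * entry_letter.

Definition word_length : nexp := 5 + 3 * (dimE L + dimE L * num_vars).

Local Close Scope nexp_scope.

Lemma word_letter_avoids b : b != 0 -> b != flags -> b != counter -> b != radius ->
  avoids b word_letter.
Proof.
move=> b0 b_flags b_counter b_radius; have ne0 : (0 == b) = false by rewrite eq_sym (negbTE b0).
have neC : (counter == b) = false by rewrite eq_sym (negbTE b_counter).
have [|/andP[wtp /negbTE rtp] /andP[wtn /negbTE rtn]] :=
    parts_avoid (b := b) (ts := word_target_terms).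
  by apply: target_terms_avoid => //; rewrite /avoids /= neC.
have [|/andP[wmp /negbTE rmp] /andP[wmn /negbTE rmn]] :=
    parts_avoid (b := b) (ts := word_matrix_terms).
  by apply: matrix_terms_avoid => //; rewrite /avoids /= ?ne0 ?neC.
rewrite /avoids /word_letter /entry_letter /entry_positive /entry_negative /=.
by rewrite wtp wtn wmp wmn rtp rtn rmp rmn ne0 neC eq_sym (negbTE b_radius).
Qed.

End WordExpressions.

Section InstanceWord.
Local Arguments neval : simpl never.
Variables (k n : nat) (G : forms int) (phi : formula k n).
Local Notation L := (nforms G).
Local Notation m := (size phi).
Local Notation d := (L * m + n).
Local Notation all_entries := (entries d n (matrix_entry G phi) (target_entry G phi)).
Hypothesis nforms_gt0 : 0 < L.

Definition cvp_word (r : nat) : seq nat :=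
  enc_cvp (map_mx (intr : int -> rat) (sat_matrix G phi))
    (map_mx (intr : int -> rat) (sat_target G phi)) (r%:R)%R.

Definition cvp_word_size : nat := 5 + 3 * (d + d * n).

Lemma cvp_wordE r : cvp_word r = [:: n; d; 0; r; 1] ++ flatten (map enc_int all_entries).
Proof. exact: enc_cvp_int. Qed.

Lemma size_cvp_word r : size (cvp_word r) = cvp_word_size.
Proof. by rewrite cvp_wordE size_cat size_enc_ints size_entries. Qed.

Lemma neval_word_length f : holds_formula phi f -> neval f (word_length G) = cvp_word_size.
Proof.
move=> f_phi; rewrite /word_length.
by rewrite !(neval_dim L f_phi, neval_num_vars f_phi, neval_Bin, neval_Cst).
Qed.

Section Evaluation.
Variables (f : nat -> nat -> nat) (r x : nat).
Hypotheses (f_phi : holds_formula phi f) (f_flags : holds_flags phi f).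
Hypotheses (f_counter : f counter 0 = x) (f_radius : f radius 0 = r).

Lemma neval_entry_index : neval f entry_index = (x - 5) %/ 3.
Proof. by rewrite !nevalE f_counter. Qed.

Lemma neval_entry : (x - 5) %/ 3 < d + d * n ->
  ((neval f (entry_positive k G))%:Z - (neval f (entry_negative k G))%:Z)%R =
  nth 0%R all_entries ((x - 5) %/ 3).
Proof.
move=> e_lt; have in_targetE : neval f (in_target G) = ((x - 5) %/ 3 < d).
  by rewrite neval_lt neval_entry_index (neval_dim L f_phi).
rewrite nth_entries // /entry_positive /entry_negative.
rewrite !(in_targetE, neval_Bin, neval_Cst) /=.
case: ltnP => _; rewrite ?mul1n ?mul0n ?subnn ?subn0 ?mul0n ?mul1n ?addn0 ?add0n.
  by rewrite -combination_parts; apply: target_termsE; rewrite ?neval_entry_index.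
rewrite -combination_parts; apply: matrix_termsE => //;
by rewrite !(neval_mod, neval_entry_index, neval_dim L f_phi, neval_num_vars f_phi, neval_Bin).
Qed.

Lemma neval_entry_letter : 5 <= x < cvp_word_size ->
  neval f (entry_letter k G) = nth 0 (flatten (map enc_int all_entries)) (x - 5).
Proof.
move=> /andP[x5 x_lt]; have u_lt : x - 5 < 3 * (d + d * n) by rewrite /cvp_word_size in x_lt; lia.
rewrite nth_enc_ints ?size_entries // -neval_entry; last by rewrite ltn_divLR // mulnC.
have componentE : neval f component = (x - 5) %% 3 by rewrite !nevalE f_counter.
set P := neval f (entry_positive k G); set N := neval f (entry_negative k G).
have -> : neval f (entry_letter k G) =
    neval f (component == 0)%nexp * neval f (entry_positive k G < entry_negative k G)%nexp
    + (neval f (component == 1)%nexp * ((P - N) + (N - P)) + neval f (component == 2)%nexp).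
  by [].
rewrite !neval_eq neval_lt !componentE !neval_Cst -/P -/N.
have : (x - 5) %% 3 < 3 by rewrite ltn_mod.
case: (_ %% 3) => [|[|[|]]] //= _; rewrite ?mul0n ?mul1n ?add0n ?addn0 //; last by lia.
by congr nat_of_bool; lia.
Qed.

Lemma neval_header_letter : x < 5 -> neval f (header_letter G) = nth 0 [:: n; d; 0; r; 1] x.
Proof.
rewrite /header_letter !(neval_dim L f_phi, neval_num_vars f_phi, nevalE) f_counter f_radius.
by case: x => [|[|[|[|[|]]]]] //= _; rewrite ?mul0n ?mul1n ?add0n ?addn0.
Qed.

Lemma neval_word_letter : x < cvp_word_size -> neval f (word_letter k G) = nth 0 (cvp_word r) x.
Proof.
move=> x_lt; rewrite cvp_wordE nth_cat /=.
have -> : neval f (word_letter k G) =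
    neval f (Var counter < 5)%nexp * neval f (header_letter G)
    + neval f (5 <= Var counter)%nexp * neval f (entry_letter k G) by [].
rewrite neval_lt neval_le neval_Cst neval_Cell f_counter.
case: (ltnP x 5) => x5; first by rewrite mul0n addn0 mul1n neval_header_letter.
by rewrite mul0n add0n mul1n neval_entry_letter // x5.
Qed.

End Evaluation.

End InstanceWord.

(** * Calibration of the radius *)

Local Notation zero := 30.

Section Oracle.
Variable R : realType.
Implicit Types (P : prog R) (s t : state R) (w : seq nat).

Definition answers P w (T : nat) (yes no : Prop) : Prop :=
  runs P (init_state R w) T (fun s => (yes -> accepting s) /\ (no -> ~ accepting s)).

Definition same_outside_column (J j : nat) (arrays : seq nat) s t : Prop :=
  forall b i, ~~ scratch_from 0 b -> b \notin arrays -> (odd b -> i %% J != j) ->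
    nats t b i = nats s b i.

Lemma fill_word_runs a eb e w s V : program_array a -> fill_ok a eb (Var counter) e ->
  neval (nats s) eb = size w -> size w <= V -> bounded V s ->
  (forall j, j < size w -> neval (env s j) e = nth 0 w j) -> (forall j, nth 0 w j <= V) ->
  (forall i, size w <= i -> nats s a i = 0) ->
  runs (fill R a eb (Var counter) e) s (fill_cost eb (Var counter) e V)
    (fun t => [/\ same_outside [:: a; counter; limit] s t,
       forall i, nats t a i = nth 0 w i & bounded V t]).
Proof.
move=> oa ok ebE wV bs eE w_le rest.
apply: runs_post (fill_runs ok ebE wV bs _) _ => [_ j jw|t [_ nt at_ bt]]; first by rewrite eE.
split=> // i; rewrite at_ written_id; last by move=> j; exact: neval_counter.
by case: ltnP => iw; [rewrite eE|rewrite rest // nth_default].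
Qed.

Definition test (a : nat) : prog R :=
  IfNLe (Indirect 1 slot) (Direct zero) (NConst (Direct a) 0) (NConst (Direct a) 1).

Lemma test_runs a s j v : nats s slot 0 = j -> nats s 1 j = v -> nats s zero 0 = 0 ->
  runs (test a) s (bits j + bits v + 4) (fun t => t = nset s (Direct a) (v != 0)).
Proof.
move=> s_slot s_v s_zero.
have answer : nget s (Indirect 1 slot) = v by rewrite nget_indirect s_slot.
have -> : bits j + bits v + 4 = nread_cost s (Indirect 1 slot) + nread_cost s (Direct zero) + 2.
  rewrite /nread_cost answer nget_direct s_zero addr_cost_direct addr_cost_indirect s_slot bits0.
  by lia.
apply: runs_ifn; rewrite answer nget_direct s_zero leqn0.
by case: eqP => _; apply: runs_nconst; rewrite ?addr_cost_direct ?bits0 ?bits1.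
Qed.

Section Ask.
Local Arguments neval : simpl never.
Variables (k : nat) (G : forms int) (P : prog R).
Hypotheses (nforms_gt0 : 0 < nforms G) (P_discrete : discrete P).

Definition write_index : nexp := (Var counter * Var stride + Var slot)%nexp.

Definition writer : prog R := fill R 1 (word_length G) write_index (word_letter k G).

Definition writer_cost : nat -> nat := fill_cost (word_length G) write_index (word_letter k G).

Definition ask (a : nat) : prog R := Seq writer (Seq (sim_prog P) (test a)).

Definition ask_cost V : nat := writer_cost V + 14 * V.+1 + 2 * V + 7.

Lemma is_poly_ask_cost : is_poly ask_cost.
Proof.
have : is_poly writer_cost by exact: is_poly_fill_cost.
by rewrite /ask_cost; auto 10 with poly.
Qed.

Variables (n : nat) (psi : formula k n) (V J j r : nat).
Hypotheses (j_lt_J : j < J) (size_leV : cvp_word_size G psi <= V).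

Definition ready s : Prop :=
  [/\ holds_formula psi (nats s), holds_flags psi (nats s),
      [/\ nats s slot 0 = j, nats s stride 0 = J, nats s radius 0 = r & nats s zero 0 = 0],
      bounded V s & forall a i, odd a -> i %% J = j -> nats s a i = 0].

Lemma neval_write_index s x : nats s slot 0 = j -> nats s stride 0 = J ->
  neval (env s x) write_index = x * J + j.
Proof. by move=> sj sJ; rewrite !nevalE /env /update /= sj sJ. Qed.

Lemma column_write_index x : (x * J + j) %% J = j.
Proof. by rewrite modnMDl modn_small. Qed.

Lemma written_word s x : ready s -> written (nats s 1) (fun y => neval (env s y) write_index)
    (fun y => neval (env s y) (word_letter k G)) (cvp_word_size G psi) (x * J + j) =
  nth 0 (cvp_word G psi r) x.
Proof.
move=> [s_psi s_flags [sj sJ sr _] _ fresh]; have J0 := leq_ltn_trans (leq0n j) j_lt_J.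
have idxE y : neval (env s y) write_index = y * J + j by exact: neval_write_index.
have idx_inj y : (y * J + j == x * J + j) = (y == x) by rewrite eqn_add2r eqn_pmul2r.
have [x_lt|x_ge] := ltnP x (cvp_word_size G psi).
  rewrite -{1}idxE written_in //.
    by apply: neval_word_letter => //; rewrite /env /update /=.
  by move=> y z _ _; rewrite !idxE => /addIn /eqP; rewrite eqn_pmul2r // => /eqP.
rewrite written_notin; last first.
  by move=> y y_lt; rewrite idxE idx_inj ltn_eqF // (leq_trans y_lt).
by rewrite fresh ?column_write_index // nth_default // size_cvp_word.
Qed.

Lemma writer_runs s : ready s -> runs writer s (writer_cost V) (fun t =>
  [/\ same_outside_column J j [:: counter; limit] s t, bounded V t
    & sim J j (init_state R (cvp_word G psi r)) t]).
Proof.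
move=> s_ready; have [s_psi _ [sj sJ _ _] bs fresh] := s_ready.
have b_avoid b : b \in [:: 1; limit] -> avoids b (word_letter k G).
  by rewrite !inE => /orP[]/eqP ->; exact: word_letter_avoids.
have /andP[wf_letter reads1] := b_avoid 1 isT; have /andP[_ reads_limit] := b_avoid limit isT.
have ok : fill_ok 1 (word_length G) write_index (word_letter k G).
  by rewrite /fill_ok wf_letter reads1 reads_limit.
apply: runs_post (fill_runs ok (neval_word_length G s_psi) size_leV bs _) _ => // t [_ nt wt bt].
split=> //.
  move=> b i nb bl bi; have [b1|b1] := eqVneq b 1; last by apply: nt; rewrite // inE negb_or b1.
  rewrite b1 wt written_notin // => x _; rewrite neval_write_index //.
  by apply/eqP => xi; have := bi; rewrite b1 -xi column_write_index eqxx => /(_ isT).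
split; [|by rewrite nt|by rewrite nt].
case=> [|a] i; first by rewrite [LHS]wt written_word.
have odd_a : odd a.+1.*2.+1 by rewrite oddS odd_double.
rewrite nt ?odd_scratch ?fresh ?column_write_index //.
by rewrite !inE !negb_or; apply/and3P; split=> //; apply: contraTneq odd_a => ->.
Qed.

Lemma ask_runs a s T yes no : ready s -> program_array a || (a == 0) ->
  answers P (cvp_word G psi r) T yes no -> n + j <= V -> J <= V ->
  runs (ask a) s (ask_cost V * T.+1) (fun t =>
    [/\ same_outside_column J j [:: a; counter; limit] s t, bounded V t
      & exists v : bool, [/\ nats t a 0 = v, yes -> v & no -> ~~ v]]).
Proof.
move=> s_ready oa [N [st [exP NT [st_yes st_no]]]] njV JV.
have [_ _ [sj _ _ s_zero] _ _] := s_ready.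
apply: (@runs_leq _ _ _ (writer_cost V + (14 * bits J * T + (2 * V + T + 6)))).
  have := bits_leqS J; rewrite /ask_cost; move: (writer_cost V) (bits J) => W b bJ.
  have : 14 * b * T <= 14 * V.+1 * T by rewrite leq_mul2r leq_mul2l (leq_trans bJ) ?orbT.
  by nia.
apply: runs_seq (writer_runs s_ready) _ => s1 [s_s1 b1 sim1].
have [N2 [s2 [ex2 N2T [sim2 frame2]]]] := sim_exec j_lt_J exP P_discrete sim1.
have s_s2 : same_outside_column J j [:: counter; limit] s s2.
  by move=> b i nb bl bi; rewrite frame2 // s_s1.
apply: (@runs_seq _ _ _ _ _ _ (eq s2)).
  exists N2, s2; split=> //; apply: leq_trans N2T _.
  by rewrite leq_mul2l NT orbT.
move=> _ <-; have answer : nats s2 1 j = nats st 0 0 by case: sim2 => /(_ 0 0).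
have test2 : runs (test a) s2 (bits j + bits (nats st 0 0) + 4)
    (fun t => t = nset s2 (Direct a) (nats st 0 0 != 0)).
  by apply: test_runs => //; rewrite s_s2.
apply: runs_leq (runs_post test2 _) => [|_ ->].
  have := bits_exec exP 0 0; have := bits_leqS j; have := bits_leqS n; rewrite /=; lia.
split.
- move=> b i nb; rewrite !inE negb_or => /andP[ba bl] bi; rewrite /= /update xpair_eqE (negbTE ba).
  by apply: s_s2; rewrite ?inE.
- move=> b i ob; rewrite /= /update; case: eqP => [_|_]; first by case: (_ != 0); lia.
  by rewrite frame2 ?b1 ?program_scratch //; case/andP: ob => /negbTE ->.
exists (nats st 0 0 != 0); split; first by rewrite nats_nset_direct.
- by move=> /st_yes /eqP.
- by move=> /st_no not_acc; apply/negP => /eqP.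
Qed.

End Ask.

End Oracle.

Section PositiveFormula.
Variables (k n : nat) (phi : formula k n).

Definition positive : formula k n :=
  [seq [tuple of [seq (l.1, true) | l <- C]] | C : k.-tuple (literal n) <- phi].

Lemma size_positive : size positive = size phi.
Proof. exact: size_map. Qed.

Lemma codes_positive : codes positive = [seq c./2.*2.+1 | c <- codes phi].
Proof.
rewrite /codes /positive map_flatten -!map_comp; congr flatten; apply: eq_map => C /=.
rewrite -!map_comp; apply: eq_map => l /=.
by rewrite half_enc_literal /enc_literal /= addn1.
Qed.

Lemma occurs_positive j : occurs positive j = occurs phi j.
Proof.
rewrite /occurs codes_positive has_map; apply: eq_has => c /=.
by rewrite uphalf_double.
Qed.

Lemma all_sat_positive : 0 < k -> all (sat_clause [ffun=> true]) positive.
Proof.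
move=> k0; apply/allP => _ /mapP[C _ ->]; apply/hasP.
exists ((tnth C (Ordinal k0)).1, true); last by rewrite ffunE.
by apply: map_f; exact: mem_tnth.
Qed.

Lemma size_enc_formula : size (enc_formula phi) = 2 + k * size phi.
Proof. by rewrite /= -/(codes phi) size_codes mulnC. Qed.

Lemma nth_enc_positive x : x < 2 + k * size phi -> nth 0 (enc_formula positive) x =
  (x < 2) * nth 0 (enc_formula phi) x + (2 <= x) * (2 * (nth 0 (enc_formula phi) x)./2 + 1).
Proof.
case: x => [|[|x]]; rewrite /= ?mul1n ?mul0n ?addn0 ?size_positive // => x_lt.
rewrite -/(codes positive) -/(codes phi) codes_positive add0n mul2n addn1.
by rewrite (nth_map 0) // size_codes mulnC.
Qed.

End PositiveFormula.

Local Notation found := 14.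
Local Notation one := 16.
Local Notation saved := 24.

Section Query.
Variables (R : realType) (k : nat) (G : forms int) (P : prog R).
Hypotheses (nforms_gt0 : 0 < nforms G) (P_discrete : discrete P).
Implicit Types (er ej : nexp) (s t : state R).

Definition query er ej (a : nat) : prog R :=
  Seq (set_var R radius er) (Seq (set_var R slot ej) (ask k G P a)).

Definition query_cost er ej V : nat :=
  set_var_cost er V + set_var_cost ej V + ask_cost k G V.

Lemma is_poly_query_cost er ej : is_poly (query_cost er ej).
Proof.
by have := is_poly_ask_cost k G; rewrite /query_cost /set_var_cost; auto 10 with poly.
Qed.

Lemma query_runs n (psi : formula k n) er ej a s V J j r T yes no :
  [&& nwf er, nwf ej & ~~ nreads radius ej] -> program_array a -> a \notin [:: slot; radius] ->
  holds_formula psi (nats s) -> holds_flags psi (nats s) -> nats s stride 0 = J ->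
  nats s zero 0 = 0 -> bounded V s -> (forall b i, odd b -> i %% J = j -> nats s b i = 0) ->
  neval (nats s) er = r -> neval (nats s) ej = j ->
  [/\ j < J, r <= V, n + J <= V & cvp_word_size G psi <= V] ->
  answers P (cvp_word G psi r) T yes no ->
  runs (query er ej a) s (query_cost er ej V * T.+1) (fun t =>
    [/\ same_outside_column J j [:: a; counter; limit; slot; radius] s t, nats t slot 0 = j,
        bounded V t & exists v : bool, [/\ nats t a 0 = v, yes -> v & no -> ~~ v]]).
Proof.
move=> /and3P[wr wj rj] oa a_new s_psi s_flags sJ s_zero bs fresh erE ejE [jJ rV nJV wV] ans.
have jV : j <= V by rewrite ltnW // (leq_trans jJ) // (leq_trans _ nJV) ?leq_addl.
apply: (@runs_leq _ _ _ (set_var_cost er V + (set_var_cost ej V + ask_cost k G V * T.+1))).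
  rewrite /query_cost; move: (set_var_cost er V) (set_var_cost ej V) (ask_cost k G V) => c1 c2 c3.
  by nia.
apply: runs_seq (set_var_runs wr _ bs erE rV) _ => // s1 [ss1 b1].
have ejE1 : neval (nats s1) ej = j.
  rewrite -ejE; apply: eq_neval => // b i ob rb; apply: (assigned_other ss1).
    exact: program_scratch.
  by apply: contraTneq rb => ->.
apply: runs_seq (set_var_runs wj _ b1 ejE1 jV) _ => // s2 [s1s2 b2].
have keep : same_outside [:: slot; radius] s s2.
  move=> b i nb; rewrite !inE negb_or => /andP[b_slot b_radius].
  by rewrite (assigned_other s1s2) // (assigned_other ss1).
have odd_keep b i : odd b -> nats s2 b i = nats s b i.
  move=> ob; apply: keep; first exact: odd_scratch.
  by rewrite !inE negb_or; apply/andP; split; apply: contraTneq ob => ->.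
have slot2 : nats s2 slot 0 = j by exact: assigned_eq s1s2.
have radius2 : nats s2 radius 0 = r.
  by rewrite (assigned_other s1s2) //; exact: assigned_eq ss1.
have s2_ready : ready psi V J j r s2.
  split=> //.
  - by move=> x; rewrite keep.
  - by move=> x; rewrite keep.
  - by split; rewrite // keep.
  - by move=> b i ob ij; rewrite odd_keep // fresh.
apply: runs_post (ask_runs nforms_gt0 P_discrete jJ wV s2_ready _ ans _ _) _ => //.
- by rewrite oa.
- by apply: leq_trans nJV; rewrite leq_add2l ltnW.
- by apply: leq_trans nJV; exact: leq_addl.
move=> t [s2t bt v]; split=> //.
  move=> b i nb; rewrite -cat1s -[[:: counter; _; _; _]]/([:: counter; limit] ++ _) catA mem_cat.
  by rewrite negb_or => /andP[b_ask b_var] bi; rewrite s2t // keep.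
rewrite s2t // !inE !negb_or; move: a_new; rewrite !inE negb_or => /andP[a_slot _].
by rewrite eq_sym a_slot.
Qed.

End Query.

Section SatProgramBound.
Variables (k : nat) (G : forms int) (E F K n : nat) (phi : formula k n) (V : nat).
Local Notation m := (size phi).
Local Notation J := (K * m + 2).

Definition sat_prog_bound : nat :=
  2 * (n + m) + 3 + (2 + k * m) + cvp_word_size G phi + J * (E + F + 1).

Hypothesis V_large : sat_prog_bound <= V.

Lemma length_leq : 2 + k * m <= V.
Proof. by have := V_large; rewrite /sat_prog_bound; lia. Qed.

Lemma columns_leq : n + J <= V.
Proof. by have := V_large; rewrite /sat_prog_bound; nia. Qed.

Lemma radius_leq q : q < J -> E * q <= V /\ F * q <= V.
Proof. by have := V_large; rewrite /sat_prog_bound; split; nia. Qed.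

Lemma cvp_word_size_leq : cvp_word_size G phi <= V.
Proof. by have := V_large; rewrite /sat_prog_bound; lia. Qed.

Lemma cvp_word_size_positive : cvp_word_size G (positive phi) = cvp_word_size G phi.
Proof. by rewrite /cvp_word_size size_positive. Qed.

Lemma enc_formula_ltn y : nth 0 (enc_formula phi) y < V.
Proof.
by have := enc_formula_leq phi y; have := V_large; rewrite /sat_prog_bound; lia.
Qed.

Lemma nth_positive_leq j : nth 0 (enc_formula (positive phi)) j <= V.
Proof.
have := enc_formula_leq (positive phi) j; rewrite size_positive.
by have := V_large; rewrite /sat_prog_bound; lia.
Qed.

End SatProgramBound.

Section SatProgram.
Local Arguments neval : simpl never.
Variables (R : realType) (k : nat) (G : forms int) (P : prog R) (E F K : nat).
Local Notation x := (Var counter).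

Definition formula_length : nexp := (2 + k * num_clauses)%nexp.

Definition saved_letter : nexp := Cell saved x.

Definition positive_letter : nexp :=
  ((x < 2) * saved_letter + (2 <= x) * (2 * halfE saved_letter + 1))%nexp.

Definition num_columns : nexp := (K * num_clauses + 2)%nexp.

(* Each query works in a column of its own, as the machine of the algorithm expects
   its memory to be clear; the final query uses column 0. *)
Definition prepare : prog R :=
  Seq (flag_prog R k)
  (Seq (fill R saved formula_length x (Cell 0 x))
  (Seq (fill R 0 formula_length x positive_letter)
  (Seq (set_var R stride num_columns) (set_var R one 1)))).

Definition try_next_radius : prog R :=
  query k G P (E * (Var slot + 1))%nexp (Var slot + 1)%nexp found.

Definition finish : prog R :=
  Seq (fill R 0 formula_length x saved_letter) (query k G P (F * Var slot)%nexp 0 0).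

Definition sat_prog : prog R :=
  Seq prepare (Seq (WhileNLt (Direct found) (Direct one) try_next_radius) finish).

Definition prepare_cost V : nat :=
  flag_cost k V + (fill_cost formula_length x (Cell 0 x) V
  + (fill_cost formula_length x positive_letter V
  + (set_var_cost num_columns V + set_var_cost 1 V))).

Definition try_cost : nat -> nat :=
  query_cost k G (E * (Var slot + 1))%nexp (Var slot + 1)%nexp.

Definition finish_cost V : nat :=
  fill_cost formula_length x saved_letter V + query_cost k G (F * Var slot)%nexp 0 V.

Definition sat_prog_cost V : nat :=
  prepare_cost V + (V * (try_cost V + 4) + 4 + finish_cost V).

Lemma is_poly_sat_prog_cost : is_poly sat_prog_cost.
Proof.
have query_poly := is_poly_query_cost k G.
by rewrite /sat_prog_cost /prepare_cost /try_cost /finish_cost /set_var_cost; auto 20 with poly.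
Qed.

Lemma discrete_sat_prog : discrete sat_prog.
Proof. by rewrite /= !discrete_ncompile ?discrete_sim_prog. Qed.

Hypotheses (nforms_gt0 : 0 < nforms G) (P_discrete : discrete P) (E_gt0 : 0 < E).
Variables (n : nat) (phi : formula k n) (V T : nat).
Local Notation m := (size phi).
Local Notation J := (K * m + 2).

Hypothesis V_large : sat_prog_bound G E F K phi <= V.

Variables (D D' gamma : R).
Hypothesis D'_le : (D' <= (K * m)%:R)%R.
Hypothesis positive_answers : forall q, 0 < q < J ->
  answers P (cvp_word G (positive phi) (E * q)) T
    (D' <= (E * q)%:R)%R (gamma * (E * q)%:R < D')%R.
Hypothesis final_answers : forall q, 0 < q < J ->
  answers P (cvp_word G phi (F * q)) T (D <= (F * q)%:R)%R (gamma * (F * q)%:R < D)%R.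

Definition holds_saved (s : state R) : Prop := forall y, nats s saved y = nth 0 (enc_formula phi) y.

Definition calibrating (j : nat) (s : state R) : Prop :=
  [/\ holds_formula (positive phi) (nats s), holds_flags phi (nats s), holds_saved s,
      [/\ nats s slot 0 = j, nats s stride 0 = J, nats s one 0 = 1, nats s zero 0 = 0
        & bounded V s]
    & forall a i, odd a -> i %% J = 0 \/ j < i %% J -> nats s a i = 0].

Definition calibrated (q : nat) : Prop :=
  [/\ 0 < q < J, ((E * q.-1)%:R <= D')%R & (D' <= gamma * (E * q)%:R)%R].

Lemma neval_formula_length (psi : formula k n) f : holds_formula psi f ->
  neval f formula_length = 2 + k * size psi.
Proof. by move=> f_psi; rewrite !(neval_num_clauses f_psi, nevalE). Qed.

Lemma neval_saved_letter (s : state R) j : neval (env s j) saved_letter = nats s saved j.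
Proof. by rewrite neval_Cell neval_counter. Qed.

Lemma neval_positive_letter (s : state R) j : holds_saved s -> j < 2 + k * m ->
  neval (env s j) positive_letter = nth 0 (enc_formula (positive phi)) j.
Proof.
move=> s_saved j_lt; rewrite nth_enc_positive // -s_saved -neval_saved_letter.
have -> : neval (env s j) positive_letter =
    neval (env s j) (x < 2)%nexp * neval (env s j) saved_letter +
    neval (env s j) (2 <= x)%nexp * (2 * neval (env s j) (halfE saved_letter) + 1) by [].
by rewrite neval_lt neval_le neval_half neval_counter neval_Cst.
Qed.

Lemma save_runs s : holds_formula phi (nats s) -> bounded V s ->
  (forall i, nats s saved i = 0) ->
  runs (fill R saved formula_length x (Cell 0 x)) s
    (fill_cost formula_length x (Cell 0 x) V)
    (fun t => [/\ same_outside [:: saved; counter; limit] s t, holds_saved t & bounded V t]).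
Proof.
move=> s_phi bs rest; rewrite /holds_saved.
apply: fill_word_runs;
  rewrite ?size_enc_formula ?(neval_formula_length s_phi) ?(length_leq V_large) //.
- by move=> j _; rewrite neval_Cell neval_counter /env /update /= s_phi.
- by move=> j; exact: ltnW (enc_formula_ltn V_large j).
Qed.

Lemma make_positive_runs s : holds_formula phi (nats s) -> holds_saved s -> bounded V s ->
  runs (fill R 0 formula_length x positive_letter) s
    (fill_cost formula_length x positive_letter V)
    (fun t => [/\ same_outside [:: 0; counter; limit] s t,
       holds_formula (positive phi) (nats t) & bounded V t]).
Proof.
move=> s_phi s_saved bs; have sizeE := size_enc_formula (positive phi).
apply: fill_word_runs;
  rewrite ?sizeE ?size_positive ?(neval_formula_length s_phi) ?(length_leq V_large) //.
- by move=> j j_lt; exact: neval_positive_letter.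
- exact: nth_positive_leq V_large.
- by move=> i i_ge; rewrite s_phi nth_default // size_enc_formula.
Qed.

Lemma restore_runs s : holds_formula (positive phi) (nats s) -> holds_saved s -> bounded V s ->
  runs (fill R 0 formula_length x saved_letter) s (fill_cost formula_length x saved_letter V)
    (fun t => [/\ same_outside [:: 0; counter; limit] s t, holds_formula phi (nats t)
      & bounded V t]).
Proof.
move=> s_pos s_saved bs; have sizeE := size_enc_formula (positive phi).
apply: fill_word_runs;
  rewrite ?size_enc_formula ?(neval_formula_length s_pos) ?size_positive ?(length_leq V_large) //.
- by move=> j _; rewrite neval_saved_letter s_saved.
- by move=> j; exact: ltnW (enc_formula_ltn V_large j).
- by move=> i i_ge; rewrite s_pos nth_default // sizeE size_positive.
Qed.

Lemma set_constants_runs s : holds_formula (positive phi) (nats s) -> bounded V s ->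
  runs (Seq (set_var R stride num_columns) (set_var R one 1)) s
    (set_var_cost num_columns V + set_var_cost 1 V)
    (fun t => [/\ same_outside [:: stride; one] s t, nats t stride 0 = J, nats t one 0 = 1
      & bounded V t]).
Proof.
move=> s_pos bs; have JV : J <= V := leq_trans (leq_addl _ _) (columns_leq V_large).
have columnsE : neval (nats s) num_columns = J.
  by rewrite !(neval_num_clauses s_pos, nevalE) size_positive.
apply: runs_seq (set_var_runs _ _ bs columnsE JV) _ => // s1 [ss1 b1].
have V1 : 0 < V by apply: leq_trans JV; rewrite addn2.
apply: runs_post (set_var_runs _ _ b1 (erefl : neval (nats s1) 1 = 1) V1) _ => // t [s1t bt].
split=> //; last exact: assigned_eq s1t.
  move=> b i nb; rewrite !inE negb_or => /andP[b_stride b_one].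
  by rewrite (assigned_other s1t) // (assigned_other ss1).
by rewrite (assigned_other s1t) //; exact: assigned_eq ss1.
Qed.

Lemma prepare_runs : runs prepare (init_state R (enc_formula phi)) (prepare_cost V)
  (fun s => calibrating 0 s /\ nats s found 0 = 0).
Proof.
set s := init_state _ _; have b0 : bounded V s.
  by apply: bounded_init_state; have := V_large; rewrite /sat_prog_bound; lia.
have V0 : 0 < V := leq_trans (ltn0Sn _) (length_leq V_large).
have kV : k * m <= V := leq_trans (leq_addl _ _) (length_leq V_large).
apply: runs_seq (flag_runs _ _ b0 V0 kV) _ => // s1 [n1 flags1 b1].
have phi1 : holds_formula phi (nats s1) by move=> y; rewrite n1.
apply: runs_seq (save_runs phi1 b1 _) _ => [i|s2 [n2 saved2 b2]]; first by rewrite n1.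
have phi2 : holds_formula phi (nats s2) by move=> y; rewrite n2.
apply: runs_seq (make_positive_runs phi2 saved2 b2) _ => s3 [n3 pos3 b3].
apply: runs_post (set_constants_runs pos3 b3) _ => t [nt stride_t one_t bt].
have untouched b i : ~~ scratch_from 0 b ->
    b \notin [:: 0; flags; counter; limit; stride; one; saved] -> nats t b i = 0.
  move=> nb; rewrite !inE !negb_or => /and5P[ne0 ne2 ne4 ne6 /and3P[ne10 ne16 ne24]].
  rewrite nt ?n3 ?n2 ?n1 // ?inE ?negb_or ?ne0 ?ne2 ?ne4 ?ne6 ?ne10 ?ne16 ?ne24 //.
  by rewrite /s /= (negbTE ne0).
split; last exact: untouched.
split.
- by move=> y; rewrite nt.
- by move=> y; rewrite nt // n3 // n2.
- by move=> y; rewrite nt // n3.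
- by split=> //; exact: untouched.
move=> a i oa _; apply: untouched; first exact: odd_scratch.
by rewrite !inE !negb_or; do !(apply/andP; split); apply: contraTneq oa => ->.
Qed.

Lemma try_runs j s : calibrating j s -> j.+1 < J ->
  runs try_next_radius s (try_cost V * T.+1) (fun t => calibrating j.+1 t /\
    exists v : bool, [/\ nats t found 0 = v, (D' <= (E * j.+1)%:R)%R -> v
      & (gamma * (E * j.+1)%:R < D')%R -> ~~ v]).
Proof.
move=> [s_pos s_flags s_saved [s_slot sJ s_one s_zero bs] fresh] jJ.
have slotE : neval (nats s) (Var slot + 1)%nexp = j.+1 by rewrite !nevalE s_slot /= addn1.
have radiusE : neval (nats s) (E * (Var slot + 1))%nexp = E * j.+1.
  by rewrite neval_Bin slotE.
apply: runs_post (query_runs nforms_gt0 P_discrete _ _ _ s_pos _ sJ s_zero bs _ radiusE slotE _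
  (positive_answers (jJ : 0 < j.+1 < J))) _ => //.
- by move=> y; rewrite occurs_positive s_flags.
- by move=> b i ob ij; apply: fresh => //; right; rewrite ij.
- rewrite cvp_word_size_positive (cvp_word_size_leq V_large) (columns_leq V_large).
  by rewrite (radius_leq V_large jJ).1.
move=> t [st t_slot bt v]; split=> //.
split.
- by move=> y; rewrite st.
- by move=> y; rewrite st.
- by move=> y; rewrite st.
- by split=> //; rewrite st.
move=> a i oa ij; have j_ne : i %% J != j.+1 by case: ij => [->|ij] //; rewrite gtn_eqF.
rewrite st ?odd_scratch //.
  by apply: fresh => //; case: ij => [|/ltnW]; [left|right].
by rewrite !inE !negb_or; do !(apply/andP; split); apply: contraTneq oa => ->.
Qed.

Definition loop_invariant (i : nat) (s : state R) : Prop := exists j,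
  [/\ i + j = (K * m).+1, calibrating j s
  & (nats s found 0 = 0 /\ ((E * j)%:R <= D')%R) \/ (nats s found 0 = 1 /\ calibrated j)].

Lemma loop_runs s : calibrating 0 s -> nats s found 0 = 0 -> (0 <= D')%R ->
  runs (WhileNLt (Direct found) (Direct one) try_next_radius) s
    ((K * m).+1 * (try_cost V * T.+1 + 4) + 4)
    (fun t => exists2 q, calibrating q t & calibrated q).
Proof.
move=> s_cal s_found D'0.
have start : loop_invariant (K * m).+1 s.
  by exists 0; rewrite addn0; split=> //; left; rewrite muln0.
have guard i t : loop_invariant i t ->
    nread_cost t (Direct found) + nread_cost t (Direct one) <= 4.
  move=> [j [_ [_ _ _ [_ _ t_one _ _] _] t_found]].
  rewrite /nread_cost !nget_direct !addr_cost_direct t_one bits1.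
  by case: t_found => -[-> _]; rewrite ?bits0 ?bits1.
have stop t : loop_invariant 0 t -> nget t (Direct one) <= nget t (Direct found).
  move=> [j [jE [_ _ _ [_ _ t_one _ _] _] t_found]].
  rewrite !nget_direct t_one; case: t_found => -[-> //] ED; exfalso.
  have := le_trans ED D'_le; rewrite ler_nat -[j]add0n jE leqNgt.
  by rewrite (leq_trans (ltnSn _)) // leq_pmull.
have step i t : loop_invariant i.+1 t -> nget t (Direct found) < nget t (Direct one) ->
    runs try_next_radius t (try_cost V * T.+1) (loop_invariant i).
  move=> [j [jE t_cal t_found]]; have [_ _ _ [_ _ t_one _ _] _] := t_cal.
  rewrite !nget_direct t_one; case: t_found => -[-> //] ED _.
  have jJ : j.+1 < J by lia.
  apply: runs_post (try_runs t_cal jJ) _ => t1 [t1_cal [v [t1_found yes no]]].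
  exists j.+1; split=> //; first by rewrite addnS -addSn.
  case: v t1_found yes no => t1_found yes no; [right|left]; split=> //.
    by split=> //; rewrite leNgt; apply/negP => /no.
  by apply: ltW; rewrite ltNge; apply/negP => /yes.
apply: runs_post (runs_while guard step stop start) _ => t [i [j [_ t_cal t_found]]].
have [_ _ _ [_ _ t_one _ _] _] := t_cal; rewrite !nget_direct t_one.
by case: t_found => -[-> //] j_cal _; exists j.
Qed.

Lemma finish_runs q s : calibrating q s -> calibrated q ->
  runs finish s (finish_cost V * T.+1) (fun t =>
    ((D <= (F * q)%:R)%R -> accepting t) /\ ((gamma * (F * q)%:R < D)%R -> ~ accepting t)).
Proof.
move=> [s_pos s_flags s_saved [s_slot sJ _ s_zero bs] fresh] [qJ _ _].
apply: (@runs_leq _ _ _ (fill_cost formula_length x saved_letter V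
  + query_cost k G (F * Var slot)%nexp 0 V * T.+1)).
  by rewrite /finish_cost mulnDl leq_add2r leq_pmulr.
apply: runs_seq (restore_runs s_pos s_saved bs) _ => s1 [n1 phi1 b1].
have radiusE : neval (nats s1) (F * Var slot)%nexp = F * q by rewrite !nevalE n1 // s_slot.
have J0 : 0 < J by rewrite addn2.
have odd1 a i : odd a -> nats s1 a i = nats s a i.
  move=> oa; rewrite n1 ?odd_scratch // !inE !negb_or.
  by apply/and3P; split; apply: contraTneq oa => ->.
have stride1 : nats s1 stride 0 = J by rewrite n1.
apply: runs_post (query_runs nforms_gt0 P_discrete _ _ _ phi1 _ stride1 _ b1 _ radiusE
  (erefl : neval (nats s1) 0 = 0) _ (final_answers qJ)) _ => //.
- by move=> y; rewrite n1.
- by rewrite n1.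
- by move=> a i oa i0; rewrite odd1 // fresh //; left.
- rewrite (cvp_word_size_leq V_large) (columns_leq V_large).
  by case/andP: qJ => _ /(radius_leq V_large)[].
move=> t [_ _ _ [v [t_v yes no]]]; rewrite /accepting t_v.
by split=> [/yes ->|/no /negbTE ->].
Qed.

Lemma sat_prog_runs : (0 <= D')%R ->
  runs sat_prog (init_state R (enc_formula phi)) (sat_prog_cost V * T.+1) (fun t =>
    exists q, [/\ calibrated q, (D <= (F * q)%:R)%R -> accepting t
      & (gamma * (F * q)%:R < D)%R -> ~ accepting t]).
Proof.
move=> D'0.
apply: (@runs_leq _ _ _ (prepare_cost V
  + ((K * m).+1 * (try_cost V * T.+1 + 4) + 4 + finish_cost V * T.+1))).
  have KV : (K * m).+1 <= V by have := columns_leq V_large; lia.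
  rewrite /sat_prog_cost; move: (prepare_cost V) (try_cost V) (finish_cost V) => c1 c2 c3.
  have : (K * m).+1 * (c2 * T.+1 + 4) <= V * ((c2 + 4) * T.+1) by apply: leq_mul => //; nia.
  by rewrite mulnA; move: (V * (c2 + 4)) (_.+1 * (_ + 4)) => c4 c5; nia.
apply: runs_seq prepare_runs _ => s1 [cal1 found1].
apply: runs_seq (loop_runs cal1 found1 D'0) _ => s2 [q cal2 q_cal].
by apply: runs_post (finish_runs cal2 q_cal) _ => t [yes no]; exists q.
Qed.

End SatProgram.

Local Open Scope classical_set_scope.
Local Open Scope ring_scope.

(** * The Karp reduction *)

Section ApproximationRatio.
Variable R : realType.
Implicit Types (p u rho c s C : R) (k : nat).

Lemma powRV_1Dx_ge p u : 0 < p -> 0 <= u -> 1 + u / (1 + u) / p <= (1 + u) `^ p^-1.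
Proof.
move=> p0 u0; have u1 : 0 < 1 + u by lra.
have ln_ge : u / (1 + u) <= ln (1 + u).
  have inv0 : 0 < (1 + u)^-1 by rewrite invr_gt0.
  have := @le_ln1Dx R ((1 + u)^-1 - 1); rewrite subrKC lnV ?posrE //.
  have -> : u / (1 + u) = 1 - (1 + u)^-1 by field; lra.
  by move=> /(_ _) ln_le; have := ln_le; lra.
apply: (@le_trans _ _ (1 + ln (1 + u) / p)).
  by rewrite lerD2l ler_pM2r ?invr_gt0.
by apply: le_trans (expR_ge1Dx _) _; rewrite /powR gt_eqF // [p^-1 * _]mulrC.
Qed.

Lemma ratio_powRV_ge p rho c s C k :
  1 <= p -> (2 < k)%N -> 0 <= rho <= 1 -> 1 - 2 ^- k < s -> s <= c -> c <= 1 ->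
  1 <= C <= 1 + k%:R ->
  1 + 2 ^+ (k - 1) / (2 ^+ k - 1) * (c - s) * (rho / (p * k%:R))
  <= ((C + rho * (1 - s)) / (C + rho * (1 - c))) `^ p^-1.
Proof.
move=> p1 k3 /andP[rho0 rho1] s_gt sc c1 /andP[C1 Ck].
have kR : 3 <= k%:R :> R by rewrite ler_nat.
have pow8 : 8 <= 2 ^+ k :> R.
  have -> : 8 = 2 ^+ 3 :> R by ring.
  by apply: ler_weXn2l => //; lra.
have powE : 2 ^+ k = 2 * 2 ^+ (k - 1) :> R by rewrite -exprS subn1 prednK // (ltn_trans _ k3).
have inv8 : 2 ^- k <= 8^-1 :> R by rewrite lef_pV2 ?posrE //; lra.
have scaled x : 0 <= x <= 8^-1 -> 0 <= rho * x <= 8^-1.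
  move=> /andP[x0 x8]; rewrite mulr_ge0 //; apply: le_trans x8.
  by rewrite ler_piMl.
have /andP[rho_c0 rho_c8] : 0 <= rho * (1 - c) <= 8^-1 by apply: scaled; lra.
have /andP[rho_cs0 rho_cs8] : 0 <= rho * (c - s) <= 8^-1 by apply: scaled; lra.
set D := C + rho * (1 - c); pose u := rho * (c - s) / D.
have D1 : 1 <= D by rewrite /D; lra.
have Dk : D <= 14 / 9 * k%:R by rewrite /D; lra.
have -> : (C + rho * (1 - s)) / D = 1 + u by rewrite /u /D; field; rewrite -/D; lra.
have u0 : 0 <= u by rewrite /u divr_ge0; lra.
have u8 : u <= 8^-1 by rewrite /u ler_pdivrMr; lra.
apply: le_trans (powRV_1Dx_ge _ u0); last by lra.
have -> : 2 ^+ (k - 1) / (2 ^+ k - 1) * (c - s) * (rho / (p * k%:R)) =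
    rho * (c - s) * (2 ^+ (k - 1) / (2 ^+ k - 1) / k%:R) / p.
  by field; rewrite ?gt_eqF //; lra.
rewrite lerD2l; apply: ler_wpM2r; first by rewrite invr_ge0; lra.
have -> : u / (1 + u) = rho * (c - s) * ((1 + u)^-1 / D) by rewrite /u; ring.
apply: ler_wpM2l => //; apply: (@le_trans _ _ (4 / 7 / k%:R)).
  by rewrite ler_pM2r ?invr_gt0 ?ler_pdivrMr; lra.
apply: (@le_trans _ _ (8 / 9 / D)).
  by rewrite ler_pdivrMr; [rewrite mulrAC ler_pdivlMr; lra|lra].
rewrite ler_pM2r ?invr_gt0; last by lra.
by rewrite -[8 / 9]invrK lef_pV2 ?posrE ?invr_gt0 ?invf_div; lra.
Qed.

Definition karp_ratio p rho k s c : R :=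
  ((sat_cost p rho k + rho * (1 - s)) / (sat_cost p rho k + rho * (1 - c))) `^ p^-1.

Lemma karp_ratio_gadget_gap_ge p c s k : 1 <= p -> (2 < k)%N -> p < k%:R ->
  not_even p -> 1 - 2 ^- k < s -> s <= c -> c <= 1 ->
  1 + (2 ^+ (k - 1)) / (2 ^+ k - 1) * (c - s)
      * (`|sin (pi * p / 2)| / (4 * p ^+ 3 * k%:R))
      * ((2 * p) / ((expR 1) ^+ 2 * pi ^+ 2 * k%:R)) `^ ((p + 1) / 2)
  <= karp_ratio p (gadget_gap p k) k s c.
Proof.
move=> p1 k3 pk p_not_even s_gt sc c1; set rho := gadget_gap p k.
have rho0 : 0 < rho := gadget_gap_gt0 p1 p_not_even pk.
have rho1 : rho <= 1 := gadget_gap_le1 p1 pk.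
apply: (@le_trans _ _ (1 + 2 ^+ (k - 1) / (2 ^+ k - 1) * (c - s) * (rho / (p * k%:R)))).
  rewrite -/(gap_power p k) /rho /gadget_gap le_eqVlt; apply/orP; left; apply/eqP.
  have pow1 : 1 < 2 ^+ k :> R by rewrite exprn_egt1 ?ltr1n //; case: (k) k3.
  by field; rewrite ?gt_eqF //; lra.
apply: ratio_powRV_ge => //; first by rewrite ltW.
by rewrite sat_cost_ge1 sat_cost_le // rho0.
Qed.

End ApproximationRatio.

Lemma mean_cost_exact (R : realType) k n (phi : formula k n) (C rho : R) :
  mean_cost phi C (C + rho) = C + rho * (1 - val_sat R phi).
Proof. by rewrite /mean_cost; ring. Qed.

Section KarpReduction.
Variables (R : realType) (p rho c s : R) (k : nat) (G : forms R).
Hypotheses (p_ge1 : 1 <= p) (k_gt0 : (0 < k)%N) (rho_gt0 : 0 < rho) (s_le_c : s <= c)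
  (c_le1 : c <= 1) (exactG : exact_gadget p k rho G).
Local Notation C := (sat_cost p rho k).
Local Notation G' := (penalise k G (penalty p rho)).
Local Notation yes_cost := (C + rho * (1 - c)).
Local Notation no_cost := (C + rho * (1 - s)).

Let p_gt0 : 0 < p := lt_le_trans ltr01 p_ge1.

Let gadget : clause_gadget p k G' C C (C + rho) (C + rho) :=
  clause_gadget_penalise p_ge1 rho_gt0 exactG.

Lemma yes_cost_gt0 : 0 < yes_cost.
Proof.
have := sat_cost_ge1 p rho k; have : 0 <= rho * (1 - c) by rewrite mulr_ge0 ?subr_ge0 // ltW.
by lra.
Qed.

Lemma karp_reduction_of_gadget :
  karp_reduction_gapsat_cvp k s c p (karp_ratio p rho k s c).
Proof.
have C1 := sat_cost_ge1 p rho k; have yes0 := yes_cost_gt0.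
have no0 : 0 < no_cost by apply: lt_le_trans yes0 _; rewrite lerD2l ler_pM2l // lerD2l lerN2.
have L0 : (0 < nforms G')%N by rewrite addn_gt0 k_gt0 orbT.
have [a time] : is_poly (fun N => reduction_cost k G' yes_cost p^-1 (reduction_bound k G' N)
    + (nforms G' * N + N))%N.
  apply: is_polyD; last by auto with poly.
  exact: is_poly_comp (is_poly_reduction_cost _ _ _ _) (is_poly_reduction_bound _ _).
exists (reduction k G' yes_cost p^-1), a => n phi m_gt0.
have [N [st [ex cost_N out]]] := reduction_runs yes_cost p^-1 L0 phi.
have m0 : 0 < (size phi)%:R :> R by rewrite ltr0n.
exists N, st, (nforms G' * size phi + n)%N, (sat_matrix G' phi), (sat_target G' phi),
  (((size phi)%:R * yes_cost) `^ p^-1); split=> //.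
- apply: leq_trans (time _); apply: leq_add => //.
  by rewrite leq_add ?leq_mul ?leq_addl ?leq_addr.
- split=> //; split; last by rewrite powR_gt0 // mulr_gt0.
  by apply/sat_matrix_row_free/isolates_penalise; rewrite gt_eqF // penalty_gt0.
- rewrite /cvp_yes => c_le; apply: le_trans (dist_sat_le p_gt0 gadget m_gt0) _.
  have v1 := val_sat_le1 R m_gt0.
  apply: le_root => //; rewrite mean_cost_exact.
    by rewrite mulr_ge0 // addr_ge0 ?(le_trans ler01 C1) // mulr_ge0 ?(ltW rho_gt0) // subr_ge0.
  by rewrite ler_pM2l // lerD2l ler_pM2l // lerD2l lerN2.
rewrite /cvp_no => v_lt; have lo_le : 0 <= C <= C + rho by rewrite (le_trans ler01 C1) lerDl ltW.
apply: lt_le_trans (dist_sat_ge p_gt0 gadget m_gt0 lo_le); rewrite /karp_ratio.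
rewrite -powRM ?divr_ge0 ?mulr_ge0 ?ltW // mean_cost_exact.
have -> : no_cost / yes_cost * ((size phi)%:R * yes_cost) = (size phi)%:R * no_cost.
  by field; rewrite gt_eqF.
apply: gt0_ltr_powR; rewrite ?invr_gt0 ?nnegrE ?mulr_ge0 ?(ltW no0) //.
  apply: le_trans (ltW no0) _.
  by rewrite lerD2l ler_pM2l // lerD2l lerN2 ltW.
by rewrite ltr_pM2l // ltrD2l ltr_pM2l // ltrD2l ltrN2.
Qed.

End KarpReduction.

Lemma exists_karp_reduction (R : realType) (p s c : R) k : 1 <= p -> not_even p ->
  Num.max 2 p < k%:R -> 1 - 2 ^- k < s -> s <= c -> c <= 1 ->
  exists gamma : R,
    1 + (2 ^+ (k - 1)) / (2 ^+ k - 1) * (c - s)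
        * (`|sin (pi * p / 2)| / (4 * p ^+ 3 * k%:R))
        * ((2 * p) / ((expR 1) ^+ 2 * pi ^+ 2 * k%:R)) `^ ((p + 1) / 2)
      <= gamma
    /\ karp_reduction_gapsat_cvp k s c p gamma.
Proof.
move=> p1 p_not_even; rewrite gt_max => /andP[k2 pk] s_gt sc c1.
have k3 : (2 < k)%N by rewrite -(ltr_nat R).
have rho0 := gadget_gap_gt0 p1 p_not_even pk.
have p0 : p != 0 by rewrite gt_eqF // (lt_le_trans ltr01).
have [G exactG] := exists_exact_gadget p0 rho0 (fun j => abs_powR_gap p1 p_not_even pk k3).
eexists; split; first exact: karp_ratio_gadget_gap_ge.
apply: karp_reduction_of_gadget exactG => //.
exact: ltn_trans k3.
Qed.

(** * Hardness of the closest vector problem *)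

Section SatFromCvp.
Variables (R : realType) (p gamma eps : R) (k : nat) (G : forms int) (P : prog R) (E F K : nat).
Hypotheses (p_gt0 : 0 < p) (E_gt0 : (0 < E)%N) (F_gt0 : (0 < F)%N) (eps_le1 : eps <= 1).
Hypotheses (nforms_gt0 : (0 < nforms G)%N)
  (G_isolates : isolates_variables k (map_forms intr G : forms R)).
Hypothesis P_algorithm : cvp_algorithm p gamma eps P.

Definition sat_dist n (psi : formula k n) : R :=
  dist p (lattice (sat_matrix (map_forms intr G) psi)) (sat_target (map_forms intr G) psi).

Definition word_size_bound V : nat := (V * (neval_bound (word_letter k G) V).+1)%N.

Lemma is_poly_word_size_bound : is_poly word_size_bound.
Proof. by rewrite /word_size_bound; auto with poly. Qed.

Lemma word_size_cvp_word n (psi : formula k n) V r : (2 * (n + size psi) + 2 <= V)%N ->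
  (cvp_word_size G psi <= V)%N -> (r <= V)%N ->
  (word_size (cvp_word G psi r) <= word_size_bound V)%N.
Proof.
move=> V_ge size_le rV; rewrite /word_size (big_nth 0%N) size_cvp_word.
apply: (@leq_trans (\sum_(0 <= x < cvp_word_size G psi) (neval_bound (word_letter k G) V).+1)%N);
  last by rewrite sum_nat_const_nat subn0 leq_mul2r size_le orbT.
rewrite !big_nat; apply: leq_sum => x /andP[_ x_lt].
apply: leq_trans (bits_leqS _) _; rewrite ltnS.
pose f b i := if b == 0%N then nth 0%N (enc_formula psi) i
  else if b == flags then occurs psi i : nat
  else if b == counter then x else if b == radius then r else 0%N.
rewrite -(@neval_word_letter k n G psi nforms_gt0 f r x) //; apply: neval_leq; last first.
  by have /andP[] := word_letter_avoids k G (b := 1) isT isT isT isT.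
move=> b i _; rewrite /f; case: ifP => _; first exact: leq_trans (enc_formula_leq psi i) V_ge.
case: ifP => _; first by apply: (@leq_trans 1); [case: occurs|lia].
case: ifP => _; first by rewrite ltnW // (leq_trans x_lt).
by case: ifP.
Qed.

Lemma cvp_algorithm_answers : exists2 f, is_poly f & forall n (psi : formula k n) V r,
  (2 * (n + size psi) + 2 <= V)%N -> (cvp_word_size G psi <= V)%N -> (0 < r <= V)%N ->
  answers P (cvp_word G psi r) (Num.truncn (2 `^ ((1 - eps) * n%:R) * (f V)%:R))
    (sat_dist psi <= r%:R) (gamma * r%:R < sat_dist psi).
Proof.
have [_ [a decides]] := P_algorithm.
exists (fun V => poly_bound a (word_size_bound V)).
  by apply: is_poly_comp is_poly_word_size_bound; exact: is_poly_bound.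
move=> n psi V r V_ge size_le /andP[r0 rV].
have ratr_intr : (ratr : rat -> R) \o intr =1 intr by exact: ratr_int.
have := @decides n _ (map_mx (intr : int -> rat) (sat_matrix G psi))
  (map_mx (intr : int -> rat) (sat_target G psi)) r%:R.
rewrite /= -!map_mx_comp !(eq_map_mx _ ratr_intr) ratr_nat map_sat_matrix map_sat_target.
have inst : cvp_instance (sat_matrix (map_forms intr G : forms R) psi)
    (sat_target (map_forms intr G) psi) r%:R.
  by split; [exact: sat_matrix_row_free|rewrite ltr0n].
move=> /(_ inst) [N [st [exP cost_N yes no]]]; exists N, st; split=> //.
rewrite truncn_ge_nat ?mulr_ge0 ?powR_ge0 //; apply: le_trans cost_N _.
rewrite ler_wpM2l ?powR_ge0 // ler_nat leq_poly_bound //.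
exact: word_size_cvp_word.
Qed.

(* Bounds every number handled on formulas with n + m = A. *)
Definition sat_bound A : nat :=
  (2 * A + 3 + (2 + k * A) + (5 + 3 * ((nforms G * A + A) + (nforms G * A + A) * A))
   + (K * A + 2) * (E + F + 1))%N.

Lemma is_poly_sat_bound : is_poly sat_bound.
Proof. by rewrite /sat_bound; auto 30 with poly. Qed.

Lemma sat_prog_bound_leq n (phi : formula k n) :
  (sat_prog_bound G E F K phi <= sat_bound (n + size phi))%N.
Proof.
have mA : (size phi <= n + size phi)%N by exact: leq_addl.
have nA : (n <= n + size phi)%N by exact: leq_addr.
by rewrite /sat_prog_bound /cvp_word_size !leq_add ?leq_mul ?leq_add ?leq_mul.
Qed.

Lemma sat_prog_decides : exists b, forall n (phi : formula k n) (yes no : Prop),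
  (0 < size phi)%N -> sat_dist (positive phi) <= (K * size phi)%:R ->
  (forall q, calibrated E K phi (sat_dist (positive phi)) gamma q ->
     (yes -> sat_dist phi <= (F * q)%:R) /\ (no -> gamma * (F * q)%:R < sat_dist phi)) ->
  decides_within (sat_prog k G P E F K) eps n b (n + size phi) (enc_formula phi) yes no.
Proof.
have [f f_poly oracle] := cvp_algorithm_answers; have P_discrete := P_algorithm.1.
have [b bound_b] : is_poly
    (fun A => sat_prog_cost k G E F K (sat_bound A) * (f (sat_bound A) + 1))%N.
  have bound_poly := is_poly_sat_bound; apply: is_polyM.
    exact: is_poly_comp (is_poly_sat_prog_cost _ _ _ _ _) bound_poly.
  by apply: is_polyD; [exact: is_poly_comp bound_poly|exact: is_polyC].
exists b => n phi yes no m_gt0 distK answer; set V := sat_bound (n + size phi).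
have VE : (sat_prog_bound G E F K phi <= V)%N := sat_prog_bound_leq phi.
set c := 2 `^ ((1 - eps) * n%:R); have c1 : 1 <= c.
  by rewrite /c -[leLHS](powRr0 (2 : R)) ler_powR ?ler1n // mulr_ge0 // subr_ge0.
pose T := Num.truncn (c * (f V)%:R).
have V_ge : (2 * (n + size phi) + 2 <= V)%N.
  by apply: leq_trans VE; rewrite /sat_prog_bound; lia.
have size_le := cvp_word_size_leq VE.
have radius_ok q : (0 < q < K * size phi + 2)%N -> (0 < E * q <= V)%N /\ (0 < F * q <= V)%N.
  by move=> /andP[q0 qJ]; have [Eq Fq] := radius_leq VE qJ; rewrite !muln_gt0 E_gt0 F_gt0 q0.
have calib q : (0 < q < K * size phi + 2)%N ->
    answers P (cvp_word G (positive phi) (E * q)) T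
      (sat_dist (positive phi) <= (E * q)%:R) (gamma * (E * q)%:R < sat_dist (positive phi)).
  by move=> /radius_ok[Eq _]; apply: oracle; rewrite ?size_positive ?cvp_word_size_positive.
have final q : (0 < q < K * size phi + 2)%N -> answers P (cvp_word G phi (F * q)) T
    (sat_dist phi <= (F * q)%:R) (gamma * (F * q)%:R < sat_dist phi).
  by move=> /radius_ok[_ Fq]; exact: oracle.
have [N [st [ex cost_N [q [q_cal acc rej]]]]] :=
  sat_prog_runs nforms_gt0 P_discrete E_gt0 VE distK calib final (dist_ge0 _ _ p_gt0).
exists N, st; have [q_yes q_no] := answer q q_cal; split=> //.
- apply: (@le_trans _ _ (c * (sat_prog_cost k G E F K V * (f V + 1))%:R)); last first.
    by rewrite ler_wpM2l ?(le_trans ler01) // ler_nat; exact: bound_b.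
  apply: (@le_trans _ _ (sat_prog_cost k G E F K V * T.+1)%:R); first by rewrite ler_nat.
  rewrite !natrM mulrCA ler_wpM2l //.
  have : T%:R <= c * (f V)%:R by rewrite truncn_le mulr_ge0 // (le_trans ler01).
  by rewrite -natr1 natrD; lra.
- by move=> /q_yes.
- by move=> /q_no.
Qed.

End SatFromCvp.

Lemma exists_nat_ge (R : realType) (x : R) : exists2 N, (0 < N)%N & x <= N%:R.
Proof. by exists (Num.truncn x).+1 => //; apply/ltW/truncnS_gt. Qed.

Lemma exists_rounding_error (R : realType) (C x : R) : 1 <= C -> 1 < x ->
  exists e, [/\ 0 < e, C / 2 <= C - e & C + e <= x * (C - e)].
Proof.
move=> C1 x1; exists (C * (x - 1) / (2 * x)).
have e0 : 0 < C * (x - 1) / (2 * x) by rewrite divr_gt0 ?mulr_gt0; lra.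
have eE : C * (x - 1) / (2 * x) * (2 * x) = C * (x - 1) by field; lra.
move: (C * (x - 1) / (2 * x)) e0 eE => e e0 eE; split=> //.
  have x0 : 0 < 2 * x by lra.
  have : e <= C / 2 by rewrite -(ler_pM2r x0) eE; lra.
  by lra.
have : e * (1 + x) <= e * (2 * x) by rewrite ler_wpM2l; lra.
by lra.
Qed.

Section Roots.
Variables (R : realType) (p : R).
Hypothesis p_ge1 : 1 <= p.

Lemma root_gt1 (x : R) : 1 < x -> 1 < x `^ p^-1.
Proof.
move=> x1; have p0 : 0 < p by exact: lt_le_trans p_ge1.
by rewrite /powR gt_eqF ?(lt_trans ltr01) // expR_gt1 mulr_gt0 ?invr_gt0 ?ln_gt0.
Qed.

Lemma root_le_id (x : R) : 1 <= x -> x `^ p^-1 <= x.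
Proof.
move=> x1; rewrite -[leRHS]powRr1 ?(le_trans ler01) // ler_powR // invf_le1 //.
exact: lt_le_trans p_ge1.
Qed.

Lemma half_root_powR (x : R) : 0 <= x -> x / 2 <= (x `^ p / 2) `^ p^-1.
Proof.
move=> x0; have p0 : 0 < p by exact: lt_le_trans p_ge1.
rewrite powRM ?powR_ge0 // -powRrM mulfV ?gt_eqF // powRr1 // ler_wpM2l //.
rewrite -[leLHS]powRr1 // ger_powR //; last by rewrite invf_le1.
by rewrite invr_gt0 ltr0n /= invf_le1 ?ler1n.
Qed.

Lemma powR_rootX (x u : R) n : 0 <= x -> 0 <= u ->
  (x `^ p^-1) ^+ n * u `^ p^-1 = (x ^+ n * u) `^ p^-1.
Proof.
move=> x0 u0; rewrite powRM ?exprn_ge0 //; congr (_ * _).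
by rewrite -(powR_mulrn n (powR_ge0 x p^-1)) -powRrM mulrC powRrM powR_mulrn.
Qed.

End Roots.

Section DistanceGap.
Variables (R : realType) (p : R) (k : nat) (delta : R).
Hypotheses (p_ge1 : 1 <= p) (k_gt0 : (0 < k)%N) (delta_gt0 : 0 < delta).

(* The threshold U depends only on the number of clauses, so that it can be
   estimated on a formula known to be satisfiable. *)
Definition distance_gap (g : R) (G : forms int) (U : nat -> R) : Prop :=
  forall n (phi : formula k n), (0 < size phi)%N ->
    [/\ U (size phi) <= sat_dist p G phi,
        satisfiable phi -> sat_dist p G phi <= g * U (size phi)
      & val_sat R phi < 1 - delta -> g ^+ 7 * U (size phi) <= sat_dist p G phi].

Lemma satisfiable_val_sat n (phi : formula k n) : (0 < size phi)%N -> satisfiable phi ->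
  val_sat R phi = 1.
Proof.
move=> m_gt0 [a]; rewrite all_count => /eqP a_sat; apply/le_anti; rewrite val_sat_le1 //=.
have m0 : 0 < (size phi)%:R :> R by rewrite ltr0n.
by rewrite -(ler_pM2r m0) mul1r; have := count_val_sat R m_gt0 a; rewrite a_sat.
Qed.

Lemma clause_gadget_distance_gap (x lo lo' hi hi' : R) (G : forms int) :
  clause_gadget p k (map_forms intr G) lo hi lo' hi' -> 0 <= lo <= lo' -> 0 <= x -> hi <= x * lo ->
  x ^+ 7 * lo <= lo + delta * (lo' - lo) ->
  distance_gap (x `^ p^-1) G (fun m => (m%:R * lo) `^ p^-1).
Proof.
move=> gadget /andP[lo0 lo_le] x0 hi_le gap n phi m_gt0.
have p0 : 0 < p by exact: lt_le_trans p_ge1.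
have lo_ge : 0 <= lo <= lo' by rewrite lo0.
have low u : 0 <= u -> u <= mean_cost phi lo lo' ->
    ((size phi)%:R * u) `^ p^-1 <= sat_dist p G phi.
  move=> u0 u_le; apply: le_trans (dist_sat_ge p0 gadget m_gt0 lo_ge).
  by apply: le_root; rewrite ?mulr_ge0 // ler_wpM2l.
have meanE : mean_cost phi lo lo' = lo + (1 - val_sat R phi) * (lo' - lo).
  by rewrite /mean_cost; ring.
have v1 := val_sat_le1 R m_gt0; split.
- by apply: low; rewrite // meanE lerDl mulr_ge0 ?subr_ge0.
- move=> phi_sat; apply: le_trans (dist_sat_le p0 gadget m_gt0) _.
  rewrite /mean_cost (satisfiable_val_sat m_gt0 phi_sat) mul1r subrr mul0r addr0.
  rewrite -[x `^ _]expr1 powR_rootX ?mulr_ge0 // expr1 mulrCA; apply: le_root => //.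
    have [sat_bounds _ _] := gadget; rewrite mulr_ge0 //.
    have ones : satisfying k (fun=> 1 : R) by split; [move=> i _; left|exists 0%N].
    by have /andP[lo_c c_hi] := sat_bounds _ ones; rewrite (le_trans lo0) // (le_trans lo_c).
  by rewrite ler_wpM2l.
move=> v_lt; rewrite powR_rootX ?mulr_ge0 // mulrCA; apply: low.
  by rewrite mulr_ge0 ?exprn_ge0.
apply: le_trans gap _; rewrite meanE lerD2l ler_wpM2r ?subr_ge0 //; lra.
Qed.

Lemma exists_gap_factor (C rho : R) : 0 < C -> 0 < rho ->
  exists2 x, 1 < x & x ^+ 7 * C = C + delta * rho.
Proof.
move=> C0 rho0; have ratio1 : 1 < 1 + delta * rho / C by rewrite ltrDl divr_gt0 ?mulr_gt0.
exists (expR (ln (1 + delta * rho / C) / 7)).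
  by rewrite expR_gt1 divr_gt0 // ln_gt0.
rewrite -expRM_natl [7%:R * _]mulrC divfK ?pnatr_eq0 // lnK; last by rewrite posrE; lra.
by field; lra.
Qed.

Lemma exists_distance_gap (rho : R) (G : forms R) : 0 < rho -> exact_gadget p k rho G ->
  exists2 g, 1 < g & forall M, exists G' U K,
    [/\ (0 < nforms G')%N, isolates_variables k (map_forms intr G' : forms R),
        distance_gap g G' U & forall m, (0 < m)%N -> M <= U m /\ g * U m <= (K * m)%:R].
Proof.
move=> rho0 exactG; set C := sat_cost p rho k; have C1 : 1 <= C := sat_cost_ge1 p rho k.
have [x x1 x7] : exists2 x, 1 < x & x ^+ 7 * C = C + delta * rho.
  by apply: exists_gap_factor => //; exact: lt_le_trans C1.
have [e [e0 e_half e_gap]] := exists_rounding_error C1 x1.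
exists (x `^ p^-1); first exact: root_gt1.
move=> M; have [S [S0 MS gadget]] := clause_gadget_integer p_ge1 rho0 exactG (2 * M) e0.
rewrite -/C in gadget; set T := S%:R `^ p in gadget.
have T0 : 0 < T by rewrite powR_gt0 // ltr0n.
have lo0 : 0 <= (C - e) * T by rewrite mulr_ge0 ?(ltW T0) //; lra.
have x0 : 0 <= x by lra.
have [K K0 K_ge] := exists_nat_ge (x * ((C - e) * T)).
exists (integer_gadget p rho k G S), (fun m => (m%:R * ((C - e) * T)) `^ p^-1), K; split.
- by rewrite addn_gt0 k_gt0 orbT.
- exact: isolates_integer_gadget.
- apply: clause_gadget_distance_gap gadget _ _ _ _ => //.
  + by rewrite lo0 ler_wpM2r ?(ltW T0) //; lra.
  + by rewrite mulrA ler_wpM2r ?(ltW T0).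
  have -> : (C - e) * T + delta * ((C + rho - e) * T - (C - e) * T) = (x ^+ 7 * C - e) * T.
    by rewrite x7; ring.
  rewrite mulrA ler_wpM2r ?(ltW T0) // mulrBr lerD2l lerN2.
  by rewrite ler_peMl ?(ltW e0) // exprn_ege1 // ltW.
move=> m m0; have m1 : 1 <= m%:R :> R by rewrite ler1n.
split.
  have M_half : M <= S%:R / 2 by lra.
  apply: le_trans M_half _; apply: le_trans (half_root_powR p_ge1 (ler0n R S)) _.
  apply: le_root; rewrite ?divr_ge0 ?powR_ge0 ?(lt_le_trans ltr01) //.
  apply: (@le_trans _ _ (1 * ((C - e) * T))); last by rewrite ler_wpM2r.
  by rewrite mul1r [T / 2]mulrC ler_wpM2r ?(ltW T0) //; lra.
have mK1 : 1 <= m%:R * K%:R :> R by rewrite -natrM ler1n muln_gt0 m0 K0.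
rewrite natrM [K%:R * _]mulrC; apply: le_trans (root_le_id p_ge1 mK1).
move: ((C - e) * T) lo0 K_ge => lo lo0 K_ge.
rewrite -[x `^ _]expr1 powR_rootX ?mulr_ge0 // expr1.
apply: le_root; rewrite ?(lt_le_trans ltr01) ?mulr_ge0 //.
by rewrite mulrCA ler_wpM2l.
Qed.

End DistanceGap.

Section RadiusFactors.
Variables (R : realType) (g : R).
Hypothesis g_gt1 : 1 < g.

Lemma exists_radius_factors : exists E F : nat,
  [/\ (0 < E)%N, (0 < F)%N, E%:R * g ^+ 2 <= F%:R & F%:R <= E%:R * g ^+ 3].
Proof.
have g0 : 0 < g := lt_trans ltr01 g_gt1.
have d0 : 0 < g ^+ 3 - g ^+ 2.
  have -> : g ^+ 3 - g ^+ 2 = g ^+ 2 * (g - 1) by ring.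
  by rewrite mulr_gt0 ?exprn_gt0 ?subr_gt0.
have [E E0] := exists_nat_ge (g ^+ 3 - g ^+ 2)^-1; rewrite -[leLHS]mul1r ler_pdivrMr // => E_ge.
have F_gt := truncnS_gt (E%:R * g ^+ 2).
have F_le : (Num.truncn (E%:R * g ^+ 2))%:R <= E%:R * g ^+ 2.
  by rewrite truncn_le mulr_ge0 // exprn_ge0 // ltW.
exists E, (Num.truncn (E%:R * g ^+ 2)).+1; split=> //; first exact: ltW.
by rewrite -natr1; lra.
Qed.

Lemma calibrated_radius (E F K k n : nat) (phi : formula k n) (D' U : R) q :
  E%:R * g ^+ 2 <= F%:R -> F%:R <= E%:R * g ^+ 3 -> 0 < U -> U <= D' <= g * U ->
  E%:R <= (g - 1) * U -> calibrated E K phi D' g q ->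
  g * U <= (F * q)%:R /\ g * (F * q)%:R < g ^+ 7 * U.
Proof.
have g0 : 0 < g := lt_trans ltr01 g_gt1.
move=> F_ge F_le U0 /andP[U_le D'_le] E_le [/andP[q0 _] D'_ge D'_le_q]; rewrite natrM; split.
  apply: (@le_trans _ _ (g * (g * (E * q)%:R))).
    by rewrite ler_pM2l // (le_trans U_le).
  have -> : g * (g * (E * q)%:R) = E%:R * g ^+ 2 * q%:R by rewrite natrM; ring.
  by rewrite ler_wpM2r.
have Eq_le : (E * q)%:R <= g ^+ 2 * U.
  have -> : (E * q)%:R = (E * q.-1)%:R + E%:R :> R by rewrite -natrD -mulnSr prednK.
  have : (g - 1) * U <= (g - 1) * (g * U) by rewrite ler_pM2l ?ler_peMl ?subr_gt0 // ltW.
  by move: D'_ge E_le D'_le; rewrite expr2; lra.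
apply: (@le_lt_trans _ _ (g ^+ 4 * (E * q)%:R)).
  have -> : g ^+ 4 * (E * q)%:R = g * (E%:R * g ^+ 3 * q%:R) by rewrite natrM; ring.
  by rewrite ler_pM2l // ler_wpM2r.
apply: (@le_lt_trans _ _ (g ^+ 6 * U)); last first.
  by rewrite ltr_pM2r // [g ^+ 7]exprS ltr_pMl // exprn_gt0.
have -> : g ^+ 6 * U = g ^+ 4 * (g ^+ 2 * U) by ring.
by rewrite ler_pM2l // exprn_gt0.
Qed.

End RadiusFactors.

Section Hardness.
Variables (R : realType) (p : R) (k : nat).
Hypotheses (p_ge1 : 1 <= p) (p_not_even : not_even p) (k_gt0 : (0 < k)%N).

Lemma exists_gadget : exists rho (G : forms R), 0 < rho /\ exact_gadget p k rho G.
Proof.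
pose k' := (k + Num.truncn p + 3)%N.
have pk : p < k'%:R.
  apply: lt_le_trans (truncnS_gt p) _; rewrite ler_nat /k' addn3 ltnS.
  by do 2!apply: leqW; exact: leq_addl.
have k3 : (2 < k')%N by rewrite /k' addn3.
have kk' : (k <= k')%N by rewrite /k' -addnA leq_addr.
have rho0 := gadget_gap_gt0 p_ge1 p_not_even pk.
have p0 : p != 0 by rewrite gt_eqF // (lt_le_trans ltr01).
have [G exactG] := exists_exact_gadget p0 rho0
  (fun j jk => abs_powR_gap p_ge1 p_not_even pk k3 (leq_trans jk kk')).
by exists (gadget_gap p k'), G.
Qed.

Lemma cvp_hardness_gap (delta : R) : 0 < delta -> exists2 gamma : R, 1 < gamma &
  forall (eps : R) (P : prog R), eps <= 1 -> cvp_algorithm p gamma eps P ->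
  exists P', gap_sat_algorithm k delta eps P'.
Proof.
move=> delta0; have [rho [G0 [rho0 exactG]]] := exists_gadget.
have [g g1 gap] := exists_distance_gap p_ge1 k_gt0 delta0 rho0 exactG.
exists g => // eps P eps1 algP; have p0 : 0 < p by exact: lt_le_trans p_ge1.
have [E [F [E0 F0 F_ge F_le]]] := exists_radius_factors g1.
have [G [U [K [L0 G_isolates G_gap U_ge]]]] := gap (E%:R / (g - 1)).
have [b decides] := sat_prog_decides K p0 E0 F0 eps1 L0 G_isolates algP.
exists (sat_prog k G P E F K); split; first by apply: discrete_sat_prog; case: algP.
exists b => n phi m0; have [M_le U_le] := U_ge _ m0.
have EU : E%:R <= (g - 1) * U (size phi) by rewrite mulrC -ler_pdivrMr ?subr_gt0.
have U0 : 0 < U (size phi).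
  by apply: lt_le_trans M_le; rewrite divr_gt0 ?subr_gt0 ?ltr0n.
have m0' : (0 < size (positive phi))%N by rewrite size_positive.
have [pos_ge pos_le _] := G_gap _ (positive phi) m0'; rewrite size_positive in pos_ge pos_le.
have {}pos_le : sat_dist p G (positive phi) <= g * U (size phi).
  by apply: pos_le; exists [ffun=> true]; exact: all_sat_positive.
have [_ sat_le unsat_ge] := G_gap _ phi m0.
apply: decides => // [|q q_cal]; first exact: le_trans pos_le U_le.
have pos_bounds : U (size phi) <= sat_dist p G (positive phi) <= g * U (size phi) by rewrite pos_ge.
have [gU_le gFq_lt] := calibrated_radius g1 F_ge F_le U0 pos_bounds EU q_cal.
split=> [/sat_le sat|/unsat_ge unsat]; first exact: le_trans sat gU_le.
exact: lt_le_trans gFq_lt unsat.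
Qed.

End Hardness.

Lemma cvp_algorithm_le (R : realType) (p gamma eps eps' : R) (P : prog R) : eps' <= eps ->
  cvp_algorithm p gamma eps P -> cvp_algorithm p gamma eps' P.
Proof.
move=> ee [P_discrete [a alg]]; split => //; exists a => n d B t r B' t' r' inst.
have [N [st [ex cost_N yes no]]] := alg n d B t r inst; exists N, st; split => //.
by apply: le_trans cost_N _; rewrite ler_wpM2r // ler_powR ?ler1n // ler_wpM2r //; lra.
Qed.

Theorem theorem4p2 (R : realType) :
  (forall (p : R) (k : nat) (s c : R),
     1 <= p -> (forall z : int, p <> 2 * z%:~R) ->
     Num.max 2 p < k%:R ->
     1 - 2 ^- k < s -> s <= c -> c <= 1 ->
     exists gamma : R,
       1 + (2 ^+ (k - 1)) / (2 ^+ k - 1) * (c - s)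
           * (`|sin (pi * p / 2)| / (4 * p ^+ 3 * k%:R))
           * ((2 * p) / ((expR 1) ^+ 2 * pi ^+ 2 * k%:R)) `^ ((p + 1) / 2)
         <= gamma
       /\ karp_reduction_gapsat_cvp k s c p gamma)
  /\
  (Gap_SETH R ->
   forall p eps : R,
     1 <= p -> (forall z : int, p <> 2 * z%:~R) -> 0 < eps ->
     exists gamma : R,
       1 < gamma /\ ~ exists P : prog R, cvp_algorithm p gamma eps P).
Proof.
split=> [p k s c p1 p_not_even k_gt s_gt sc c1|seth p eps p1 p_not_even eps0].
  exact: exists_karp_reduction.
have eps'0 : 0 < Num.min eps 1 by rewrite lt_min eps0 ltr01.
have [k [delta [k0 delta0 hard]]] := seth _ eps'0.
have [gamma gamma1 alg] := cvp_hardness_gap p1 p_not_even k0 delta0.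
exists gamma; split => // -[P algP]; apply: hard.
apply: (alg (Num.min eps 1) P); first by rewrite ge_min lexx orbT.
by apply: cvp_algorithm_le algP; rewrite ge_min lexx.
Qed.
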